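(* Let $2<p<6$ and $\frac p2+1<q<4$, or $p>6$ and $4\leq q<\frac p2+1$. Then there exists $\widetilde{\mu}_{p,q}>0$ such that $$\mathcal{E}_{p,q}(\mu)\begin{cases}=0, & \text{if }\mu\leq\widetilde{\mu}_{p,q},\\ <0, & \text{if }\mu>\widetilde{\mu}_{p,q},\end{cases}$$ $\mathcal{E}_{p,q}$ is strictly decreasing on $[\widetilde{\mu}_{p,q},+\infty)$, and $$\lim_{\mu\to+\infty}\mathcal{E}_{p,q}(\mu)\begin{cases}=-\infty, & \text{if }2<p<6,\ \frac p2+1<q<4,\\ >-\infty, & \text{if }p>6,\ 4\leq q<\frac p2+1.\end{cases}$$ Moreover, when $q\neq4$, ground states exist at mass $\mu>0$ if and only if $\mu\geq\widetilde{\mu}_{p,q}$. Conversely, when $q=4$, it holds $\widetilde{\mu}_{p,4}=2$ for every $p>6$, ground states exist at mass $\mu>0$ if and only if $\mu>2$ and, for all such masses, they are unique up to a change of sign.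
   Context: Functions are real-valued. For $p,q>2$, $E_{p,q}(v):=\frac12\|v'\|_{L^2(\mathbb{R})}^2+\frac1p\|v\|_{L^p(\mathbb{R})}^p-\frac1q|v(0)|^q$ for $v\in H^1(\mathbb{R})$. For $\mu\geq0$, $H^1_\mu(\mathbb{R}):=\{v\in H^1(\mathbb{R}):\|v\|_{L^2(\mathbb{R})}^2=\mu\}$ and $\mathcal{E}_{p,q}(\mu):=\inf_{u\in H^1_\mu(\mathbb{R})}E_{p,q}(u)$. A ground state at mass $\mu$ is a function $u\in H^1_\mu(\mathbb{R})$ with $E_{p,q}(u)=\mathcal{E}_{p,q}(\mu)$. *)

(* Defs.v *)
From HB Require Import structures.
From mathcomp Require Export all_boot all_order all_algebra.
From mathcomp Require Export all_classical all_reals all_analysis.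
Export Order.TTheory GRing.Theory Num.Theory.
Export numFieldNormedType.Exports.

Set Implicit Arguments.
Unset Strict Implicit.
Unset Printing Implicit Defensive.

Local Open Scope classical_set_scope.
Local Open Scope ring_scope.

Section Energy.
Context {R : realType}.
Implicit Types (v g phi : R -> R) (p q m : R).

Definition Lpnorm p v : \bar R := 'N[@lebesgue_measure R]_(p%:E)[EFin \o v].

Definition L2 : set (R -> R) := [set v | v \in Lfun (@lebesgue_measure R) 2%:E].

(* The test functions are C^1, as in Brezis's definition of W^{1,p} on an
   interval. *)
Definition C1c : set (R -> R) :=
  [set phi : R -> R | [/\ forall x, derivable phi x 1,
     continuous (derive1 phi) & compact (closure [set x | phi x != 0])]].

Definition is_weak_derivative v g :=
  forall phi, C1c phi ->
    \int[lebesgue_measure]_(x in [set: R]) (v x * derive1 phi x) =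
    - \int[lebesgue_measure]_(x in [set: R]) (g x * phi x).

(* Each class of H^1(R) is represented by its unique continuous member, so that
   v 0 is meaningful and equality of classes is equality of functions. *)
Definition H1 : set (R -> R) :=
  [set v | [/\ continuous v, L2 v & exists2 g, L2 g & is_weak_derivative v g]].

(* The weak derivative is unique up to a null set; one representative of it is
   chosen (the default value is irrelevant on H1). *)
Definition weak_derivative v : R -> R :=
  xget (cst 0) [set g | L2 g /\ is_weak_derivative v g].

(* Extended-real valued; it is finite on H1. *)
Definition energy p q v : \bar R :=
  ((2^-1)%:E * Lpnorm 2 (weak_derivative v) `^ 2
   + (p^-1)%:E * Lpnorm p v `^ p
   - (q^-1 * `|v 0| `^ q)%R%:E)%E.

Definition H1mass m : set (R -> R) :=
  [set v | H1 v /\ (Lpnorm 2 v `^ 2 = m%:E)%E].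

Definition ground_energy p q m : \bar R := ereal_inf [set energy p q v | v in H1mass m].

Definition ground_state p q m v :=
  H1mass m v /\ energy p q v = ground_energy p q m.

End Energy.

(* Main.v *)
(* Fix the height A = u(0) > 0 and add a Lagrange multiplier (w/2)||u||_2^2: the
   energy becomes convex, and its unique minimiser is the even decreasing solution
   of W'' = W^(p-1) + w W with W(0) = A. For w = t A^(p-2) this is
   A U_t(A^(p/2-1) x), and the substitution r = U_t^2 expresses its mass as
   A^(3-p/2) m(t) and its energy through m(t) and g(t), the integrals over [0,1] of
   ((2/p) r^(p/2-1) + t)^(-1/2) and of its inverse. Minimising at mass mu thus
   reduces to minimising over t >= 0 a function F(t, mu) that has the sign of
   (N(t)/mu)^s - 1, where s = (q-p/2-1)/(3-p/2) lies in (0,1] and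
   N(t) = m(t) (q (g(t) - t m(t)/2))^(1/s). The critical mass is the infimum of N.
   If q <> 4 then s < 1, and N blows up at both ends because m g >= 1, so that the
   infimum is attained. If q = 4 then N > 2 and N tends to 2 as t goes to infinity;
   stationarity under mass-preserving dilations then reads
   2 (2/p + t)^(1/2) m(t) = mu, whose left-hand side is strictly decreasing in t,
   and this gives uniqueness. *)

Require Import Defs.
From mathcomp Require Import ring lra measurable_realfun.

Local Open Scope classical_set_scope.
Local Open Scope ring_scope.

Set Implicit Arguments.
Unset Strict Implicit.
Unset Printing Implicit Defensive.

(** * Smooth test functions *)

Section TestFunctions.
Context {R : realType}.
Implicit Types (x y t s e : R).

(** The convexity inequality holds for every multiplier, but it is sharp only if the profile of
    height [A] has exactly the mass mu, that is [A^(3-p/2) m(t) = mu]; the obstacle is that this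
    equation in [t] may have no solution. If [p > 6], [m] is unbounded near 0 and a solution exists
    for every height, but [t = 0] is lost. If [p < 6], [m] is bounded by [m(0)]; when mu is too
    large for the height of [u], the bound at [t = 0] does not see the mass and equals the energy of
    a profile of smaller mass. Then [u] either has positive energy or is strictly beaten by a higher
    profile of mass mu. The gap in the inequality is half the squared L^2 norm of [u' - W'], so
    equality identifies [u]; this is what turns uniqueness of [t] into uniqueness of the ground
    state. Profiles have a corner at 0, hence everything is done on the two half-lines. The
    first-order term is handled by Fubini, which avoids boundary terms at infinity. The profile
    itself is explicit, since [W^(1-p/2)] satisfies a linear equation on the right half-line. *)

Definition pos2 t : R := Num.max 0 t ^+ 2.

Lemma is_derive_pos2 t : is_derive t 1 pos2 (2 * Num.max 0 t).
Proof.
have [t0|t0|->] := ltgtP t 0.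
- rewrite mulr0.
  apply: (near_eq_is_derive (f := cst (0:R))).
    near=> s; rewrite /pos2 max_l ?expr0n//= ltW//.
    by near: s; exact: lt_nbhsl.
- apply: (near_eq_is_derive (f := fun s => s ^+ 2)).
    near=> s; rewrite /pos2 max_r// ltW//.
    by near: s; exact: lt_nbhsr.
  apply: is_derive_eq; rewrite /GRing.scale/=; ring.
- rewrite mulr0.
  have H : h^-1 *: (pos2 (h *: 1 + 0) - pos2 0) @[h --> 0^'] --> (0 : R).
    apply/cvgrPdist_le => /= e e0; near=> h.
    have h0 : h != 0 by near: h; exact: nbhs_dnbhs_neq.
    rewrite /pos2 [h *: 1]mulr1 addr0 maxxx expr0n subr0 sub0r normrN.
    rewrite /GRing.scale/= normrM normrV ?unitfE// normrX.
    rewrite ler_pdivrMl ?normr_gt0// expr2.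
    have hh : `|Num.max 0 h| <= `|h|.
      by have [h1|h1] := leP h 0; rewrite ?normr0// normr_ge0.
    rewrite ler_pM// (le_trans hh)//.
    near: h; apply: dnbhs0_le => //.
  by split; [apply/cvg_ex; exists 0|exact/cvg_lim].
Unshelve. all: by end_near. Qed.

(** A second difference of [pos2]: a piecewise quadratic step rising from 0 to 1 on [0, 1]. Its
    derivative is a hat function, so it has just the C^1 regularity that [C1c] asks for. *)
Definition ramp s : R := 2 * (pos2 s - 2 * pos2 (s - 2^-1) + pos2 (s - 1)).
Definition ramp' s : R :=
  4 * (Num.max 0 s - 2 * Num.max 0 (s - 2^-1) + Num.max 0 (s - 1)).

Lemma is_derive_pos2_shift a t :
  is_derive t 1 (fun s => pos2 (s - a)) (2 * Num.max 0 (t - a)).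
Proof.
have H := is_derive_pos2 (t - a).
have := @is_derive1_comp _ pos2 (fun s => s - a) t _ _ H _.
move=> /(_ 1); rewrite mulr1; apply.
by apply: is_derive_eq; rewrite subr0.
Qed.

Lemma is_derive_ramp t : is_derive t 1 ramp (ramp' t).
Proof.
have H0 := is_derive_pos2 t.
have H1 := is_derive_pos2_shift 2^-1 t.
have H2 := is_derive_pos2_shift 1 t.
rewrite /ramp; apply: is_derive_eq.
by rewrite /GRing.scale/= /ramp'; ring.
Qed.

Lemma ramp'_ge0 s : 0 <= ramp' s.
Proof. by rewrite /ramp'; case: (leP 0 s); case: (leP 0 (s - 2^-1)); case: (leP 0 (s - 1)); lra. Qed.

Lemma ramp_le0 s : s <= 0 -> ramp s = 0.
Proof.
by move=> s0; rewrite /ramp /pos2 !max_l ?expr0n/=; lra.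
Qed.

Lemma ramp_ge1 s : 1 <= s -> ramp s = 1.
Proof. by move=> s0; rewrite /ramp /pos2 !max_r; [|lra..]; field. Qed.

Lemma ramp_itv s : 0 <= ramp s <= 1.
Proof. by rewrite /ramp /pos2; case: (leP 0 s); case: (leP 0 (s - 2^-1)); case: (leP 0 (s - 1)); nra. Qed.

Lemma ramp'_le0 s : s <= 0 -> ramp' s = 0.
Proof. by move=> s0; rewrite /ramp' !max_l; lra. Qed.

Lemma ramp'_ge1 s : 1 <= s -> ramp' s = 0.
Proof. by move=> s0; rewrite /ramp' !max_r; lra. Qed.

Lemma continuous_ramp' : continuous ramp'.
Proof.
have H a : continuous (fun s : R => Num.max 0 (s - a)).
  move=> s; apply: (@continuous_max _ _ (cst 0) (fun s => s - a)).
    exact: cst_continuous.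
  by apply: continuousB => //; exact: cst_continuous.
have H0 : continuous (fun s : R => Num.max 0 s).
  move=> s; apply: (@continuous_max _ _ (cst 0) id) => //.
  exact: cst_continuous.
move=> s; rewrite /ramp'.
apply: cvgM; first exact: cvg_cst.
apply: cvgD; last exact: H.
apply: cvgB; first exact: H0.
apply: cvgM; first exact: cvg_cst.
exact: H.
Qed.

End TestFunctions.

(** * Approximate identities and trapezoidal test functions *)

Section WeakDerivative.
Context {R : realType}.
Notation mu := (@lebesgue_measure R).
Implicit Types (x y t s e : R) (v g phi psi : R -> R).

(** An approximate identity at [x], of mass 1 and supported to the right of [x]. As the derivative
    of a rescaled [ramp], it makes the difference of two bumps the derivative of a compactly
    supported function, [trap]. *)
Definition bump (n : nat) x t : R := n.+1%:R * ramp' (n.+1%:R * (t - x)).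

Lemma is_derive_ramp_scale (n : nat) x t :
  is_derive t 1 (fun s => ramp (n.+1%:R * (s - x))) (bump n x t).
Proof.
have := @is_derive1_comp _ ramp (fun s => n.+1%:R * (s - x)) t _ _ (is_derive_ramp _) _.
move=> /(_ n.+1%:R); rewrite /bump mulrC; apply.
by apply: is_derive_eq; rewrite /GRing.scale/= subr0 mulr1.
Qed.

Lemma continuous_bump n x : continuous (bump n x).
Proof.
move=> t; apply: cvgM; first exact: cvg_cst.
apply: (@continuous_comp _ _ _ (fun t => n.+1%:R * (t - x)) ramp'); last exact: continuous_ramp'.
apply: cvgM; first exact: cvg_cst.
by apply: cvgB; [exact: cvg_id|exact: cvg_cst].
Qed.

Lemma bump_ge0 n x t : 0 <= bump n x t.
Proof. by rewrite mulr_ge0// ramp'_ge0. Qed.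

Lemma bump_out n x t : t <= x \/ x + n.+1%:R^-1 <= t -> bump n x t = 0.
Proof.
rewrite /bump => -[h|h].
  by rewrite ramp'_le0 ?mulr0// pmulr_rle0// subr_le0.
rewrite ramp'_ge1 ?mulr0// -ler_pdivrMl// mulr1 lerBrDl; exact: h.
Qed.

Lemma int_bump n x :
  (\int[mu]_(t in `[x, (x + n.+1%:R^-1)%R]) (bump n x t)%:E = 1)%E.
Proof.
have d t := is_derive_ramp_scale n x t.
rewrite (@continuous_FTC2 _ _ (fun s => ramp (n.+1%:R * (s - x)))).
- by rewrite subrr mulr0 (@ramp_le0 _ 0)// addrAC subrr add0r divff// ramp_ge1// sube0.
- by rewrite ltrDl.
- exact/continuous_subspaceT/continuous_bump.
- have c : continuous (fun s => ramp (n.+1%:R * (s - x))).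
    by move=> t; apply/differentiable_continuous/derivable1_diffP; have [] := d t.
  split; first by move=> t _; have [] := d t.
  + exact/cvg_at_right_filter/c.
  + exact/cvg_at_left_filter/c.
- by move=> t _; rewrite derive1E; apply: derive_val.
Qed.

Lemma closed_support_C1c phi a b :
  (forall x, derivable phi x 1) -> continuous (derive1 phi) ->
  (forall x, x < a \/ b < x -> phi x = 0) -> C1c phi.
Proof.
move=> dphi cphi phi0; split; [exact: dphi|exact: cphi|].
apply: (subclosed_compact _ (@segment_compact _ a b)); first exact: closed_closure.
rewrite [X in _ `<=` X](closure_id _).1; last exact: itv_closed.
apply: closure_subset => x /= /eqP px.
rewrite in_itv/=; apply/andP; split; rewrite leNgt; apply/negP => h; apply: px; apply: phi0; tauto.
Qed.

Definition trap n x y t := ramp (n.+1%:R * (t - x)) - ramp (n.+1%:R * (t - y)).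

Lemma is_derive_trap n x y t :
  is_derive t 1 (trap n x y) (bump n x t - bump n y t).
Proof.
have H1 := is_derive_ramp_scale n x t.
have H2 := is_derive_ramp_scale n y t.
exact: is_deriveB.
Qed.

Lemma derive1_trap n x y : derive1 (trap n x y) = bump n x \- bump n y.
Proof.
apply/funext => t; rewrite derive1E; have h := is_derive_trap n x y t.
exact: derive_val.
Qed.

Lemma trap_lt n x y t : x <= y -> t <= x -> trap n x y t = 0.
Proof.
by move=> xy tx; rewrite /trap !ramp_le0 ?subrr// pmulr_rle0//; lra.
Qed.

Lemma trap_gt n x y t : x <= y -> y + n.+1%:R^-1 <= t -> trap n x y t = 0.
Proof.
move=> xy ty; have n0 : 0 < n.+1%:R^-1 :> R by rewrite invr_gt0.
by rewrite /trap !ramp_ge1 ?subrr// -ler_pdivrMl// mulr1 lerBrDl//; apply: le_trans ty; rewrite lerD2r.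
Qed.

Lemma trap_abs n x y t : `|trap n x y t| <= 1.
Proof.
rewrite /trap ler_norml.
have /andP[] := ramp_itv (n.+1%:R * (t - x)).
have /andP[] := ramp_itv (n.+1%:R * (t - y)); lra.
Qed.

Lemma C1c_trap n x y : x <= y -> C1c (trap n x y).
Proof.
move=> xy; apply: (@closed_support_C1c _ x (y + n.+1%:R^-1)).
- by move=> t; have [] := is_derive_trap n x y t.
- rewrite derive1_trap => t; apply: cvgB; exact: continuous_bump.
- move=> t [h|h]; first by apply: trap_lt => //; exact: ltW.
  by apply: trap_gt => //; exact: ltW.
Qed.

(** The endpoints form a null set and are excluded: at [x] every trapezoid vanishes although the
    indicator is 1. *)
Lemma cvg_trap x y t : x < y -> t != x -> t != y ->
  trap n x y t @[n --> \oo] --> (\1_`[x, y] t : R).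
Proof.
move=> xy tx ty; rewrite indicE.
apply: cvg_near_cst.
have big e : 0 < e -> \forall n \near \oo, n.+1%:R^-1 < e :> R.
  by move=> e0; exact: near_infty_natSinv_lt (PosNum e0).
have [ltx|ltx] := ltP t x.
  rewrite memNset /=; last by rewrite in_itv/= => /andP[]; lra.
  by near=> n; rewrite trap_lt; [|lra|exact: ltW].
have {}ltx : x < t by rewrite lt_neqAle eq_sym tx.
have [gty|gty] := leP t y.
  have {}gty : t < y by rewrite lt_neqAle ty.
  rewrite mem_set /=; last by rewrite in_itv/=; lra.
  near=> n; rewrite /trap [X in _ - X]ramp_le0 ?subr0; last by rewrite pmulr_rle0//; lra.
  rewrite ramp_ge1// -ler_pdivrMl// mulr1; apply: ltW.
  by near: n; apply: big; lra.
rewrite memNset /=; last by rewrite in_itv/= => /andP[]; lra.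
near=> n; rewrite trap_gt//; first lra.
rewrite -lerBrDl; apply: ltW; near: n; apply: big; lra.
Unshelve. all: by end_near. Qed.

End WeakDerivative.

(** * Weak derivatives and integral representation *)

Section Representation.
Context {R : realType}.
Notation mu := (@lebesgue_measure R).
Implicit Types (x y t s e : R) (v g phi psi : R -> R).

Lemma L2_measurable g : L2 g -> measurable_fun setT g.
Proof. by rewrite /L2/= => /sub_Lfun_mfun; rewrite inE. Qed.

Lemma L2_sqr_integrable g : L2 g -> mu.-integrable setT (fun x => (g x ^+ 2)%:E).
Proof. exact: Lfun2_integrable_sqr. Qed.

Lemma L2_itv_integrable g a b : L2 g -> mu.-integrable `[a, b] (EFin \o g).
Proof.
move=> g2; have mg := L2_measurable g2.
have i1 : mu.-integrable `[a, b] (fun x => (1 + g x ^+ 2)%:E).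
  rewrite (_ : (fun x => _) = (fun=> 1%:E) \+ (fun x => (g x ^+ 2)%:E))%E//.
  apply: integrableD => //.
    apply: (@continuous_compact_integrable _ (cst 1)); first exact: segment_compact.
    exact/continuous_subspaceT/cst_continuous.
  exact: (integrableS measurableT _ _ (L2_sqr_integrable g2)).
apply: le_integrable i1 => //.
  by apply/measurable_EFinP; exact: measurable_funTS.
move=> x _ /=; rewrite lee_fin [leRHS]ger0_norm; last by have := sqr_ge0 (g x); lra.
have := sqr_ge0 (`|g x| - 1); rewrite sqrrB1 real_normK ?num_real//.
have := normr_ge0 (g x); nra.
Qed.

Lemma L2_locally_integrable g : L2 g -> locally_integrable setT g.
Proof.
move=> g2; have mg := L2_measurable g2; split => //; first exact: openT.
move=> K _ Kc; have [M [Mr HM]] := compact_bounded Kc.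
have KM : K `<=` `[- (`|M| + 1), `|M| + 1].
  move=> x Kx; have := HM (`|M| + 1) _ x Kx; rewrite /= in_itv/= -ler_norml; apply.
  by rewrite (le_lt_trans (ler_norm M))// ltrDl.
have /integrableP[_] := L2_itv_integrable (- (`|M| + 1)) (`|M| + 1) g2.
apply: le_lt_trans; apply: ge0_subset_integral => //.
  apply: closed_measurable; exact: compact_closed.
by apply/measurable_EFinP; apply: measurableT_comp => //; exact: measurable_funTS.
Qed.

Lemma Rintegral_supp f a b : (forall x, x < a \/ b < x -> f x = 0) ->
  \int[mu]_(x in [set: R]) f x = \int[mu]_(x in `[a, b]) f x.
Proof.
move=> f0; rewrite [RHS]Rintegral_mkcond; apply: eq_Rintegral => x _.
rewrite patchE; case: ifPn => //; rewrite notin_setE/= in_itv/= => /negP.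
by rewrite negb_and -!ltNge => /orP h; exact: f0.
Qed.

Lemma cont_itv_integrable f a b : continuous f -> mu.-integrable `[a, b] (EFin \o f).
Proof.
move=> cf; apply: continuous_compact_integrable; first exact: segment_compact.
exact: continuous_subspaceT.
Qed.

Lemma cont_supp_integrable f a b : continuous f ->
  (forall x, x < a \/ b < x -> f x = 0) -> mu.-integrable setT (EFin \o f).
Proof.
move=> cf f0.
have -> : f = f \_ `[a, b].
  apply/funext => x; rewrite patchE; case: ifPn => //; rewrite notin_setE/= in_itv/= => /negP.
  by rewrite negb_and -!ltNge => /orP h; exact: f0.
rewrite -restrict_EFin; apply/integrable_restrict => //=; rewrite setTI.
exact: cont_itv_integrable.
Qed.

Lemma integrable_mul_bump v n x : continuous v ->
  mu.-integrable setT (EFin \o (fun t => v t * bump n x t)).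
Proof.
move=> cv; apply: (@cont_supp_integrable _ x (x + n.+1%:R^-1)).
  by move=> t; apply: cvgM; [exact: cv|exact: continuous_bump].
move=> t h; rewrite bump_out ?mulr0//.
by case: h => h; [left|right]; exact: ltW.
Qed.

Lemma cvg_bump v x : continuous v ->
  \int[mu]_(t in [set: R]) (v t * bump n x t) @[n --> \oo] --> v x.
Proof.
move=> cv; apply/cvgrPdist_le => e e0.
have /cvgrPdist_le/(_ e e0)[d /= d0 hd] := cv x.
near=> n.
pose c := x + n.+1%:R^-1.
have n0 : 0 < n.+1%:R^-1 :> R by rewrite invr_gt0.
rewrite (@Rintegral_supp _ x c); last first.
  move=> t h; rewrite bump_out ?mulr0//.
  by case: h => h; [left|right]; exact: ltW.
have cb := @continuous_bump R n x.
have ib := cont_itv_integrable x c cb.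
have ivb : mu.-integrable `[x, c] (EFin \o (fun t => v t * bump n x t)).
  by apply: cont_itv_integrable => t; apply: cvgM; [exact: cv|exact: cb].
have I1 : \int[mu]_(t in `[x, c]) bump n x t = 1 by rewrite /Rintegral int_bump.
have -> : v x = \int[mu]_(t in `[x, c]) (v x * bump n x t).
  by rewrite RintegralZl// I1 mulr1.
rewrite -RintegralB//; last first.
  by apply: cont_itv_integrable => t; apply: cvgM; [exact: cvg_cst|exact: cb].
have -> : \int[mu]_(t in `[x, c]) (v x * bump n x t - v t * bump n x t) =
          \int[mu]_(t in `[x, c]) ((v x - v t) * bump n x t).
  by apply: eq_Rintegral => t _; rewrite mulrBl.
have id : mu.-integrable `[x, c] (EFin \o (fun t => (v x - v t) * bump n x t)).
  apply: cont_itv_integrable => t; apply: cvgM; last exact: cb.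
  by apply: cvgB; [exact: cvg_cst|exact: cv].
apply: le_trans (le_normr_Rintegral _ id) _ => //.
rewrite -[leRHS]mulr1 -I1 -RintegralZl//.
apply: le_Rintegral => //.
- have /integrableP[? ?] := id.
  exact: integrable_norm.
- by apply: cont_itv_integrable => t; apply: cvgM; [exact: cvg_cst|exact: cb].
move=> t /= /[!in_itv]/= /andP[xt tc].
rewrite normrM (ger0_norm (bump_ge0 _ _ _)) ler_wpM2r ?bump_ge0//.
apply: hd; rewrite /ball_/= distrC ger0_norm ?subr_ge0// ltrBlDl.
apply: le_lt_trans tc _; rewrite ltrD2l.
near: n; exact: near_infty_natSinv_lt (PosNum d0).
Unshelve. all: by end_near. Qed.

(** Test against [trap n x y]: its derivative is a difference of approximate identities at [x] and
    [y], so one side tends to [v x - v y], while the other tends to minus the integral of [g] over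
    [x, y] by dominated convergence. *)
Lemma weak_derivative_repr v g x y : continuous v -> L2 g ->
  is_weak_derivative v g -> x <= y ->
  v y - v x = \int[mu]_(t in `[x, y]) g t.
Proof.
move=> cv g2 vg; rewrite le_eqVlt => /predU1P[->|xy].
  by rewrite subrr set_itv1 Rintegral_set1.
have mg := L2_measurable g2.
have H n := vg _ (@C1c_trap R n x y (ltW xy)).
have L : \int[mu]_(t in [set: R]) (v t * derive1 (trap n x y) t) @[n --> \oo] -->
    v x - v y.
  have E n : \int[mu]_(t in [set: R]) (v t * derive1 (trap n x y) t) =
      \int[mu]_(t in [set: R]) (v t * bump n x t) - \int[mu]_(t in [set: R]) (v t * bump n y t).
    rewrite -RintegralB//; [|exact: integrable_mul_bump..].
    by apply: eq_Rintegral => t _; rewrite derive1_trap/= mulrBr.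
  under eq_fun do rewrite E.
  by apply: cvgB; exact: cvg_bump.
(* The interval [x, y + 1] contains the supports of all the trapezoids, because
   [n.+1%:R^-1 <= 1]. *)
have Ig := L2_itv_integrable x (y + 1) g2.
have E n : \int[mu]_(t in [set: R]) (g t * trap n x y t) =
           \int[mu]_(t in `[x, y + 1]) (g t * trap n x y t).
  apply: Rintegral_supp => t [h|h].
    by rewrite trap_lt ?mulr0// ltW.
  rewrite trap_gt ?mulr0 ?(ltW xy)//; apply: (le_trans _ (ltW h)).
  by rewrite lerD2l invf_le1// ler1n.
have Rt : \int[mu]_(t in `[x, y + 1]) (g t * trap n x y t) @[n --> \oo] -->
    \int[mu]_(t in `[x, y + 1]) (g t * \1_`[x, y] t).
  have [||||||i1 _ i2] := @dominated_convergence _ _ _ mu `[x, y + 1] _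
    (fun n t => (g t * trap n x y t)%:E) (fun t => (g t * \1_`[x, y] t)%:E)
    (fun t => `|g t|%:E) _ _ _ _ _.
  - by [].
  - move=> n; apply/measurable_EFinP; apply: measurable_funM; first exact: measurable_funTS.
    apply: measurable_funTS; apply: continuous_measurable_fun => t.
    apply/differentiable_continuous/derivable1_diffP.
    by have [] := is_derive_trap n x y t.
  - apply/measurable_EFinP; apply: measurable_funM; first exact: measurable_funTS.
    exact: measurable_indic.
  - exists [set x; y]; split.
    + by apply: measurableU.
    + apply/eqP; rewrite -measure_le0; apply: le_trans (measureU2 _ _ _) _ => //.
      rewrite [X in (X + _)%E](_ : _ = 0%E); last exact: lebesgue_measure_set1.
      by rewrite add0e [X in (X <= _)%E](_ : _ = 0%E)//; exact: lebesgue_measure_set1.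
    + move=> t /= /not_implyP[_ h]; apply: contrapT => /not_orP[/eqP tx /eqP ty]; apply: h.
      apply: cvg_EFin; first by near=> n.
      by apply: cvgM; [exact: cvg_cst|exact: cvg_trap].
  - exact: integrable_norm.
  - apply: aeW => t n _; rewrite /= lee_fin normrM -[leRHS]mulr1 ler_wpM2l//.
    exact: trap_abs.
  by apply: fine_cvg; rewrite fineK//; exact: integrable_fin_num.
have Ei : \int[mu]_(t in `[x, y + 1]) (g t * \1_`[x, y] t) = \int[mu]_(t in `[x, y]) g t.
  rewrite -(@Rintegral_supp (fun t => g t * \1_`[x, y] t)).
    rewrite [RHS]Rintegral_mkcond; apply: eq_Rintegral => t _.
    by rewrite patchE indicE; case: ifPn => _; rewrite ?mulr1 ?mulr0.
  move=> t h; rewrite indicE memNset ?mulr0//= in_itv/= => /andP[]; lra.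
have : \int[mu]_(t in [set: R]) (v t * derive1 (trap n x y) t) @[n --> \oo] -->
    - \int[mu]_(t in `[x, y]) g t.
  by under eq_fun do rewrite H E; rewrite -Ei; exact: cvgN.
move=> /(cvg_unique _ L) h.
by rewrite -[RHS]opprK -h// opprB.
Unshelve. all: by end_near. Qed.
End Representation.

(** * Uniqueness of the weak derivative and its L^2 norm *)

Section Uniqueness.
Context {R : realType}.
Notation mu := (@lebesgue_measure R).
Implicit Types (x y t s e : R) (v g phi psi : R -> R).

Lemma L2B g h : L2 g -> L2 h -> L2 (g \- h).
Proof. move=> g2 h2; have p1 : (1 <= 2%:E :> \bar R)%E by rewrite lee_fin ler1n.
have Nh2 := Lfun_oppr_closed h2.
have [_ H] := @Lfun_addr_closed _ _ R mu _ p1.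
exact: (H _ _ g2 Nh2). Qed.

(** At a Lebesgue point [x] the value of [d] is the derivative of its primitive, and the primitive
    based at [x - 1] vanishes near [x]. *)
Lemma itv_integral_eq0_ae d : L2 d ->
  (forall x y, x <= y -> \int[mu]_(t in `[x, y]) d t = 0) -> ae_eq mu setT d (cst 0).
Proof.
move=> d2 d0; have := lebesgue_differentiation (L2_locally_integrable d2).
apply: filterS; first exact: (ae_filter_ringOfSetsType mu).
move=> x dx _.
have xx : x < x + 1 by rewrite ltrDl.
have := @FTC1_lebesgue_pt R d (BLeft (x - 1)) x (x + 1) xx (L2_itv_integrable _ _ d2).
move=> /= H; case: H => // [|_ <-].
  by rewrite lte_fin ltrBlDr ltrDl.
rewrite derive1E (@near_eq_derive _ _ _ _ (cst 0)) ?derive_cst//.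
near=> y; rewrite d0//; apply: ltW; near: y.
by apply: lt_nbhsr; rewrite ltrBlDr ltrDl.
Unshelve. all: by end_near. Qed.

Lemma weak_derivative_unique v g1 g2 : continuous v -> L2 g1 -> L2 g2 ->
  is_weak_derivative v g1 -> is_weak_derivative v g2 -> ae_eq mu setT g1 g2.
Proof.
move=> cv l1 l2 w1 w2.
have := @itv_integral_eq0_ae (g1 \- g2) (L2B l1 l2) _.
move=> H; have {}H := H _.
have : ae_eq mu setT (g1 \- g2) (cst 0).
  apply: H => x y xy.
  rewrite RintegralB//; [|exact: L2_itv_integrable..].
  by rewrite -!(weak_derivative_repr (v := v))// subrr.
apply: filterS => x /= /(_ I) h _.
by apply/eqP; rewrite -subr_eq0; apply/eqP.
Qed.

Lemma L2_Lpnorm g : L2 g -> (Lpnorm 2 g `^ 2 = (\int[mu]_x (g x ^+ 2))%:E)%E.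
Proof.
move=> g2; rewrite /Lpnorm powR_Lnorm//.
rewrite /Rintegral fineK; last exact/integrable_fin_num/L2_sqr_integrable.
by apply: eq_integral => x _ /=; rewrite powR_mulrn// real_normK// num_real.
Qed.

Lemma weak_derivativeP v : H1 v -> L2 (weak_derivative v) /\ is_weak_derivative v (weak_derivative v).
Proof.
move=> [_ _ [g g2 vg]].
by rewrite /weak_derivative; case: xgetP => [h _ //|/(_ g)]; case.
Qed.

(** The energy refers to a chosen representative of the weak derivative; this allows it to be
    computed with any explicit one. *)
Lemma Lpnorm_weak_derivative v g : H1 v -> L2 g -> is_weak_derivative v g ->
  (Lpnorm 2 (weak_derivative v) `^ 2 = (\int[mu]_x (g x ^+ 2))%:E)%E.
Proof.
move=> hv g2 vg; have [w2 vw] := weak_derivativeP hv.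
rewrite L2_Lpnorm//; congr EFin; congr fine.
apply: ae_eq_integral => //.
- by have /integrableP[] := L2_sqr_integrable w2.
- by have /integrableP[] := L2_sqr_integrable g2.
case: hv => cv _ _.
have := weak_derivative_unique cv w2 g2 vw vg.
by apply: filterS => x /= /(_ I) ->.
Qed.
End Uniqueness.

(** * Convexity bound on the half-line *)

Section HalfLine.
Context {R : realType}.
Notation mu := (@lebesgue_measure R).
Implicit Types (x y t s e : R) (v g phi psi f d : R -> R).

Lemma integral_comp_opp (f : R -> \bar R) D : measurable D -> measurable_fun D f ->
  (\int[mu]_(x in D) f x = \int[mu]_(x in -%R @^-1` D) f (- x)%R)%E.
Proof.
move=> mD mf.
have H (h : R -> \bar R) : measurable_fun D h -> (forall x, 0 <= h x)%E ->
    (\int[mu]_(x in D) h x = \int[mu]_(x in -%R @^-1` D) h (- x)%R)%E.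
  move=> mh h0.
  transitivity (\int[pushforward mu (-%R : _ -> measurableTypeR R)]_(x in D) h x)%E.
    by apply: eq_measure_integral => //= A mA AS; exact/esym/lebesgue_measureN.
  by rewrite ge0_integral_pushforward.
rewrite integralE [RHS]integralE; congr (_ - _)%E.
  rewrite (H f^\+%E); [by apply: eq_integral => x _; rewrite !funeposE|exact: measurable_funepos|move=> x; exact: funepos_ge0].
rewrite (H f^\-%E); [by apply: eq_integral => x _; rewrite !funenegE|exact: measurable_funeneg|move=> x; exact: funeneg_ge0].
Qed.

Lemma Rintegral_comp_opp f D : measurable D -> measurable_fun D f ->
  \int[mu]_(x in D) f x = \int[mu]_(x in -%R @^-1` D) f (- x).
Proof.
move=> mD mf; rewrite /Rintegral (@integral_comp_opp (EFin \o f))//.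
exact/measurable_EFinP.
Qed.

Lemma ge0_integral_line (f : R -> \bar R) : measurable_fun setT f ->
  (forall x, 0 <= f x)%E ->
  (\int[mu]_x f x = \int[mu]_(x in `[0%R, +oo[) f x + \int[mu]_(x in `[0%R, +oo[) f (- x)%R)%E.
Proof.
move=> mf f0.
have -> : [set: R] = `[0, +oo[ `|` `]-oo, 0[.
  by apply/seteqP; split => // x _ /=; rewrite !in_itv/= andbT; case: (leP 0 x) => h; [left|right].
rewrite ge0_integral_setU//=; last 2 first.
- exact: measurable_funTS.
- apply/disj_setPS => x [/=]; rewrite !in_itv/= andbT; lra.
congr (_ + _)%E.
rewrite integral_itv_bndo_bndc; last exact: measurable_funTS.
rewrite (@ge0_integration_by_substitution0 _ (fun x => f (- x)))//.
  by apply: eq_integral => x _; rewrite opprK.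
exact: measurableT_comp.
Qed.

(** In the application [psi] is [W''], [Z] is [W'] and [d] is [u' - W']. Fubini on the triangle 0 <=
    y <= x takes the place of integration by parts: integrating [psi] over [y, +oo[ gives [- Z y],
    and no boundary term at infinity arises. *)
Lemma half_line_by_parts d psi (Z : R -> R) :
  measurable_fun setT d -> measurable_fun setT psi ->
  (forall x, 0 <= x -> 0 <= psi x) ->
  (forall a, mu.-integrable `[0, a] (EFin \o d)) ->
  (forall y, 0 <= y -> (\int[mu]_(x in `[y, +oo[) (psi x)%:E = (- Z y)%:E)%E) ->
  mu.-integrable `[0, +oo[ (fun y => (Z y * d y)%:E) ->
  mu.-integrable `[0, +oo[ (fun x => (psi x * \int[mu]_(y in `[0, x]) d y)%:E) /\
  \int[mu]_(x in `[0, +oo[) (psi x * \int[mu]_(y in `[0, x]) d y) =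
  - \int[mu]_(y in `[0, +oo[) (Z y * d y).
Proof.
move=> md mpsi psi0 iD psiZ iZd.
pose E := [set z : R * R | (0 <= z.2) && (z.2 <= z.1)].
have mE : measurable E.
  have -> : E = (fun z : R * R => z.2) @^-1` `[0, +oo[ `&`
                (fun z : R * R => z.1 - z.2) @^-1` `[0, +oo[.
    by apply/seteqP; split => z; rewrite /E /= !in_itv/= !andbT subr_ge0 => /andP.
  apply: measurableI; rewrite -[X in measurable X]setTI.
    by apply: measurable_snd.
  apply: measurable_funB => //.
pose f (z : R * R) := (psi z.1 * d z.2 * \1_E z)%:E.
have mf : measurable_fun setT f.
  apply/measurable_EFinP; apply: measurable_funM; last exact: measurable_indic.
  by apply: measurable_funM; apply: measurableT_comp.
have Fx x : (\int[mu]_y f (x, y) =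
    ((fun x => (psi x * \int[mu]_(y in `[0%R, x]) d y)%:E) \_ `[0%R, +oo[) x)%E.
  rewrite patchE; case: ifPn => [|]; rewrite ?inE ?notin_setE/= in_itv/= andbT => x0; last first.
    apply: integral0_eq => y _; rewrite /f/= indicE memNset ?mulr0//= /E/=.
    by move=> /andP[h1 h2]; apply: x0; exact: le_trans h2.
  rewrite EFinM /Rintegral fineK; last exact: integrable_fin_num.
  rewrite -integralZl//.
  rewrite [RHS]integral_mkcond; apply: eq_integral => y _.
  rewrite patchE /f/= indicE.
  case: ifPn => [|]; rewrite ?inE ?notin_setE/= in_itv/= => yx.
    by rewrite mem_set// mulr1 EFinM.
  by rewrite memNset// mulr0.
(* The factor [c] is left free in order to use the identity both with the absolute value of [d], for
   integrability on the product, and with [d] itself. *)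
have Gy (c : R -> R) y : (\int[mu]_x (psi x * c y * \1_E (x, y))%:E =
    ((fun y => (- (Z y * c y))%:E) \_ `[0%R, +oo[) y)%E.
  rewrite patchE; case: ifPn => [|]; rewrite ?inE ?notin_setE/= in_itv/= andbT => y0; last first.
    apply: integral0_eq => x _; rewrite indicE memNset ?mulr0//= /E/=.
    by move=> /andP[h1 h2]; exact: y0.
  rewrite -mulNr mulrC EFinM -psiZ//.
  rewrite -integralZl//; last first.
    apply/integrableP; split; first by apply/measurable_EFinP; exact: measurable_funTS.
    under eq_integral.
      move=> x; rewrite inE/= in_itv/= andbT => yx.
      rewrite ger0_norm ?psi0 ?(le_trans y0)//.
      over.
    by rewrite psiZ// ltry.
  rewrite [RHS]integral_mkcond; apply: eq_integral => x _.
  rewrite patchE indicE.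
  case: ifPn => [|]; rewrite ?inE ?notin_setE/= in_itv/= andbT => yx.
    by rewrite mem_set ?mulr1 1?mulrC//= /E/= y0 yx.
  by rewrite memNset ?mulr0// /E/= => /andP[].
(* Tonelli, integrating in [x] first: since [psi] is nonnegative on the half-line, the inner
   integral of the absolute value of [f] is that of [Z y * d y], integrable by hypothesis. *)
have imf : (mu \x mu)%E.-integrable setT f.
  apply/(@integrable21ltyP _ _ _ _ R mu mu f mf).
  have -> : (\int[mu]_y \int[mu]_x `|f (x, y)| = \int[mu]_(y in `[0%R, +oo[) `|(Z y * d y)%:E|)%E.
    rewrite [RHS]integral_mkcond; apply: eq_integral => y _.
    have := Gy (fun y => `|d y|) y.
    transitivity (\int[mu]_x (psi x * `|d y| * \1_E (x, y))%:E)%E.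
      apply: eq_integral => x _; rewrite /f /= indicE.
      have [|_] := boolP ((x, y) \in E); last by rewrite !mulr0 normr0.
      rewrite inE /E/= => /andP[h1 h2]; rewrite !mulr1 normrM (ger0_norm (psi0 _ _))//.
      exact: le_trans h2.
    apply: (etrans H); rewrite !patchE; case: ifPn => //; rewrite inE/= in_itv/= andbT => y0.
    rewrite normrM [in RHS]ler0_norm ?mulNr//.
    rewrite -oppr_ge0 -lee_fin -psiZ//; apply: integral_ge0 => x /=.
    by rewrite in_itv/= andbT => yx; rewrite lee_fin psi0// (le_trans y0).
  by have /integrableP[] := iZd.
have I1 := integrable_fubini_F imf.
have F1 := integral12_prod_meas1 imf.
have F2 := integral21_prod_meas1 imf.
have FE : fubini_F mu f = (fun x => (psi x * \int[mu]_(y in `[0%R, x]) d y)%:E) \_ `[0%R, +oo[.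
  by apply/funext => x; exact: Fx.
split; first by apply/integrable_mkcond => //; rewrite -FE.
rewrite -[RHS]mulN1r -RintegralZl// /Rintegral; congr fine.
transitivity (\int[mu]_x (fubini_F mu f x))%E; first by rewrite integral_mkcond -FE.
apply: (etrans F1); apply: (etrans (esym F2)).
transitivity (\int[mu]_y ((fun y => (- (Z y * d y))%:E) \_ `[0%R, +oo[) y)%E.
  by apply: eq_integral => y _; exact: Gy.
rewrite -integral_mkcond.
by apply: eq_integral => y _; rewrite mulN1r.
Qed.

End HalfLine.

(** * The profile equation and its first integral *)

Section Profile.
Context {R : realType}.
Notation mu := (@lebesgue_measure R).
Implicit Types (x y t s e : R) (p w A : R) (u g d W : R -> R).

Definition slope p w s : R := Num.sqrt (2 / p * s `^ p + w * s ^+ 2).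

Definition force p w s : R := s `^ (p - 1) + w * s.

(* The even positive solutions of [W'' = force p w W] decaying at infinity, given
   by their first integral [W'^2 = (2/p) W^p + w W^2]. *)
Definition profile p w A W :=
  [/\ continuous W, (forall x, W (- x) = W x), W 0 = A, (forall x, 0 < W x) &
      (forall x, 0 < x -> is_derive x 1 W (- slope p w (W x))) /\
      W x @[x --> +oo] --> 0].

Lemma slope_arg_gt0 p w s : 0 < p -> 0 <= w -> 0 < s -> 0 < 2 / p * s `^ p + w * s ^+ 2.
Proof.
move=> p0 w0 s0; apply: ltr_pwDl; last by rewrite mulr_ge0// sqr_ge0.
by rewrite mulr_gt0 ?powR_gt0// divr_gt0.
Qed.

Lemma slope_gt0 p w s : 0 < p -> 0 <= w -> 0 < s -> 0 < slope p w s.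
Proof. by move=> *; rewrite sqrtr_gt0 slope_arg_gt0. Qed.

Lemma sqr_slope p w s : 0 < p -> 0 <= w -> 0 < s ->
  slope p w s ^+ 2 = 2 / p * s `^ p + w * s ^+ 2.
Proof. by move=> *; rewrite sqr_sqrtr// ltW// slope_arg_gt0. Qed.

Lemma is_derive_slope p w s : 0 < p -> 0 <= w -> 0 < s ->
  is_derive s 1 (slope p w) (force p w s / slope p w s).
Proof.
move=> p0 w0 s0.
have D : is_derive s 1 (fun s => 2 / p * s `^ p + w * s ^+ 2) (2 * force p w s).
  have dp := is_derive1_powR p s0.
  apply: is_derive_eq; rewrite /GRing.scale/= /force; field; lra.
have S := is_derive1_sqrt (slope_arg_gt0 p0 w0 s0).
have := @is_derive1_comp _ Num.sqrt (fun s => 2 / p * s `^ p + w * s ^+ 2) s _ _ S D.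
congr is_derive; rewrite -/(slope p w s).
by have := slope_gt0 p0 w0 s0 => h; field; lra.
Qed.

Lemma continuous_powR_gt0 q s : 0 < s -> {for s, continuous (fun s => s `^ q)}.
Proof.
move=> s0; apply/differentiable_continuous/derivable1_diffP.
by have [] := is_derive1_powR q s0.
Qed.

Lemma continuous_slope p w s : 0 < p -> 0 <= w -> 0 < s -> {for s, continuous (slope p w)}.
Proof.
move=> p0 w0 s0; apply/differentiable_continuous/derivable1_diffP.
by have [] := is_derive_slope p0 w0 s0.
Qed.

Lemma continuous_force p w s : 0 < s -> {for s, continuous (force p w)}.
Proof.
move=> s0; apply: cvgD; first exact: continuous_powR_gt0.
by apply: cvgM; [exact: cvg_cst|exact: cvg_id].
Qed.

Lemma slope0 p w : 0 < p -> slope p w 0 = 0.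
Proof.
by move=> p0; rewrite /slope powR0 ?gt_eqF// mulr0 expr0n/= mulr0 addr0 sqrtr0.
Qed.

Lemma slope_cvg0 p w : 0 < p -> slope p w s @[s --> 0^'+] --> 0.
Proof.
move=> p0; rewrite -[X in _ --> X](slope0 w p0).
have : (2 / p * s `^ p + w * s ^+ 2) @[s --> 0^'+] --> (2 / p * 0 `^ p + w * 0 ^+ 2).
  apply: cvgD; apply: cvgM; first exact: cvg_cst.
  - by rewrite powR0 ?gt_eqF//; exact: powR_cvg0.
  - exact: cvg_cst.
  - apply: cvg_at_right_filter.
    by apply: (@exprn_continuous).
by apply: continuous_cvg; exact: sqrt_continuous.
Qed.

Section ProfileFacts.
Variables (p w A : R) (W : R -> R).
Hypotheses (p2 : 2 < p) (w0 : 0 <= w) (HW : profile p w A W).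

Let p0 : 0 < p. Proof. by apply: lt_trans p2. Qed.

(** This is [W'] on the right half-line only. For negative [x] it has the opposite sign, so that it
    is even and stays continuous across the corner of [W] at 0. *)
Definition dprofile x := - slope p w (W x).

Lemma profile_gt0 x : 0 < W x. Proof. by case: HW. Qed.

Lemma profile_continuous : continuous W. Proof. by case: HW. Qed.

Lemma profile_even x : W (- x) = W x. Proof. by case: HW. Qed.

Lemma profile_A : W 0 = A. Proof. by case: HW. Qed.

Lemma is_derive_profile x : 0 < x -> is_derive x 1 W (dprofile x).
Proof. by case: HW => _ _ _ _ [+ _] x0; exact. Qed.

Lemma dprofile_continuous : continuous dprofile.
Proof.
move=> x; apply: cvgN; apply: continuous_comp; first exact: profile_continuous.
by apply: continuous_slope => //; exact: profile_gt0.
Qed.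

Lemma force_profile_continuous : continuous (fun x => force p w (W x)).
Proof.
move=> x; apply: (@continuous_comp _ _ _ W (force p w)); first exact: profile_continuous.
by apply: continuous_force; exact: profile_gt0.
Qed.

Lemma is_derive_dprofile x : 0 < x -> is_derive x 1 dprofile (force p w (W x)).
Proof.
move=> x0; have dW := is_derive_profile x0.
have S := is_derive_slope p0 w0 (profile_gt0 x).
have D := @is_derive1_comp _ (slope p w) W _ _ _ S dW.
have := is_deriveN D; congr is_derive.
rewrite /dprofile; have := slope_gt0 p0 w0 (profile_gt0 x) => h; field; lra.
Qed.

Lemma profile_cvg0 : W x @[x --> +oo] --> 0. Proof. by case: HW => _ _ _ _ []. Qed.

(** Positivity of [W] makes the limit one-sided, as needed to compose with [slope_cvg0]. *)
Lemma profile_cvg0r : W x @[x --> +oo] --> 0^'+.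
Proof.
move=> B [e /= e0 eB].
have /cvgrPdist_lt/(_ _ e0) := profile_cvg0.
apply: filterS => x h; apply: eB => //; exact: profile_gt0.
Qed.

Lemma dprofile_cvg0 : dprofile x @[x --> +oo] --> 0.
Proof.
rewrite -oppr0; apply: cvgN.
by apply: cvg_comp (slope_cvg0 w p0); exact: profile_cvg0r.
Qed.

Lemma integral_force_profile y : 0 <= y ->
  (\int[mu]_(x in `[y, +oo[) (force p w (W x))%:E = (- dprofile y)%:E)%E.
Proof.
move=> y0; rewrite (@ge0_continuous_FTC2y _ _ dprofile _ 0).
- by rewrite sub0e EFinN.
- move=> x _; rewrite addr_ge0 ?powR_ge0// mulr_ge0// ltW// profile_gt0//.
- exact/continuous_subspaceT/force_profile_continuous.
- exact: dprofile_cvg0.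
- by move=> x yx; have [] := is_derive_dprofile (le_lt_trans y0 yx).
- by apply: cvg_at_right_filter; exact: dprofile_continuous.
- move=> x; rewrite in_itv/= andbT => yx; rewrite derive1E.
  by have h := is_derive_dprofile (le_lt_trans y0 yx); exact: derive_val.
Qed.

Lemma integral_dprofile x : 0 <= x -> \int[mu]_(y in `[0, x]) dprofile y = W x - A.
Proof.
rewrite le_eqVlt => /predU1P[<-|x0].
  by rewrite set_itv1 Rintegral_set1 profile_A subrr.
rewrite /Rintegral (@continuous_FTC2 _ _ W)//.
- by rewrite profile_A.
- exact/continuous_subspaceT/dprofile_continuous.
- split.
  + by move=> y; rewrite in_itv/= => /andP[y0 _]; have [] := is_derive_profile y0.
  + by apply: cvg_at_right_filter; exact: profile_continuous.
  + by apply: cvg_at_left_filter; exact: profile_continuous.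
- move=> y; rewrite in_itv/= => /andP[y0 _]; rewrite derive1E.
  by have h := is_derive_profile y0; exact: derive_val.
Qed.

End ProfileFacts.
End Profile.

(** * Closure properties of integrability *)

Section IntegrableClosure.
Context {R : realType}.
Notation mu := (@lebesgue_measure R).
Variables (D : set R) (mD : measurable D).
Implicit Types (f g : R -> R).
Notation itg f := (mu.-integrable D (EFin \o f)).

Lemma itgD f g : itg f -> itg g -> itg (fun x => f x + g x).
Proof. move=> If Ig; rewrite (_ : EFin \o _ = (EFin \o f) \+ (EFin \o g))%E//; exact: integrableD. Qed.

Lemma itgB f g : itg f -> itg g -> itg (fun x => f x - g x).
Proof. move=> If Ig; rewrite (_ : EFin \o _ = (EFin \o f) \- (EFin \o g))%E//; exact: integrableB. Qed.

Lemma itgZ (k : R) f : itg f -> itg (fun x => k * f x).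
Proof. move=> If; rewrite (_ : EFin \o _ = (fun x => k%:E * (EFin \o f) x))%E//; exact: integrableZl. Qed.

Lemma itg_le f g : measurable_fun D f -> (forall x, D x -> `|f x| <= g x) ->
  itg g -> itg f.
Proof.
move=> mf fg; apply: le_integrable => //; first exact/measurable_EFinP.
move=> x Dx; rewrite lee_fin; apply: (le_trans (fg _ Dx)); exact: ler_norm.
Qed.

Lemma itgM_sqr f g : measurable_fun D f -> measurable_fun D g ->
  itg (fun x => f x ^+ 2) -> itg (fun x => g x ^+ 2) -> itg (fun x => f x * g x).
Proof.
move=> mf mg If Ig; apply: itg_le (itgD If Ig); first exact: measurable_funM.
move=> x _; rewrite ler_norml; apply/andP; split.
  by have := sqr_ge0 (f x + g x); rewrite sqrrD; nra.
by have := sqr_ge0 (f x - g x); rewrite sqrrB; nra.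
Qed.

Lemma itgB_sqr f g : measurable_fun D f -> measurable_fun D g ->
  itg (fun x => f x ^+ 2) -> itg (fun x => g x ^+ 2) -> itg (fun x => (f x - g x) ^+ 2).
Proof.
move=> mf mg If Ig; apply: itg_le (itgZ 2 (itgD If Ig)).
  by apply: measurable_funX; exact: measurable_funB.
by move=> x _; rewrite ger0_norm ?sqr_ge0//; have := sqr_ge0 (f x + g x); nra.
Qed.

End IntegrableClosure.

(** * Convexity of the action *)

Section Bound.
Context {R : realType}.
Notation mu := (@lebesgue_measure R).
Notation I0 := `[0, +oo[%classic.
Implicit Types (x y t s e : R) (p w A : R) (u g d W : R -> R).

(** The tangent at [s] lies below the convex function [y] -> |y|^p / p. It follows from Young's
    inequality for |y| and [s^(p-1)] with the conjugate exponents [p] and [p / (p - 1)]. *)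
Lemma convex_power_bound p s y : 1 < p -> 0 < s ->
  p^-1 * s `^ p + s `^ (p - 1) * (y - s) <= p^-1 * `|y| `^ p.
Proof.
move=> p1 s0; have p0 : 0 < p by apply: lt_trans p1.
have q0 : 0 < p / (p - 1) by rewrite divr_gt0// subr_gt0.
have := @conjugate_powR R `|y| (s `^ (p - 1)) p (p / (p - 1)) (normr_ge0 _) (powR_ge0 _ _) p0 q0.
have -> : p^-1 + (p / (p - 1))^-1 = 1 by field; lra.
move=> /(_ erefl); rewrite -powRrM.
have -> : (p - 1) * (p / (p - 1)) = p by field; lra.
have E : s `^ p = s * s `^ (p - 1) by rewrite mulr_powRB1// ltW.
have -> : s `^ p / (p / (p - 1)) = s `^ p - p^-1 * s `^ p by field; lra.
have := ler_norm y; have := powR_gt0 (p - 1) s0; rewrite E; nra.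
Qed.

(* Convexity of the action around [W]; the first-order terms cancel because
   [W'' = force p w W] and [u - W] vanishes at 0. *)
Lemma half_line_bound p w A W u g : 2 < p -> 0 <= w -> profile p w A W ->
  measurable_fun setT u -> measurable_fun setT g ->
  (forall a, mu.-integrable `[0, a] (EFin \o g)) ->
  (forall x, 0 <= x -> u x = A + \int[mu]_(y in `[0, x]) g y) ->
  mu.-integrable I0 (EFin \o (fun x => dprofile p w W x ^+ 2)) ->
  mu.-integrable I0 (EFin \o (fun x => g x ^+ 2)) ->
  mu.-integrable I0 (EFin \o (fun x => u x ^+ 2)) ->
  mu.-integrable I0 (EFin \o (fun x => `|u x| `^ p)) ->
  mu.-integrable I0 (EFin \o (fun x => (g x - dprofile p w W x) ^+ 2)) /\
  \int[mu]_(x in I0) (dprofile p w W x ^+ 2) +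
  2^-1 * \int[mu]_(x in I0) ((g x - dprofile p w W x) ^+ 2) <=
  2^-1 * \int[mu]_(x in I0) (g x ^+ 2) + p^-1 * \int[mu]_(x in I0) (`|u x| `^ p) +
    w / 2 * \int[mu]_(x in I0) (u x ^+ 2).
Proof.
move=> p2 w0 HW mu_ mg ig ug iZ2 ig2 iu2 iup.
have p0 : 0 < p by apply: lt_trans p2.
set Z := dprofile p w W in iZ2 *.
have cZ : continuous Z by exact: (dprofile_continuous p2 w0 HW).
have mZ : measurable_fun setT Z by exact: continuous_measurable_fun.
pose d x := g x - Z x.
have md : measurable_fun setT d by exact: measurable_funB.
have mI := measurable_itv `[(0 : R), +oo[.
have id2 : mu.-integrable I0 (EFin \o (fun x => d x ^+ 2)).
  by apply: itgB_sqr => //; exact: measurable_funTS.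
have iZd : mu.-integrable I0 (EFin \o (fun x => Z x * d x)).
  by apply: itgM_sqr => //; exact: measurable_funTS.
pose psi x := force p w (W x).
have iZ a : mu.-integrable `[0, a] (EFin \o Z) by exact: cont_itv_integrable.
have [] := @half_line_by_parts R d psi Z md.
- apply: continuous_measurable_fun; exact: (force_profile_continuous HW).
- move=> x _; rewrite addr_ge0 ?powR_ge0// mulr_ge0// ltW// (profile_gt0 HW)//.
- by move=> a; apply: itgB.
- by move=> y y0; exact: (integral_force_profile p2 w0 HW).
- exact: iZd.
have H x : 0 <= x -> \int[mu]_(y in `[0, x]) d y = u x - W x.
  move=> x0; rewrite RintegralB//.
  by rewrite (integral_dprofile p2 w0 HW)// ug//; ring.
move=> iph Eph.
have {}iph : mu.-integrable I0 (EFin \o (fun x => psi x * (u x - W x))).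
  apply: eq_integrable iph => // x; rewrite inE/= in_itv/= andbT => x0.
  by rewrite H.
have {}Eph : \int[mu]_(x in I0) (psi x * (u x - W x)) = - \int[mu]_(y in I0) (Z y * d y).
  rewrite -Eph; apply: eq_Rintegral => x; rewrite inE/= in_itv/= andbT => x0.
  by rewrite H.
split; first exact: id2.
have -> : \int[mu]_(x in I0) (Z x ^+ 2) + 2^-1 * \int[mu]_(x in I0) (d x ^+ 2) =
    \int[mu]_(x in I0) ((Z x ^+ 2 + 2^-1 * d x ^+ 2) + (Z x * d x + psi x * (u x - W x))).
  rewrite RintegralD//; [|by apply: itgD => //; apply: itgZ|exact: itgD].
  rewrite RintegralD//; last exact: itgZ.
  by rewrite RintegralZl// RintegralD// Eph subrr addr0.
have -> : 2^-1 * \int[mu]_(x in I0) (g x ^+ 2) + p^-1 * \int[mu]_(x in I0) (`|u x| `^ p) +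
    w / 2 * \int[mu]_(x in I0) (u x ^+ 2) =
    \int[mu]_(x in I0) (2^-1 * g x ^+ 2 + p^-1 * `|u x| `^ p + w / 2 * u x ^+ 2).
  rewrite RintegralD//; [|by apply: itgD => //; exact: itgZ|exact: itgZ].
  rewrite RintegralD//; [|exact: itgZ|exact: itgZ].
  by rewrite !RintegralZl.
apply: le_Rintegral => //.
- by apply: itgD => //; apply: itgD => //; exact: itgZ.
- by apply: itgD => //; [apply: itgD => //|]; exact: itgZ.
move=> x _.
have Wx := profile_gt0 HW x.
have p1 : 1 < p by lra.
have B := convex_power_bound (u x) p1 Wx.
have S : Z x ^+ 2 = 2 / p * W x `^ p + w * W x ^+ 2 by rewrite sqrrN sqr_slope.
have S2 : p^-1 * W x `^ p = 2^-1 * Z x ^+ 2 - w / 2 * W x ^+ 2 by rewrite S; field; lra.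
have E1 : Z x ^+ 2 + 2^-1 * d x ^+ 2 + Z x * d x = 2^-1 * g x ^+ 2 + 2^-1 * Z x ^+ 2.
  by rewrite /d; field.
have Q := mulr_ge0 w0 (sqr_ge0 (u x - W x)).
have Q' : w * (W x * (u x - W x)) + w / 2 * W x ^+ 2 <= w / 2 * u x ^+ 2.
  rewrite -subr_ge0 [X in 0 <= X](_ : _ = 2^-1 * (w * (u x - W x) ^+ 2)); last by field.
  by rewrite mulr_ge0.
rewrite addrA E1 /psi /force mulrDl -mulrA; move: B Q'; rewrite S2; lra.
Qed.

End Bound.

(** * Even functions on the line *)

Section WholeLine.
Context {R : realType}.
Notation mu := (@lebesgue_measure R).
Notation I0 := `[0, +oo[%classic.
Implicit Types (x y t s e : R) (p w A : R) (u g d W Z f : R -> R).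

Lemma sqr_integrable_L2 f : measurable_fun setT f ->
  mu.-integrable setT (EFin \o (fun x => f x ^+ 2)) -> L2 f.
Proof.
move=> mf /integrableP[_ fi]; rewrite /L2/=.
apply/andP; split; first by rewrite inE.
rewrite inE/= /finite_norm.
apply: (@lty_poweRy _ _ 2) => //.
rewrite powR_Lnorm//; apply: le_lt_trans fi; rewrite le_eqVlt; apply/orP; left; apply/eqP.
apply: eq_integral => x _ /=.
by rewrite powR_mulrn// real_normK ?num_real// ger0_norm ?sqr_ge0.
Qed.

Lemma Rintegral_line f : (forall x, 0 <= f x) -> mu.-integrable setT (EFin \o f) ->
  [/\ mu.-integrable I0 (EFin \o f), mu.-integrable I0 (EFin \o (fun x => f (- x))) &
  \int[mu]_(x in [set: R]) f x = \int[mu]_(x in I0) f x + \int[mu]_(x in I0) f (- x)].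
Proof.
move=> f0 fi; have /integrableP[mf foo] := fi.
have := @ge0_integral_line R (EFin \o f) mf f0.
have i1 : mu.-integrable I0 (EFin \o f) by exact: integrableS fi.
have mf' : measurable_fun setT (fun x => f (- x)).
  by apply: measurableT_comp => //; exact/measurable_EFinP.
move=> E.
have i2 : mu.-integrable I0 (EFin \o (fun x => f (- x))).
  apply/integrableP; split.
    by apply/measurable_EFinP; exact: measurable_funTS.
  have L : (\int[mu]_(x in I0) (f (- x))%:E <= \int[mu]_x (f x)%:E)%E.
    have E' : (\int[mu]_x (f x)%:E =
      \int[mu]_(x in I0) (f x)%:E + \int[mu]_(x in I0) (f (- x))%:E)%E := E.
    by rewrite E' leeDr// integral_ge0// => x _; rewrite lee_fin.
  apply: le_lt_trans foo.
  under eq_integral do rewrite /= ger0_norm//.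
  under [leRHS]eq_integral do rewrite /= ger0_norm//.
  exact: L.
split => //; rewrite /Rintegral E fineD//; exact: integrable_fin_num.
Qed.

Lemma ge0_integrable_line f : measurable_fun setT f -> (forall x, 0 <= f x) ->
  mu.-integrable I0 (EFin \o f) -> mu.-integrable I0 (EFin \o (fun x => f (- x))) ->
  mu.-integrable setT (EFin \o f).
Proof.
move=> mf f0 i1 i2; apply/integrableP; split; first exact/measurable_EFinP.
under eq_integral do rewrite /= ger0_norm//.
rewrite (@ge0_integral_line R (EFin \o f))//; last exact/measurable_EFinP.
by rewrite lte_add_pinfty//; exact: integrable_lty.
Qed.

Definition odd_ext Z x := if 0 <= x then Z x else - Z (- x).

Lemma measurable_odd_ext Z : continuous Z -> measurable_fun setT (odd_ext Z).
Proof.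
move=> cZ; apply: measurable_fun_ifT => //.
- by apply: measurable_fun_ler.
- exact: continuous_measurable_fun.
- apply: continuous_measurable_fun => x; apply: cvgN.
  by apply: (@continuous_comp _ _ _ -%R Z); [exact: opp_continuous|exact: cZ].
Qed.

Lemma C1c_bounded_support (phi : R -> R) : C1c phi ->
  exists2 X : R, 0 < X & forall x, X <= `|x| -> phi x = 0 /\ derive1 phi x = 0.
Proof.
move=> [dphi cphi /compact_bounded[M [Mr HM]]].
(* One unit makes the bound on the support strict; the other leaves room for [phi] to vanish in a
   neighbourhood of [x], which kills the derivative too. *)
exists (`|M| + 2) => [|x xX]; first by rewrite ltr_wpDl.
have H y : `|M| + 1 < `|y| -> phi y = 0.
  move=> yM; apply: contrapT => /eqP py.
  have MM : M < `|M| + 1 by rewrite (le_lt_trans (ler_norm M))// ltrDl.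
  have : `|y| <= `|M| + 1 := HM _ MM y (@subset_closure _ _ y py).
  lra.
split; first by apply: H; lra.
rewrite derive1E (@near_eq_derive _ _ _ _ (cst 0)) ?derive_cst//.
near=> y; apply: H; near: y.
have cn : {for x, continuous (fun y => `|y|)} by exact: norm_continuous.
have xl : `|M| + 1 < `|x| by lra.
exact: (cn _ (lt_nbhsr xl)).
Unshelve. all: by end_near. Qed.

(** Integrating by parts on [-X, 0] and on [0, X] separately produces the boundary terms
    [W 0 * phi 0] with opposite signs, so the corner at 0 contributes nothing. *)
Lemma even_weak_derivative W Z : continuous W -> continuous Z ->
  (forall x, W (- x) = W x) -> (forall x, 0 < x -> is_derive x 1 W (Z x)) ->
  is_weak_derivative W (odd_ext Z).
Proof.
move=> cW cZ eW dW phi phiC.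
have [X X0 HX] := C1c_bounded_support phiC.
case: phiC => dphi cdphi _.
have cphi : continuous phi.
  by move=> x; apply/differentiable_continuous/derivable1_diffP.
have out x : x < - X \/ X < x -> phi x = 0 /\ derive1 phi x = 0.
  move=> h; apply: HX; case: h => h.
    by rewrite ltr0_norm; lra.
  by rewrite gtr0_norm; lra.
have pX : phi X = 0 by have [] := HX X _; rewrite // gtr0_norm.
have pNX : phi (- X) = 0 by have [] := HX (- X) _; rewrite // normrN gtr0_norm.
pose Z' x := - Z (- x).
have cZ' : continuous Z'.
  move=> x; apply: cvgN.
  by apply: (@continuous_comp _ _ _ -%R Z); [exact: opp_continuous|exact: cZ].
have dW' x : x < 0 -> is_derive x 1 W (Z' x).
  move=> x0; have h : is_derive (- x) 1 W (Z (- x)) by apply: dW; rewrite oppr_gt0.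
  have := @is_derive1_comp _ W -%R x _ _ h _.
  move=> /(_ (- 1)); rewrite mulrN1.
  have -> : W \o -%R = W by apply/funext => y; exact: eW.
  by apply; apply: is_deriveNid.
have IBPr : \int[mu]_(x in `[0, X]) (W x * derive1 phi x) =
    - (W 0 * phi 0) - \int[mu]_(x in `[0, X]) (Z x * phi x).
  rewrite (@Rintegration_by_parts R W phi Z (derive1 phi) 0 X).
  - by rewrite pX mulr0 sub0r.
  - exact: X0.
  - exact: continuous_subspaceT.
  - split.
    + by move=> x; rewrite in_itv/= => /andP[x0 _]; have [] := dW _ x0.
    + exact/cvg_at_right_filter/cW.
    + exact/cvg_at_left_filter/cW.
  - move=> x; rewrite in_itv/= => /andP[x0 _]; rewrite derive1E.
    by have h := dW _ x0; exact: derive_val.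
  - exact: continuous_subspaceT.
  - split; first by move=> x _; exact: dphi.
    + exact/cvg_at_right_filter/cphi.
    + exact/cvg_at_left_filter/cphi.
  - by [].
have IBPl : \int[mu]_(x in `[- X, 0]) (W x * derive1 phi x) =
    W 0 * phi 0 - \int[mu]_(x in `[- X, 0]) (Z' x * phi x).
  rewrite (@Rintegration_by_parts R W phi Z' (derive1 phi) (- X) 0).
  - by rewrite pNX mulr0 subr0.
  - by rewrite oppr_lt0.
  - exact: continuous_subspaceT.
  - split.
    + by move=> x; rewrite in_itv/= => /andP[_ x0]; have [] := dW' _ x0.
    + exact/cvg_at_right_filter/cW.
    + exact/cvg_at_left_filter/cW.
  - move=> x; rewrite in_itv/= => /andP[_ x0]; rewrite derive1E.
    by have h := dW' _ x0; exact: derive_val.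
  - exact: continuous_subspaceT.
  - split; first by move=> x _; exact: dphi.
    + exact/cvg_at_right_filter/cphi.
    + exact/cvg_at_left_filter/cphi.
  - by [].
have spl f : mu.-integrable `[- X, X] (EFin \o f) ->
    \int[mu]_(x in `[- X, X]) f x =
    \int[mu]_(x in `[- X, 0[) f x + \int[mu]_(x in `[0, X]) f x.
  have -> : `[- X, X]%classic = `[- X, 0[ `|` `[0, X].
    by apply/seteqP; split => x /=; rewrite !in_itv/=; case: (ltP x 0); lra.
  move=> fi; rewrite Rintegral_setU//.
  by apply/disj_setPS => x [/=]; rewrite !in_itv/=; lra.
have cl f : continuous f ->
    \int[mu]_(x in `[- X, 0[) f x = \int[mu]_(x in `[- X, 0]) f x.
  move=> cf; rewrite -Rintegral_itv_bndo_bndc//.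
  apply: integrableS (cont_itv_integrable (- X) 0 cf) => //.
  exact: subset_itv_co_cc.
have cWd : continuous (fun x => W x * derive1 phi x).
  by move=> x; apply: cvgM; [exact: cW|exact: cdphi].
have cZp : continuous (fun x => Z' x * phi x).
  by move=> x; apply: cvgM; [exact: cZ'|exact: cphi].
have cZr : continuous (fun x => Z x * phi x).
  by move=> x; apply: cvgM; [exact: cZ|exact: cphi].
rewrite (@Rintegral_supp _ _ (- X) X); last by move=> x /out[_ ->]; rewrite mulr0.
rewrite [in RHS](@Rintegral_supp _ _ (- X) X); last by move=> x /out[-> _]; rewrite mulr0.
have El : {in `[- X, 0[%classic, (fun x => odd_ext Z x * phi x) =1 (fun x => Z' x * phi x)}.
  by move=> x; rewrite inE/= in_itv/= /odd_ext => /andP[_ x0]; rewrite leNgt x0.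
have Er : {in `[0, X]%classic, (fun x => odd_ext Z x * phi x) =1 (fun x => Z x * phi x)}.
  by move=> x; rewrite inE/= in_itv/= /odd_ext => /andP[-> _].
rewrite spl; last exact: cont_itv_integrable.
rewrite cl// IBPl IBPr spl; last first.
  apply: itgM_sqr => //.
  - by apply: measurable_funTS; exact: measurable_odd_ext.
  - by apply: measurable_funTS; exact: continuous_measurable_fun.
  - have -> : (fun x => odd_ext Z x ^+ 2) = (fun x => Z `|x| ^+ 2).
      apply/funext => x; rewrite /odd_ext; case: (leP 0 x) => x0; first by rewrite ger0_norm.
      by rewrite ltr0_norm// sqrrN.
    apply: cont_itv_integrable => x; apply: (@continuous_comp _ _ _ (fun x => Z `|x|) (fun y => y ^+ 2)).
      by apply: (@continuous_comp _ _ _ (fun x : R => `|x|) Z); [exact: norm_continuous|exact: cZ].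
    exact: exprn_continuous.
  - apply: cont_itv_integrable => x; apply: (@continuous_comp _ _ _ phi (fun y => y ^+ 2)).
      exact: cphi.
    exact: exprn_continuous.
have -> : \int[mu]_(x in `[- X, 0[) (odd_ext Z x * phi x) =
    \int[mu]_(x in `[- X, 0[) (Z' x * phi x) by exact: eq_Rintegral.
have -> : \int[mu]_(x in `[0, X]) (odd_ext Z x * phi x) =
    \int[mu]_(x in `[0, X]) (Z x * phi x) by exact: eq_Rintegral.
by rewrite cl// addrACA subrr add0r -opprD.
Qed.

Lemma odd_ext_sqr Z x : odd_ext Z x ^+ 2 = Z `|x| ^+ 2.
Proof.
rewrite /odd_ext; case: (leP 0 x) => x0; first by rewrite ger0_norm.
by rewrite ltr0_norm// sqrrN.
Qed.

Lemma even_line f : measurable_fun setT f -> (forall x, 0 <= f x) -> (forall x, f (- x) = f x) ->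
  mu.-integrable I0 (EFin \o f) ->
  mu.-integrable setT (EFin \o f) /\
  \int[mu]_(x in [set: R]) f x = 2 * \int[mu]_(x in I0) f x.
Proof.
move=> mf f0 ef fi.
have e : (fun x => f (- x)) = f by apply/funext => x; exact: ef.
have fT : mu.-integrable setT (EFin \o f) by apply: ge0_integrable_line => //; rewrite e.
split => //; have [_ _ ->] := Rintegral_line f0 fT; rewrite e; ring.
Qed.

Lemma even_H1 W Z : continuous W -> continuous Z ->
  (forall x, W (- x) = W x) -> (forall x, 0 < x -> is_derive x 1 W (Z x)) ->
  mu.-integrable I0 (EFin \o (fun x => W x ^+ 2)) ->
  mu.-integrable I0 (EFin \o (fun x => Z x ^+ 2)) ->
  [/\ H1 W,
      (Lpnorm 2 W `^ 2 = (2 * \int[mu]_(x in I0) (W x ^+ 2))%:E)%E &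
      (Lpnorm 2 (weak_derivative W) `^ 2 = (2 * \int[mu]_(x in I0) (Z x ^+ 2))%:E)%E].
Proof.
move=> cW cZ eW dW iW iZ.
have mW : measurable_fun setT W by exact: continuous_measurable_fun.
have [iWT EW] : mu.-integrable setT (EFin \o (fun x => W x ^+ 2)) /\
    \int[mu]_(x in [set: R]) (W x ^+ 2) = 2 * \int[mu]_(x in I0) (W x ^+ 2).
  apply: even_line => //; [exact: measurable_funX|by move=> x; exact: sqr_ge0|].
  by move=> x; rewrite eW.
have W2 := sqr_integrable_L2 mW iWT.
have mg := measurable_odd_ext cZ.
have E : {in I0, (fun x => Z x ^+ 2) =1 (fun x => odd_ext Z x ^+ 2)}.
  by move=> x; rewrite inE/= in_itv/= andbT => x0; rewrite odd_ext_sqr ger0_norm.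
have [igT Eg] : mu.-integrable setT (EFin \o (fun x => odd_ext Z x ^+ 2)) /\
    \int[mu]_(x in [set: R]) (odd_ext Z x ^+ 2) = 2 * \int[mu]_(x in I0) (odd_ext Z x ^+ 2).
  apply: even_line => //; [exact: measurable_funX|by move=> x; exact: sqr_ge0| |].
    by move=> x; rewrite !odd_ext_sqr normrN.
  apply: eq_integrable iZ => // x xI; rewrite /comp; congr EFin; exact: E.
have g2 := sqr_integrable_L2 mg igT.
have wd := even_weak_derivative cW cZ eW dW.
have hW : H1 W by split => //; exists (odd_ext Z).
split => //.
  by rewrite L2_Lpnorm// EW.
rewrite (Lpnorm_weak_derivative hW g2 wd) Eg; congr (2 * _)%:E.
by apply: eq_Rintegral => x xI; rewrite -(E x xI).
Qed.


Lemma Rintegral_sqr_eq0 d : measurable_fun setT d ->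
  mu.-integrable I0 (EFin \o (fun x => d x ^+ 2)) ->
  (forall a, mu.-integrable `[0, a] (EFin \o d)) ->
  \int[mu]_(x in I0) (d x ^+ 2) <= 0 ->
  forall x, 0 <= x -> \int[mu]_(y in `[0, x]) d y = 0.
Proof.
move=> md i2 i1 d0 x x0.
have sub : `[0, x]%classic `<=` I0 by exact: subset_itvl.
have i2x : mu.-integrable `[0, x] (EFin \o (fun x => d x ^+ 2)).
  by apply: integrableS i2.
have d0x : \int[mu]_(y in `[0, x]) (d y ^+ 2) <= 0.
  apply: le_trans d0; rewrite /Rintegral fine_le//; [exact: integrable_fin_num..|].
  apply: ge0_subset_integral => //.
    by have /integrableP[] := i2.
  by move=> y _; rewrite lee_fin sqr_ge0.
apply/eqP; rewrite -normr_eq0 eq_le normr_ge0 andbT; apply/ler_addgt0Pl => e e0.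
rewrite addr0.
(* By |d| <= c + d^2 / c the integral of |d| is at most [c * x], since that of [d^2] is not
   positive, and [c * x <= e]. The denominator [x + 1] also covers [x = 0]. *)
pose c := e / (x + 1).
have c0 : 0 < c by rewrite divr_gt0// ltr_wpDl.
apply: (le_trans (le_normr_Rintegral _ (i1 x))) => //.
have i3 : mu.-integrable `[0, x] (EFin \o (fun y => c + c^-1 * d y ^+ 2)).
  apply: itgD => //; last exact: itgZ.
  by apply: cont_itv_integrable; exact: cst_continuous.
apply: (@le_trans _ _ (\int[mu]_(y in `[0, x]) (c + c^-1 * d y ^+ 2))).
  apply: le_Rintegral => //; first exact: integrable_norm.
  move=> y _; have [h|h] := leP `|d y| c.
    by rewrite (le_trans h)// lerDl mulr_ge0 ?sqr_ge0// invr_ge0 ltW.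
  apply: (@le_trans _ _ (c^-1 * d y ^+ 2)); last by rewrite lerDr ltW.
  by rewrite ler_pdivlMl// -real_normK ?num_real// expr2 ler_wpM2r// ltW.
rewrite RintegralD//; last 2 first.
- by apply: cont_itv_integrable; exact: cst_continuous.
- exact: itgZ.
have muE : mu `[0%R, x]%classic = x%:E.
  rewrite lebesgue_measure_itv/= lte_fin; case: ltP => [_|x0']; first by rewrite sube0.
  by congr EFin; apply/eqP; rewrite eq_le x0.
have -> : \int[mu]_(y in `[0, x]) c = c * x.
  apply: (etrans (congr1 fine (integral_cst mu (measurable_itv `[0, x]) c%:E))).
  by rewrite [X in (_ * X)%E](_ : _ = x%:E); last exact: muE.
rewrite RintegralZl//.
have h1 : c^-1 * \int[mu]_(y in `[0, x]) (d y ^+ 2) <= 0.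
  by rewrite mulr_ge0_le0// invr_ge0 ltW.
have h2 : c * x <= e.
  rewrite /c mulrAC ler_pdivrMr ?ltr_wpDl// ler_pM2l//; lra.
by rewrite -[e]addr0 lerD.
Qed.

Lemma Lpnorm_powR p u : 0 < p ->
  (Lpnorm p u `^ p = \int[mu]_x (`|u x| `^ p)%:E)%E.
Proof. by move=> p0; rewrite /Lpnorm powR_Lnorm// gt_eqF. Qed.

Lemma measurable_norm_powR p u : measurable_fun setT u ->
  measurable_fun setT (fun x => `|u x| `^ p).
Proof.
move=> mu_; apply: (measurableT_comp (measurable_powR p)).
exact: measurableT_comp.
Qed.

Let bound_arith (K D1 D2 G1 G2 P1 P2 U1 U2 i w c : R) :
  K + 2^-1 * D1 <= 2^-1 * G1 + i * P1 + w / 2 * U1 ->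
  K + 2^-1 * D2 <= 2^-1 * G2 + i * P2 + w / 2 * U2 -> 0 <= D1 -> 0 <= D2 ->
  2 * K - w / 2 * (U1 + U2) - c <= 2^-1 * (G1 + G2) + i * (P1 + P2) - c /\
  (2^-1 * (G1 + G2) + i * (P1 + P2) - c <= 2 * K - w / 2 * (U1 + U2) - c ->
   D1 <= 0 /\ D2 <= 0).
Proof. by rewrite !mulrDr; lra. Qed.

(** [half_line_bound] is applied to [u] and to its reflection. If the energy reaches the bound, both
    remainders vanish, so [u] has the derivative of [W] on each half-line and the same value at
    0. *)
Lemma energy_lower_bound p q w A W u m : 2 < p -> 0 <= w -> profile p w A W ->
  mu.-integrable I0 (EFin \o (fun x => dprofile p w W x ^+ 2)) ->
  H1mass m u -> u 0 = A ->
  let E := 2 * \int[mu]_(x in I0) (dprofile p w W x ^+ 2) - w / 2 * m - q^-1 * A `^ q in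
  (E%:E <= energy p q u)%E /\ ((energy p q u <= E%:E)%E -> u = W).
Proof.
move=> p2 w0 HW iZ [hu um] u0 E.
have p0 : 0 < p by apply: lt_trans p2.
have A0 : 0 < A by rewrite -(profile_A HW); exact: profile_gt0 HW _.
have [g2 ug] := weak_derivativeP hu; set g := weak_derivative u in g2 ug.
have [cu u2 _] := hu.
have mg := L2_measurable g2.
have mu_ := L2_measurable u2.
have Em : m = \int[mu]_x (u x ^+ 2).
  by have := L2_Lpnorm u2; rewrite um => -[].
have mup := measurable_norm_powR p mu_.
rewrite /energy (L2_Lpnorm g2) Lpnorm_powR// u0 (gtr0_norm A0).
(* If |u|^p is not integrable, the energy is [+oo]: the bound is trivial and the equality case
   contradictory. *)
have [iup|niup] := pselect (mu.-integrable setT (EFin \o (fun x => `|u x| `^ p))); last first.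
  have -> : (\int[mu]_x (`|u x| `^ p)%:E = +oo)%E.
    apply/eqP/negbNE/negP => h; apply: niup.
    apply/integrableP; split; first exact/measurable_EFinP.
    under eq_integral do rewrite /= ger0_norm ?powR_ge0//.
    by rewrite ltey.
  rewrite gt0_muley ?lte_fin ?invr_gt0//.
  rewrite -EFinM addey// addye//; split; first by rewrite leey.
  by rewrite leye_eq.
have g2i := L2_sqr_integrable g2.
have u2i := L2_sqr_integrable u2.
pose g' x := - g (- x); pose u' x := u (- x).
have mg' : measurable_fun setT g'.
  by apply: measurableT_comp => //; apply: measurableT_comp.
have mu'_ : measurable_fun setT u' by exact: measurableT_comp.
have [gi1 gi2 Eg] := Rintegral_line (fun x => sqr_ge0 (g x)) g2i.
have [ui1 ui2 Eu] := Rintegral_line (fun x => sqr_ge0 (u x)) u2i.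
have [pi1 pi2 Ep] := Rintegral_line (fun x => powR_ge0 `|u x| p) iup.
have e' : (fun x => g (- x) ^+ 2) = (fun x => g' x ^+ 2).
  by apply/funext => x; rewrite /g' sqrrN.
rewrite e' in gi2 Eg.
have ig a : mu.-integrable `[0, a] (EFin \o g) by exact: L2_itv_integrable.
have iNg a : mu.-integrable `[- a, 0] (EFin \o g) by exact: L2_itv_integrable.
have g2T' : mu.-integrable setT (EFin \o (fun x => g' x ^+ 2)).
  apply: ge0_integrable_line => //; [exact: measurable_funX|by move=> x; exact: sqr_ge0|].
  have -> : (fun x => g' (- x) ^+ 2) = (fun x => g x ^+ 2).
    by apply/funext => x; rewrite /g' opprK sqrrN.
  exact: gi1.
have ig' a : mu.-integrable `[0, a] (EFin \o g').
  by apply: L2_itv_integrable; exact: sqr_integrable_L2.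
have ru x : 0 <= x -> u x = A + \int[mu]_(y in `[0, x]) g y.
  by move=> x0; rewrite -(weak_derivative_repr cu g2 ug x0) u0; ring.
have ru' x : 0 <= x -> u' x = A + \int[mu]_(y in `[0, x]) g' y.
  move=> x0; have Nx0 : - x <= 0 by rewrite oppr_le0.
  have := weak_derivative_repr cu g2 ug Nx0.
  rewrite Rintegral_comp_opp//; last exact: measurable_funTS.
  rewrite opp_preimage_itvbndbnd/= opprK oppr0 u0 => h.
  have -> : \int[mu]_(y in `[0, x]) g' y = - \int[mu]_(y in `[0, x]) g (- y).
    rewrite -mulN1r -RintegralZl//.
      by apply: eq_Rintegral => y _; rewrite mulN1r.
    have := itgZ (measurable_itv `[0, x]) (- 1) (ig' x).
    by apply: eq_integrable => // y _; rewrite /g'/= mulN1r opprK.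
  by rewrite -h /u'; ring.
have [id1 B1] := half_line_bound p2 w0 HW mu_ mg ig ru iZ gi1 ui1 pi1.
have [id2 B2] := half_line_bound p2 w0 HW mu'_ mg' ig' ru' iZ gi2 ui2 pi2.
have -> : (\int[mu]_x (`|u x| `^ p)%:E = (\int[mu]_x (`|u x| `^ p))%:E)%E.
  by rewrite /Rintegral fineK//; exact: integrable_fin_num.
rewrite -!EFinM -!EFinD !lee_fin Eg Ep.
set K := \int[mu]_(x in I0) (dprofile p w W x ^+ 2) in E B1 B2 *.
set D1 := \int[mu]_(x in I0) ((g x - dprofile p w W x) ^+ 2) in B1.
set D2 := \int[mu]_(x in I0) ((g' x - dprofile p w W x) ^+ 2) in B2.
have D10 : 0 <= D1 by apply: Rintegral_ge0 => x _; exact: sqr_ge0.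
have D20 : 0 <= D2 by apply: Rintegral_ge0 => x _; exact: sqr_ge0.
rewrite /E Em Eu.
have [Hle Heq] := bound_arith (q^-1 * A `^ q) B1 B2 D10 D20.
split => // le; have [{}D1le {}D2le] := Heq le.
have cZ := dprofile_continuous p2 w0 HW.
have mZ : measurable_fun setT (dprofile p w W) by exact: continuous_measurable_fun.
have iZa a : mu.-integrable `[0, a] (EFin \o (dprofile p w W)).
  exact: cont_itv_integrable.
have uW h v : measurable_fun setT h -> (forall a, mu.-integrable `[0, a] (EFin \o h)) ->
   (forall x, 0 <= x -> v x = A + \int[mu]_(y in `[0, x]) h y) ->
   mu.-integrable I0 (EFin \o (fun x => (h x - dprofile p w W x) ^+ 2)) ->
   \int[mu]_(x in I0) ((h x - dprofile p w W x) ^+ 2) <= 0 ->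
   forall x, 0 <= x -> v x = W x.
  move=> mh ih vh id dle x x0.
  have := Rintegral_sqr_eq0 (measurable_funB mh mZ) id _ dle x0.
  rewrite RintegralB// (integral_dprofile p2 w0 HW)// vh// => H.
  have /eqP := H (fun a => itgB (measurable_itv _) (ih a) (iZa a)).
  by rewrite subr_eq0 => /eqP ->; rewrite addrC subrK.
apply/funext => x; have [x0|x0] := leP 0 x.
  exact: (uW g u).
have x0' : 0 <= - x by rewrite oppr_ge0 ltW.
have := uW g' u' mg' ig' ru' id2 D2le _ x0'.
by rewrite /u' opprK (profile_even HW).
Qed.

End WholeLine.

(** * Profiles and their integrals *)

Section ProfileExistence.
Context {R : realType}.
Notation mu := (@lebesgue_measure R).
Implicit Types (x y t s e : R) (p w A k : R) (W v : R -> R).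

(** For [W = v^(-1/k)] with [k = p/2 - 1], the first integral of [W] becomes v'^2 = k^2 (2/p + t
    v^2), quadratic in [v]. Hence [v] is affine for [t = 0] and a combination of exponentials for
    [t > 0]. *)
Lemma profile_of_inverse_power p t v : 2 < p -> 0 <= t ->
  continuous v -> v 0 = 1 -> (forall x, 0 <= x -> 1 <= v x) ->
  (forall x, 0 < x ->
    is_derive x 1 v ((p / 2 - 1) * Num.sqrt (2 / p + t * v x ^+ 2))) ->
  v x @[x --> +oo] --> +oo ->
  profile p t 1 (fun x => v `|x| `^ (- (p / 2 - 1)^-1)).
Proof.
move=> p2 t0 cv v0 v1 dv voo; set k := p / 2 - 1.
have k0 : 0 < k by rewrite /k; lra.
have p0 : 0 < p by lra.
have vp x : 0 < v `|x| by rewrite (lt_le_trans ltr01)// v1.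
split.
- move=> x; apply: (@continuous_comp _ _ _ (fun x => v `|x|) (fun y => y `^ (- k^-1))).
    by apply: (@continuous_comp _ _ _ (fun x : R => `|x|) v); [exact: norm_continuous|exact: cv].
  exact: continuous_powR_gt0.
- by move=> x; rewrite normrN.
- by rewrite normr0 v0 powR1.
- by move=> x; rewrite powR_gt0.
split.
  move=> x x0.
  have vx : 0 < v x by have := vp x; rewrite gtr0_norm.
  apply: (@near_eq_is_derive _ _ _ (fun y => v y `^ (- k^-1))).
    near=> y; rewrite gtr0_norm//; near: y; exact: lt_nbhsr.
  have D := @is_derive1_comp _ (fun y => y `^ (- k^-1)) v x _ _ (is_derive1_powR _ vx) (dv _ x0).
  move: D; congr is_derive; rewrite gtr0_norm// /slope.
  have E : 2 / p * (v x `^ (- k^-1)) `^ p + t * (v x `^ (- k^-1)) ^+ 2 =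
      (v x `^ (- k^-1 - 1)) ^+ 2 * (2 / p + t * v x ^+ 2).
    have e1 : (v x `^ (- k^-1)) `^ p = v x `^ ((- k^-1 - 1) * 2).
      by rewrite -powRrM; congr (_ `^ _); rewrite /k; field; lra.
    have e2 : (v x `^ (- k^-1)) ^+ 2 = v x `^ (- k^-1 * 2).
      by rewrite -powR_mulrn ?powR_ge0// -powRrM.
    have e3 : (v x `^ (- k^-1 - 1)) ^+ 2 = v x `^ ((- k^-1 - 1) * 2).
      by rewrite -powR_mulrn ?powR_ge0// -powRrM.
    have e4 : v x `^ (- k^-1 * 2) = v x `^ ((- k^-1 - 1) * 2) * v x ^+ 2.
      rewrite -(powR_mulrn 2 (ltW vx)) -powRD ?(gt_eqF vx) ?implybT//.
      by congr (_ `^ _); ring.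
    by rewrite e1 e2 e3 e4; ring.
  rewrite E sqrtrM ?sqr_ge0// sqrtr_sqr ger0_norm ?powR_ge0//.
  by rewrite -/k; field; rewrite gt_eqF.
apply/cvgrPdist_lt => e e0.
have M0 : 0 < e `^ (- k) by rewrite powR_gt0.
have /cvgryPgt/(_ (e `^ (- k))) := voo; move=> H; near=> x.
rewrite sub0r normrN ger0_norm ?powR_ge0//.
have x0 : 0 < x by near: x; exact: nbhs_pinfty_gt.
have vx : 0 < v x by have := vp x; rewrite gtr0_norm.
rewrite gtr0_norm// powRN -[X in _ < X]invrK ltf_pV2 ?posrE ?invr_gt0 ?powR_gt0//.
have -> : e^-1 = (e `^ (- k)) `^ k^-1.
  by rewrite -powRrM mulNr divff ?gt_eqF// powR_inv1// ltW.
rewrite gt0_ltr_powR ?invr_gt0// ?nnegrE ?powR_ge0 ?(ltW vx)//.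
by near: x.
Unshelve. all: by end_near. Qed.

Lemma cvgry_ge_linear (v : R -> R) (a : R) : 0 < a ->
  (forall x, 0 <= x -> 1 + a * x <= v x) -> v x @[x --> +oo] --> +oo.
Proof.
move=> a0 H; apply/cvgryPge => M.
have N : \forall x \near +oo, a^-1 * M <= x by apply: nbhs_pinfty_ge; rewrite num_real.
near=> x.
have x0 : 0 <= x by near: x; exact: nbhs_pinfty_ge.
apply: le_trans (H x x0).
have Mx : a^-1 * M <= x by near: x.
by move: Mx; rewrite ler_pdivrMl// => h; apply: (le_trans h); rewrite lerDr.
Unshelve. all: by end_near. Qed.

Lemma profile_exists0 p : 2 < p -> exists U, profile p 0 1 U.
Proof.
move=> p2; pose a := (p / 2 - 1) * Num.sqrt (2 / p).
have p0 : 0 < p by lra.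
have a0 : 0 < a by rewrite mulr_gt0 ?sqrtr_gt0 ?divr_gt0//; lra.
pose v x := 1 + a * x.
have dv x : is_derive x 1 v a.
  by rewrite /v; apply: is_derive_eq; rewrite /GRing.scale/= mulr1; ring.
eexists; apply: (@profile_of_inverse_power p 0 v) => //.
- by move=> x; apply/differentiable_continuous/derivable1_diffP; have [] := dv x.
- by rewrite /v mulr0 addr0.
- by move=> x x0; rewrite /v lerDl mulr_ge0// ltW.
- by move=> x _; rewrite mul0r addr0.
- exact: (cvgry_ge_linear a0).
Qed.

(** Here [v] is cosh(a x) + b sinh(a x). The rate [a] comes from v'' = (p/2 - 1)^2 t v, and [b] from
    the first integral at 0, where [v] is 1. *)
Lemma profile_exists_gt0 p t : 2 < p -> 0 < t -> exists U, profile p t 1 U.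
Proof.
move=> p2 t0; have p0 : 0 < p by lra.
pose a := (p / 2 - 1) * Num.sqrt t.
pose b := Num.sqrt ((2 / p + t) / t).
have a0 : 0 < a by rewrite mulr_gt0 ?sqrtr_gt0//; lra.
have b2 : b ^+ 2 = 1 + 2 / p / t.
  by rewrite sqr_sqrtr ?divr_ge0 ?addr_ge0 ?divr_ge0 ?ltW//; field; lra.
have b1 : 1 <= b.
  by rewrite -(@ler_pXn2r _ 2) ?nnegrE ?sqrtr_ge0// b2 expr1n lerDl !divr_ge0// ltW.
have a2 : a ^+ 2 = (p / 2 - 1) ^+ 2 * t by rewrite exprMn sqr_sqrtr// ltW.
pose v x := ((1 + b) * expR (a * x) + (1 - b) * expR (- (a * x))) / 2.
pose v' x := a * ((1 + b) * expR (a * x) - (1 - b) * expR (- (a * x))) / 2.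
have dE x : is_derive x 1 (fun x => expR (a * x)) (a * expR (a * x)).
  have := @is_derive1_comp _ expR (fun x => a * x) x _ a (is_derive_expR _) _.
  rewrite mulrC; apply; apply: is_derive_eq; rewrite /GRing.scale/= mulr1; ring.
have dF x : is_derive x 1 (fun x => expR (- (a * x))) (- a * expR (- (a * x))).
  have := @is_derive1_comp _ expR (fun x => - (a * x)) x _ (- a) (is_derive_expR _) _.
  rewrite mulrC; apply; apply: is_derive_eq; rewrite /GRing.scale/= mulr1; ring.
have dv x : is_derive x 1 v (v' x).
  have h1 := dE x; have h2 := dF x.
  rewrite /v; apply: is_derive_eq; rewrite /GRing.scale/= /v'; ring.
have EF x : expR (a * x) * expR (- (a * x)) = 1 by rewrite expRxMexpNx_1.
have vE x : 0 <= x -> expR (a * x) <= v x.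
  move=> x0; have ax : 0 <= a * x by rewrite mulr_ge0// ltW.
  have E1 : 1 <= expR (a * x) by rewrite (le_trans _ (expR_ge1Dx _))// lerDl.
  have F1 : expR (- (a * x)) <= 1 by rewrite expR_le1 oppr_le0.
  rewrite /v ler_pdivlMr//; nra.
have vlin x : 0 <= x -> 1 + a * x <= v x.
  by move=> x0; apply: le_trans (vE x x0); exact: expR_ge1Dx.
eexists; apply: (@profile_of_inverse_power p t v) => //; first exact: ltW.
- by move=> x; apply/differentiable_continuous/derivable1_diffP; have [] := dv x.
- by rewrite /v mulr0 oppr0 expR0; field.
- by move=> x x0; apply: le_trans (vlin x x0); rewrite lerDl mulr_ge0// ltW.
- move=> x x0; suff <- : v' x = (p / 2 - 1) * Num.sqrt (2 / p + t * v x ^+ 2) by exact: dv.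
  have k0 : 0 < p / 2 - 1 by lra.
  have v'0 : 0 <= v' x.
    rewrite /v' divr_ge0// mulr_ge0// ?ltW//.
    have := expR_gt0 (a * x); have := expR_gt0 (- (a * x)); nra.
  have S : v' x ^+ 2 = (p / 2 - 1) ^+ 2 * (2 / p + t * v x ^+ 2).
    have -> : v' x ^+ 2 = a ^+ 2 * (v x ^+ 2 - (1 - b ^+ 2) * (expR (a * x) * expR (- (a * x)))).
      by rewrite /v' /v; field.
    by rewrite EF a2 b2; field; lra.
  rewrite -[LHS]ger0_norm// -sqrtr_sqr S sqrtrM ?sqr_ge0// sqrtr_sqr ger0_norm// ltW//.
- exact: (cvgry_ge_linear a0).
Qed.

Lemma profile_exists p t : 2 < p -> 0 <= t -> exists U, profile p t 1 U.
Proof.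
move=> p2; rewrite le_eqVlt => /predU1P[<-|t0]; first exact: profile_exists0.
exact: profile_exists_gt0.
Qed.

End ProfileExistence.

(** * The weights and their integrability *)

Section ProfileIntegrals.
Context {R : realType}.
Notation mu := (@lebesgue_measure R).
Notation I0 := `[0, +oo[%classic.
Implicit Types (x y t s e r : R) (p w A k : R) (W v U f : R -> R).

(** The interval ]0, u] is exhausted by [1/(n+1), u], on which the antiderivative r^(1-s) / (1-s)
    bounds every integral by its value [C] at [u]. *)
Let integrable_powR_neg_pos (s u : R) : 0 < s < 1 -> 0 < u ->
  mu.-integrable `[0, u] (EFin \o (fun r => r `^ (- s))).
Proof.
move=> /andP[s0 s1] u0.
have mf : measurable_fun setT (fun r : R => r `^ (- s)) by exact: measurable_powR.
apply/integrableP; split; first by apply/measurable_EFinP; exact: measurable_funTS.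
under eq_integral do rewrite /= ger0_norm ?powR_ge0//.
rewrite -integral_itv_obnd_cbnd; last by apply/measurable_EFinP; exact: measurable_funTS.
pose F (n : nat) := `[n.+1%:R^-1 : R, u]%classic.
have FU : `]0, u]%classic = \bigcup_n F n.
  apply/seteqP; split => x.
    rewrite /= in_itv/= => /andP[x0 xu].
    have := near_infty_natSinv_lt (PosNum x0) => -[n _ /(_ n (leqnn _))] /= h.
    by exists n => //=; rewrite /F/= in_itv/= xu (ltW h).
  move=> [n _]; rewrite /F/= !in_itv/= => /andP[h ->]; rewrite andbT.
  by apply: lt_le_trans h; rewrite invr_gt0.
have ndF : nondecreasing_seq F.
  move=> m n mn; apply/subsetPset => x; rewrite /F/= !in_itv/= => /andP[h ->]; rewrite andbT.
  by apply: le_trans h; rewrite lef_pV2 ?posrE// ler_nat.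
pose C := u `^ (1 - s) / (1 - s).
apply: (@le_lt_trans _ _ C%:E); last by rewrite ltry.
have H' : (\int[mu]_(x in F i) (x `^ (- s))%:E @[i --> \oo] -->
   \int[mu]_(x in `]0%R, u]) (x `^ (- s))%:E)%E.
  rewrite FU; apply: ge0_nondecreasing_set_cvg_integral => //.
  - by move=> i; exact: measurable_itv.
  - by move=> i; apply/measurable_EFinP; exact: measurable_funTS.
  - by move=> i x _; rewrite lee_fin powR_ge0.
have B n : (\int[mu]_(x in F n) (x `^ (- s))%:E <= C%:E)%E.
  have n0 : 0 < n.+1%:R^-1 :> R by rewrite invr_gt0.
  have [un|nu] := leP u n.+1%:R^-1.
    have -> : (\int[mu]_(x in F n) (x `^ (- s))%:E = 0)%E.
      apply: (@integral_Sset1 _ _ _ u) => x; rewrite /F/= in_itv/= => /andP[h1 h2].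
      by apply/eqP; rewrite eq_le h2 (le_trans un).
    by rewrite lee_fin divr_ge0 ?powR_ge0// subr_ge0 ltW.
  have dG r : 0 < r -> is_derive r 1 (fun r => r `^ (1 - s) / (1 - s)) (r `^ (- s)).
    move=> r0; have d := is_derive1_powR (1 - s) r0.
    apply: is_derive_eq; rewrite /GRing.scale/=.
    have -> : 1 - s - 1 = - s by ring.
    by field; lra.
  have cG r : 0 < r -> {for r, continuous (fun r => r `^ (1 - s) / (1 - s))}.
    move=> r0; apply/differentiable_continuous/derivable1_diffP.
    by have [] := dG r r0.
  rewrite (@continuous_FTC2 _ _ (fun r => r `^ (1 - s) / (1 - s)) _ _ nu).
  - by rewrite -EFinB lee_fin lerBlDr lerDl divr_ge0 ?powR_ge0// subr_ge0 ltW.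
  - apply: continuous_in_subspaceT => r; rewrite inE/= in_itv/= => /andP[h _].
    by apply: continuous_powR_gt0; exact: lt_le_trans h.
  - split.
    + move=> r; rewrite in_itv/= => /andP[h _].
      by have [] := dG r (lt_trans n0 h).
    + by apply: cvg_at_right_filter; exact: cG.
    + by apply: cvg_at_left_filter; exact: cG.
  - move=> r; rewrite in_itv/= => /andP[h _]; rewrite derive1E.
    by have h' := dG r (lt_trans n0 h); exact: derive_val.
rewrite -(cvg_lim _ H')//; apply: lime_le; first by apply/cvg_ex; eexists; exact: H'.
by apply: nearW => n; exact: B.
Qed.

Lemma integrable_powR_neg s u : 0 < s < 1 ->
  mu.-integrable `[0, u] (EFin \o (fun r => r `^ (- s))).
Proof.
move=> s01; have u1 : 0 < Num.max u 1 by rewrite lt_max ltr01 orbT.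
apply: integrableS (integrable_powR_neg_pos s01 u1) => //.
by apply: subset_itvl; rewrite bnd_simp le_max lexx.
Qed.

Definition weight p t (a r : R) : R := (2 / p * r `^ (p / 2 - 1) + t) `^ a.

Lemma measurable_weight p t a : measurable_fun setT (weight p t a).
Proof.
apply: (measurableT_comp (measurable_powR a)) => //.
apply: measurable_funD => //; apply: measurable_funM => //.
Qed.

Lemma weight_ge0 p t a r : 0 <= weight p t a r.
Proof. exact: powR_ge0. Qed.

Lemma weight_arg_gt0 p t r : 2 < p -> 0 <= t -> 0 < r -> 0 < 2 / p * r `^ (p / 2 - 1) + t.
Proof.
by move=> p2 t0 r0; rewrite ltr_pwDl// mulr_gt0 ?powR_gt0 ?divr_gt0//; lra.
Qed.

Lemma continuous_weight p t a r : 2 < p -> 0 <= t -> 0 < r -> {for r, continuous (weight p t a)}.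
Proof.
move=> p2 t0 r0.
apply: (@continuous_comp _ _ _ (fun r => 2 / p * r `^ (p / 2 - 1) + t) (fun y => y `^ a)).
  apply: cvgD; last exact: cvg_cst.
  by apply: cvgM; [exact: cvg_cst|exact: continuous_powR_gt0].
by apply: continuous_powR_gt0; exact: weight_arg_gt0.
Qed.

(* For [t = 0] the profile decays algebraically and lies in L^2 only if [p < 6]. *)
Definition admissible p t := 0 < t \/ (t = 0 /\ p < 6).

Lemma admissible_ge0 p t : admissible p t -> 0 <= t.
Proof. by case=> [/ltW//|[-> _]]. Qed.

Lemma itg_cst_bound f (a b C : R) : measurable_fun setT f ->
  (forall r, a <= r <= b -> `|f r| <= C) -> mu.-integrable `[a, b] (EFin \o f).
Proof.
move=> mf fC; apply: (@itg_le _ _ _ _ (fun=> C)) => //.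
- exact: measurable_funTS.
- by apply: cont_itv_integrable; exact: cst_continuous.
Qed.

Lemma integrable_weight_half p t u : 2 < p -> 0 <= t ->
  mu.-integrable `[0, u] (EFin \o weight p t 2^-1).
Proof.
move=> p2 t0.
apply: (@itg_cst_bound _ _ _ ((2 / p * u `^ (p / 2 - 1) + t) `^ 2^-1)).
  exact: measurable_weight.
move=> r /andP[r0 ru]; have u0 := le_trans r0 ru.
rewrite ger0_norm; last exact: weight_ge0.
have p0 : 0 <= 2 / p by rewrite divr_ge0//; lra.
apply: ge0_ler_powR.
- by rewrite invr_ge0.
- by rewrite nnegrE addr_ge0// mulr_ge0// powR_ge0.
- by rewrite nnegrE addr_ge0// mulr_ge0// powR_ge0.
rewrite lerD2r ler_pM2l ?divr_gt0//; last lra.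
by rewrite ge0_ler_powR ?nnegrE//; lra.
Qed.

Lemma weight_neg_le p t r a : 2 < p -> 0 < t -> 0 <= a -> weight p t (- a) r <= t `^ (- a).
Proof.
move=> p2 t0 a0; rewrite /weight !powRN lef_pV2 ?posrE ?powR_gt0//.
  rewrite ge0_ler_powR ?nnegrE ?(ltW t0)//.
    by rewrite addr_ge0 ?(ltW t0)// mulr_ge0 ?powR_ge0 ?divr_ge0//; lra.
  by rewrite lerDr mulr_ge0 ?powR_ge0 ?divr_ge0//; lra.
by rewrite ltr_wpDl// mulr_ge0 ?powR_ge0 ?divr_ge0//; lra.
Qed.

Lemma weight_neg_le0 p t r : 2 < p -> 0 <= t -> 0 <= r ->
  weight p t (- 2^-1) r <= (2 / p) `^ (- 2^-1) * r `^ (- ((p / 2 - 1) / 2)) \/ r = 0.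
Proof.
move=> p2 t0; rewrite le_eqVlt => /predU1P[<-|r0]; [by right|left].
have c0 : 0 < 2 / p by rewrite divr_gt0//; lra.
have -> : (2 / p) `^ (- 2^-1) * r `^ (- ((p / 2 - 1) / 2)) = (2 / p * r `^ (p / 2 - 1)) `^ (- 2^-1).
  by rewrite [RHS]powRM ?powR_ge0 ?(ltW c0)// -powRrM; congr (_ * _ `^ _); ring.
have h : 0 < 2 / p * r `^ (p / 2 - 1) by rewrite mulr_gt0 ?powR_gt0.
rewrite /weight !powRN lef_pV2 ?posrE ?powR_gt0 ?ltr_wpDr//.
by rewrite ge0_ler_powR ?nnegrE ?invr_ge0 ?addr_ge0 ?(ltW h)// lerDl.
Qed.

Definition sing_bound p (r : R) : R := (2 / p) `^ (- 2^-1) * r `^ (- ((p / 2 - 1) / 2)).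

(** The singularity at 0 has order (p/2 - 1)/2, which is below 1 exactly when [p < 6]. *)
Lemma integrable_sing_bound p u : 2 < p < 6 -> mu.-integrable `[0, u] (EFin \o sing_bound p).
Proof.
move=> p26; apply: itgZ => //; apply: integrable_powR_neg; lra.
Qed.

Lemma integrable_weight_neg p t u : 2 < p -> admissible p t ->
  mu.-integrable `[0, u] (EFin \o weight p t (- 2^-1)).
Proof.
move=> p2 [t0|[-> p6]].
  apply: (@itg_cst_bound _ _ _ (t `^ (- 2^-1))); first exact: measurable_weight.
  by move=> r _; rewrite ger0_norm ?weight_ge0// weight_neg_le// invr_ge0.
apply: (@itg_le _ _ _ _ (sing_bound p)) => //.
- by apply: measurable_funTS; exact: measurable_weight.
- move=> r /=; rewrite in_itv/= => /andP[r0 _]; rewrite ger0_norm ?weight_ge0//.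
  have [//|->] := weight_neg_le0 p2 (lexx 0) r0.
  (* At [r = 0] the weight is a negative power of 0, which is 0 by convention. *)
  rewrite /weight powR0 ?mulr0 ?addr0; last by lra.
  by rewrite powR0 ?mulr_ge0 ?powR_ge0//; lra.
- by apply: integrable_sing_bound; rewrite p2.
Qed.

End ProfileIntegrals.

(** * Substitution by the square of the profile *)

Section ProfileMass.
Context {R : realType}.
Notation mu := (@lebesgue_measure R).
Notation I0 := `[0, +oo[%classic.
Implicit Types (x y t s e r : R) (p w A k : R) (W v U f : R -> R).

(** The antiderivative is minus the primitive [Phi] of [f] composed with [U^2]; it tends to 0 at
    infinity. Continuity of [f] is asked away from 0 only, since the weights may be singular
    there. *)
Lemma profile_substitution p t U f : 2 < p -> 0 <= t -> profile p t 1 U ->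
  (forall s, 0 < s -> 0 <= f s) -> (forall s, 0 < s -> {for s, continuous f}) ->
  (forall u, mu.-integrable `[0, u] (EFin \o f)) ->
  (\int[mu]_(x in I0) (f (U x ^+ 2) * (2 * U x * slope p t (U x)))%:E =
   (\int[mu]_(s in `[0, 1]) f s)%:E)%E.
Proof.
move=> p2 t0 HU f0 cf fi; have p0 : 0 < p by lra.
pose Phi s := \int[mu]_(r in `[0, s]) f r.
have U0 x := profile_gt0 HU x.
have U2 x : 0 < U x ^+ 2 by rewrite exprn_gt0.
have cU := profile_continuous HU.
have dPhi s : 0 < s -> is_derive s 1 Phi (f s).
  move=> s0.
  have [d1 d2] := @continuous_FTC1_closed R f 0 s (s + 1) (ltr_pwDr ltr01 (lexx s)) (fi _) s0 (cf s s0).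
  by apply: DeriveDef; [exact: d1|rewrite -derive1E; exact: d2].
pose F x := - Phi (U x ^+ 2).
pose f' x := f (U x ^+ 2) * (2 * U x * slope p t (U x)).
have dU2 x : 0 < x -> is_derive x 1 (fun y => U y ^+ 2) (2 * U x * dprofile p t U x).
  move=> x0; have d := is_derive_profile HU x0.
  by apply: is_derive_eq; rewrite /GRing.scale/=; ring.
have dF x : 0 < x -> is_derive x 1 F (f' x).
  move=> x0.
  have D := @is_derive1_comp _ Phi (fun y => U y ^+ 2) x _ _ (dPhi _ (U2 x)) (dU2 x x0).
  have := is_deriveN D; congr is_derive; rewrite /f' /dprofile; ring.
have cU2 : continuous (fun x => U x ^+ 2).
  move=> x; apply: (@continuous_comp _ _ _ U (fun y => y ^+ 2)); first exact: cU.
  exact: exprn_continuous.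
have cf' : continuous f'.
  move=> x; apply: cvgM.
    apply: (@continuous_comp _ _ _ (fun x => U x ^+ 2) f); first exact: cU2.
    by apply: cf; exact: U2.
  apply: cvgM; first by apply: cvgM; [exact: cvg_cst|exact: cU].
  apply: (@continuous_comp _ _ _ U (slope p t)); first exact: cU.
  exact: continuous_slope.
have cF x : {for x, continuous F}.
  apply: cvgN; apply: (@continuous_comp _ _ _ (fun x => U x ^+ 2) Phi); first exact: cU2.
  apply/differentiable_continuous/derivable1_diffP.
  by have [] := dPhi _ (U2 x).
rewrite (@ge0_continuous_FTC2y _ f' F 0 0).
- by rewrite sub0e /F (profile_A HU) expr1n EFinN oppeK.
- move=> x _; rewrite /f' mulr_ge0 ?f0// mulr_ge0 ?mulr_ge0//; first by rewrite ltW.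
  by rewrite ltW// slope_gt0.
- exact: continuous_subspaceT.
- rewrite -oppr0; apply: cvgN.
  have h : U x ^+ 2 @[x --> +oo] --> 0.
    rewrite (_ : (fun x => _) = (fun x => U x * U x)) -1?[X in _ --> X](mulr0 0).
      by apply: cvgM; exact: (profile_cvg0 HU).
    by apply/funext => x; rewrite expr2.
  apply: cvg_comp h _.
  exact: (@parameterized_integral_cvg_left R 0 1 f ltr01 (fi 1)).
- by move=> x x0; have [] := dF x x0.
- by apply: cvg_at_right_filter; exact: cF.
- move=> x; rewrite in_itv/= andbT => x0; rewrite derive1E.
  by have h := dF x x0; exact: derive_val.
Qed.

Lemma slope_weight p t s : 2 < p -> 0 <= t -> 0 < s ->
  slope p t s = s * weight p t 2^-1 (s ^+ 2).
Proof.
move=> p2 t0 s0; rewrite /slope /weight powR12_sqrt; last first.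
  by apply: ltW; apply: weight_arg_gt0; rewrite // exprn_gt0.
have -> : 2 / p * s `^ p + t * s ^+ 2 = s ^+ 2 * (2 / p * (s ^+ 2) `^ (p / 2 - 1) + t).
  have -> : s `^ p = s ^+ 2 * (s ^+ 2) `^ (p / 2 - 1).
    rewrite -(powR_mulrn 2 (ltW s0)) -powRrM -powRD ?(gt_eqF s0) ?implybT//.
    by congr (_ `^ _); field.
  ring.
by rewrite sqrtrM ?sqr_ge0// sqrtr_sqr gtr0_norm.
Qed.

Lemma weight_inv p t r : 2 < p -> 0 <= t -> 0 < r ->
  weight p t (- 2^-1) r * weight p t 2^-1 r = 1.
Proof.
move=> p2 t0 r0; rewrite /weight powRN mulVf// gt_eqF// powR_gt0//.
exact: weight_arg_gt0.
Qed.

(* With [U] the profile of height 1, the substitution [r = U^2] turns the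
   integrals of [U^2] and [U'^2] over the line into these. *)
Definition mass_int p t := \int[mu]_(r in `[0, 1]) weight p t (- 2^-1) r.
Definition slope_int p t := \int[mu]_(r in `[0, 1]) weight p t 2^-1 r.

Lemma ge0_integral_EFin f (D : set R) (c : R) : measurable D -> measurable_fun D f ->
  (forall x, 0 <= f x) -> (\int[mu]_(x in D) (f x)%:E = c%:E)%E ->
  mu.-integrable D (EFin \o f) /\ \int[mu]_(x in D) f x = c.
Proof.
move=> mD mf f0 E; split; last by rewrite /Rintegral E.
apply/integrableP; split; first exact/measurable_EFinP.
by under eq_integral do rewrite /= ger0_norm//; rewrite E ltry.
Qed.

Lemma profile_mass p t U : 2 < p -> admissible p t -> profile p t 1 U ->
  mu.-integrable I0 (EFin \o (fun x => U x ^+ 2)) /\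
  \int[mu]_(x in I0) (U x ^+ 2) = mass_int p t / 2.
Proof.
move=> p2 adm HU; have t0 := admissible_ge0 adm.
have U0 x := profile_gt0 HU x.
have cU := profile_continuous HU.
apply: ge0_integral_EFin => //.
- apply: measurable_funX; apply: measurable_funTS; exact: continuous_measurable_fun.
- by move=> x; exact: sqr_ge0.
have -> : (mass_int p t / 2)%:E = (\int[mu]_(s in `[0, 1]) (2^-1 * weight p t (- 2^-1) s))%:E.
  by rewrite RintegralZl//; [rewrite mulrC|exact: integrable_weight_neg].
rewrite -(profile_substitution p2 t0 HU).
- apply: eq_integral => x _; congr EFin.
  have U2 : 0 < U x ^+ 2 by rewrite exprn_gt0.
  have := weight_inv p2 t0 U2.
  rewrite slope_weight//.
  move: (weight p t (- 2^-1) _) (weight p t 2^-1 _) => a b ab.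
  have -> : 2^-1 * a * (2 * U x * (U x * b)) = U x ^+ 2 * (a * b) by field.
  by rewrite ab mulr1.
- by move=> s s0; rewrite mulr_ge0// weight_ge0.
- move=> s s0; apply: cvgM; first exact: cvg_cst.
  exact: continuous_weight.
- by move=> u; apply: itgZ => //; exact: integrable_weight_neg.
Qed.

Lemma profile_slope_mass p t U : 2 < p -> 0 <= t -> profile p t 1 U ->
  mu.-integrable I0 (EFin \o (fun x => dprofile p t U x ^+ 2)) /\
  \int[mu]_(x in I0) (dprofile p t U x ^+ 2) = slope_int p t / 2.
Proof.
move=> p2 t0 HU.
have U0 x := profile_gt0 HU x.
have cZ := dprofile_continuous p2 t0 HU.
apply: ge0_integral_EFin => //.
- apply: measurable_funX; apply: measurable_funTS; exact: continuous_measurable_fun.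
- by move=> x; exact: sqr_ge0.
have -> : (slope_int p t / 2)%:E = (\int[mu]_(s in `[0, 1]) (2^-1 * weight p t 2^-1 s))%:E.
  by rewrite RintegralZl//; [rewrite mulrC|exact: integrable_weight_half].
rewrite -(profile_substitution p2 t0 HU).
- apply: eq_integral => x _; congr EFin.
  by rewrite /dprofile sqrrN slope_weight//; field.
- by move=> s s0; rewrite mulr_ge0// weight_ge0.
- move=> s s0; apply: cvgM; first exact: cvg_cst.
  exact: continuous_weight.
- by move=> u; apply: itgZ => //; exact: integrable_weight_half.
Qed.

Lemma scale_half_line f (l c : R) : 0 < l -> continuous f -> (forall x, 0 <= f x) ->
  mu.-integrable I0 (EFin \o f) -> \int[mu]_(x in I0) f x = c ->
  mu.-integrable I0 (EFin \o (fun x => f (l * x))) /\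
  \int[mu]_(x in I0) f (l * x) = c / l.
Proof.
move=> l0 cf f0 fi fc.
have cfl : continuous (fun x => f (l * x)).
  move=> x; apply: (@continuous_comp _ _ _ (fun x => l * x) f); last exact: cf.
  by apply: cvgM; [exact: cvg_cst|exact: cvg_id].
have dl x : is_derive x 1 (fun x => l * x) l.
  by apply: is_derive_eq; rewrite /GRing.scale/= mulr1; ring.
have dlE : (fun x => l * x)^`()%classic = cst l.
  by apply/funext => x; rewrite derive1E; exact: derive_val.
have cl : continuous (fun x : R => l * x).
  by move=> x; apply: cvgM; [exact: cvg_cst|exact: cvg_id].
apply: ge0_integral_EFin => //.
  by apply: measurable_funTS; exact: continuous_measurable_fun.
have := @increasing_ge0_integration_by_substitutiony R (fun x => l * x) f 0.
rewrite mulr0 dlE => H.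
have {}H : (\int[mu]_(x in I0) (f x)%:E = \int[mu]_(x in I0) (l%:E * (f (l * x))%:E))%E.
  rewrite H.
  - by apply: eq_integral => x _; rewrite -EFinM mulrC.
  - by move=> x y _ _ xy; rewrite ltr_pM2l.
  - by move=> x _; exact: cst_continuous.
  - exact: is_cvg_cst.
  - exact: is_cvg_cst.
  - split; first by move=> x _; have [] := dl x.
    by apply: cvg_at_right_filter; exact: cl.
  - by apply: gt0_cvgMry => //; exact: cvg_id.
  - exact: continuous_subspaceT.
  - by move=> x _.
have {}H : (\int[mu]_(x in I0) (f x)%:E = l%:E * \int[mu]_(x in I0) (f (l * x))%:E)%E.
  rewrite H; apply: ge0_integralZl => //.
  - by apply/measurable_EFinP; apply: measurable_funTS; exact: continuous_measurable_fun.
  - by move=> x _; rewrite lee_fin.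
  - by rewrite lee_fin ltW.
have E : (\int[mu]_(x in I0) (f x)%:E = c%:E)%E.
  by rewrite -fc /Rintegral fineK//; exact: integrable_fin_num.
move: H; rewrite E => H.
have : (l^-1%:E * c%:E = l^-1%:E * (l%:E * \int[mu]_(x in I0) (f (l * x))%:E))%E by rewrite H.
rewrite muleA -!EFinM mulVf ?gt_eqF// mul1e => <-.
by rewrite mulrC.
Qed.

End ProfileMass.

(** * Test functions and sharp energy bound *)

Section EnergyBounds.
Context {R : realType}.
Notation mu := (@lebesgue_measure R).
Notation I0 := `[0, +oo[%classic.
Implicit Types (x y t s e r : R) (p q w A k l m : R) (W u v U f : R -> R).

Definition std_profile p t : R -> R := xget (cst 0) [set U | profile p t 1 U].

Lemma std_profileP p t : 2 < p -> 0 <= t -> profile p t 1 (std_profile p t).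
Proof.
move=> p2 t0; rewrite /std_profile; case: xgetP => [//|h].
by have [U HU] := profile_exists p2 t0; have := h U.
Qed.

Definition scaled_profile p t A x : R := A * std_profile p t (A `^ (p / 2 - 1) * x).

Lemma slope_scale p t A s : 2 < p -> 0 <= t -> 0 < A -> 0 < s ->
  slope p (t * A `^ (p - 2)) (A * s) = A * A `^ (p / 2 - 1) * slope p t s.
Proof.
move=> p2 t0 A0 s0; rewrite /slope.
have E1 : (A * A `^ (p / 2 - 1)) ^+ 2 = A `^ p.
  rewrite mulr_powRB1 ?(ltW A0)//; last by lra.
  by rewrite -powR_mulrn ?powR_ge0// -powRrM; congr (_ `^ _); field.
have E2 : A `^ (p - 2) * A ^+ 2 = A `^ p.
  rewrite -(powR_mulrn 2 (ltW A0)) -powRD ?(gt_eqF A0) ?implybT//.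
  by congr (_ `^ _); ring.
have -> : 2 / p * (A * s) `^ p + t * A `^ (p - 2) * (A * s) ^+ 2 =
    (A * A `^ (p / 2 - 1)) ^+ 2 * (2 / p * s `^ p + t * s ^+ 2).
  rewrite powRM ?(ltW A0) ?(ltW s0)// E1 -E2; ring.
by rewrite sqrtrM ?sqr_ge0// sqrtr_sqr ger0_norm// mulr_ge0 ?powR_ge0// ltW.
Qed.

Lemma scaled_profileP p t A : 2 < p -> 0 <= t -> 0 < A ->
  profile p (t * A `^ (p - 2)) A (scaled_profile p t A).
Proof.
move=> p2 t0 A0; have HU := std_profileP p2 t0.
set l := A `^ (p / 2 - 1); have l0 : 0 < l by rewrite powR_gt0.
have cl : continuous (fun x : R => l * x).
  by move=> x; apply: cvgM; [exact: cvg_cst|exact: cvg_id].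
split.
- move=> x; apply: cvgM; first exact: cvg_cst.
  by apply: (@continuous_comp _ _ _ (fun x => l * x) (std_profile p t)); [exact: cl|exact: profile_continuous HU _].
- by move=> x; rewrite /scaled_profile mulrN (profile_even HU).
- by rewrite /scaled_profile mulr0 (profile_A HU) mulr1.
- by move=> x; rewrite /scaled_profile mulr_gt0// (profile_gt0 HU).
split.
  move=> x x0; have lx : 0 < l * x by rewrite mulr_gt0.
  have dl : is_derive x 1 (fun x => l * x) l.
    by apply: is_derive_eq; rewrite /GRing.scale/= mulr1; ring.
  have D := @is_derive1_comp _ (std_profile p t) (fun x => l * x) x _ _ (is_derive_profile HU lx) dl.
  have := is_deriveZ A D; congr is_derive.
  rewrite /scaled_profile slope_scale// ?(profile_gt0 HU)// /GRing.scale/= /dprofile -/l; ring.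
rewrite -[X in _ --> X](mulr0 A); apply: cvgM; first exact: cvg_cst.
apply: cvg_comp (profile_cvg0 HU).
by apply: gt0_cvgMry => //; exact: cvg_id.
Qed.

Lemma dprofile_scale p t A x : 2 < p -> 0 <= t -> 0 < A ->
  dprofile p (t * A `^ (p - 2)) (scaled_profile p t A) x =
  A * A `^ (p / 2 - 1) * dprofile p t (std_profile p t) (A `^ (p / 2 - 1) * x).
Proof.
move=> p2 t0 A0; rewrite /dprofile /scaled_profile slope_scale//; first by rewrite mulrN.
exact: (profile_gt0 (std_profileP p2 t0)).
Qed.

(** Height [A] and dilation [l] are independent here. The choice [l = A^(p/2-1)] gives the scaled
    profile, while other choices serve for spreading the mass out and for the stationarity
    argument. *)
Lemma test_function p q t A l : 2 < p -> admissible p t -> 0 < A -> 0 < l ->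
  exists2 u, H1mass (A ^+ 2 / l * mass_int p t) u &
   energy p q u = (A ^+ 2 * l / 2 * slope_int p t +
     A `^ p / l * ((slope_int p t - t * mass_int p t) / 2) - q^-1 * A `^ q)%:E.
Proof.
move=> p2 adm A0 l0; have t0 := admissible_ge0 adm; have p0 : 0 < p by lra.
have HU := std_profileP p2 t0; set U := std_profile p t in HU.
have U0 x := profile_gt0 HU x.
have cU := profile_continuous HU.
have cZ := dprofile_continuous p2 t0 HU.
have [iU EU] := profile_mass p2 adm HU.
have [iZ EZ] := profile_slope_mass p2 t0 HU.
have csq (f : R -> R) : continuous f -> continuous (fun x => f x ^+ 2).
  move=> cf x; apply: (@continuous_comp _ _ _ f (fun y => y ^+ 2)); first exact: cf.
  exact: exprn_continuous.
have clx (f : R -> R) : continuous f -> continuous (fun x => f (l * x)).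
  move=> cf x; apply: (@continuous_comp _ _ _ (fun x => l * x) f); last exact: cf.
  by apply: cvgM; [exact: cvg_cst|exact: cvg_id].
have [iUl EUl] := scale_half_line l0 (csq _ cU) (fun x => sqr_ge0 (U x)) iU EU.
have [iZl EZl] := scale_half_line l0 (csq _ cZ) (fun x => sqr_ge0 _) iZ EZ.
pose u x := A * U (l * x).
pose z x := A * l * dprofile p t U (l * x).
have uE x : u x ^+ 2 = A ^+ 2 * U (l * x) ^+ 2 by rewrite exprMn.
have zE x : z x ^+ 2 = (A * l) ^+ 2 * dprofile p t U (l * x) ^+ 2 by rewrite exprMn.
have cu : continuous u by move=> x; apply: cvgM; [exact: cvg_cst|exact: clx].
have cz : continuous z by move=> x; apply: cvgM; [exact: cvg_cst|exact: clx].
have eu x : u (- x) = u x by rewrite /u mulrN (profile_even HU).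
have du x : 0 < x -> is_derive x 1 u (z x).
  move=> x0; have lx : 0 < l * x by rewrite mulr_gt0.
  have dl : is_derive x 1 (fun x => l * x) l.
    by apply: is_derive_eq; rewrite /GRing.scale/= mulr1; ring.
  have D := @is_derive1_comp _ U (fun x => l * x) x _ _ (is_derive_profile HU lx) dl.
  have := is_deriveZ A D; congr is_derive.
  by rewrite /GRing.scale/= /z; ring.
have mI := measurable_itv `[(0 : R), +oo[.
have iu : mu.-integrable I0 (EFin \o (fun x => u x ^+ 2)).
  have -> : (fun x => u x ^+ 2) = (fun x => A ^+ 2 * U (l * x) ^+ 2) by apply/funext => x.
  exact: itgZ.
have iz : mu.-integrable I0 (EFin \o (fun x => z x ^+ 2)).
  have -> : (fun x => z x ^+ 2) = (fun x => (A * l) ^+ 2 * dprofile p t U (l * x) ^+ 2) by apply/funext => x.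
  exact: itgZ.
have Iu : \int[mu]_(x in I0) (u x ^+ 2) = A ^+ 2 * (mass_int p t / 2 / l).
  transitivity (\int[mu]_(x in I0) (A ^+ 2 * U (l * x) ^+ 2)); first exact: eq_Rintegral.
  by rewrite RintegralZl// EUl.
have Iz : \int[mu]_(x in I0) (z x ^+ 2) = (A * l) ^+ 2 * (slope_int p t / 2 / l).
  transitivity (\int[mu]_(x in I0) ((A * l) ^+ 2 * dprofile p t U (l * x) ^+ 2)); first exact: eq_Rintegral.
  by rewrite RintegralZl// EZl.
have [hu Em Ew] := even_H1 cu cz eu du iu iz.
exists u; first by split => //; rewrite Em Iu; congr EFin; field; lra.
rewrite /energy Ew Iz Lpnorm_powR//.
have u0 x : 0 < u x by rewrite mulr_gt0.
(* The first integral expresses [U^p] through [U'^2] and [U^2], which reduces the L^p norm to the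
   two integrals already known. *)
pose f x := A `^ p * (p / 2) * (dprofile p t U (l * x) ^+ 2 - t * U (l * x) ^+ 2).
have uf x : `|u x| `^ p = f x.
  rewrite gtr0_norm// powRM ?ltW// /f /dprofile sqrrN sqr_slope//.
  by field; lra.
have if_ : mu.-integrable I0 (EFin \o f).
  by apply: itgZ => //; apply: itgB => //; exact: itgZ.
have If : \int[mu]_(x in I0) f x = A `^ p * (p / 2) * (slope_int p t / 2 / l - t * (mass_int p t / 2 / l)).
  rewrite RintegralZl//; last by apply: itgB => //; exact: itgZ.
  rewrite RintegralB//; last exact: itgZ.
  by rewrite RintegralZl// EUl EZl.
have ef x : f (- x) = f x by rewrite -!uf eu.
have f0 x : 0 <= f x by rewrite -uf powR_ge0.
have mf : measurable_fun setT f.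
  have -> : f = fun x => `|u x| `^ p by apply/funext => x; rewrite uf.
  apply: measurable_norm_powR; exact: continuous_measurable_fun.
have [ifT EfT] := even_line mf f0 ef if_.
have -> : (\int[mu]_x (`|u x| `^ p)%:E = (2 * \int[mu]_(x in I0) f x)%:E)%E.
  rewrite -EfT /Rintegral fineK; last exact: integrable_fin_num.
  by apply: eq_integral => x _; rewrite uf.
rewrite If (_ : u 0 = A); last by rewrite /u mulr0 (profile_A HU) mulr1.
rewrite gtr0_norm// -!EFinM -!EFinD; congr EFin; congr (_ + _ - _).
  by field; lra.
by field; lra.
Qed.

(** This holds for arbitrary [f], as infinite integrals become 0 on both sides. It thus applies
    directly to the identity defining a weak derivative. *)
Lemma RintegralN f (D : set R) : \int[mu]_(x in D) (- f x) = - \int[mu]_(x in D) f x.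
Proof.
rewrite /Rintegral.
have -> : (\int[mu]_(x in D) (- f x)%:E = \int[mu]_(x in D) (\- (EFin \o f)) x)%E.
  by apply: eq_integral => x _; rewrite EFinN.
have -> : (\int[mu]_(x in D) (f x)%:E = \int[mu]_(x in D) (EFin \o f) x)%E by [].
rewrite integralE [in RHS]integralE funeposN funenegN.
have : (0 <= \int[mu]_(x in D) (EFin \o f)^\+ x)%E.
  by apply: integral_ge0 => x _; exact: funepos_ge0.
have : (0 <= \int[mu]_(x in D) (EFin \o f)^\- x)%E.
  by apply: integral_ge0 => x _; exact: funeneg_ge0.
move: (\int[mu]_(x in D) (EFin \o f)^\- x)%E (\int[mu]_(x in D) (EFin \o f)^\+ x)%E.
by move=> [a| |] [b| |] //= _ _; rewrite ?oppr0// opprB.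
Qed.

Lemma H1_opp v : H1 v -> H1 (\- v) /\
  (Lpnorm 2 (weak_derivative (\- v)%R) `^ 2 = Lpnorm 2 (weak_derivative v) `^ 2)%E.
Proof.
move=> hv; have [g2 vg] := weak_derivativeP hv; set g := weak_derivative v in g2 vg *.
have [cv v2 _] := hv.
have L2N f : L2 f -> L2 (\- f) by move=> f2; exact: (Lfun_oppr_closed f2).
have Ng2 := L2N _ g2.
have w : is_weak_derivative (\- v) (\- g).
  move=> phi hphi.
  have := vg phi hphi => E.
  under eq_Rintegral do rewrite /= mulNr.
  under [in RHS]eq_Rintegral do rewrite /= mulNr.
  by rewrite !RintegralN E.
have hN : H1 (\- v).
  split; [by move=> x; apply: cvgN; exact: cv|exact: L2N|by exists (\- g)].
split => //.
rewrite (Lpnorm_weak_derivative hN Ng2 w) (L2_Lpnorm g2); congr EFin.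
by apply: eq_Rintegral => x _; rewrite sqrrN.
Qed.

Lemma energy_opp p q v : H1 v -> energy p q (\- v) = energy p q v.
Proof.
move=> hv; rewrite /energy (H1_opp hv).2 normrN; congr (_ + _ * _ - _)%E.
by rewrite /Lpnorm (_ : EFin \o (\- v)%R = \- (EFin \o v))%E// oppe_Lnorm.
Qed.

Lemma H1mass_opp m v : H1mass m v -> H1mass m (\- v).
Proof.
move=> [hv vm]; split; first exact: (H1_opp hv).1.
by rewrite -vm /Lpnorm (_ : EFin \o (\- v)%R = \- (EFin \o v))%E// oppe_Lnorm.
Qed.

(** A family of lower bounds indexed by [t], from the multiplier [t A^(p-2)]; the mass enters only
    through the term that compensates this multiplier. A negative [u 0] is treated by passing to
    [\- u]. *)
Lemma energy_ge p q t m u : 2 < p -> admissible p t -> H1mass m u -> u 0 != 0 ->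
  let A := `|u 0| in
  let E := A `^ (p / 2 + 1) * slope_int p t - t * A `^ (p - 2) / 2 * m - q^-1 * A `^ q in
  (E%:E <= energy p q u)%E /\
  ((energy p q u <= E%:E)%E -> u = scaled_profile p t A \/ u = \- scaled_profile p t A).
Proof.
move=> p2 adm; have t0 := admissible_ge0 adm.
have H v : H1mass m v -> 0 < v 0 ->
  let E := v 0 `^ (p / 2 + 1) * slope_int p t - t * v 0 `^ (p - 2) / 2 * m - q^-1 * v 0 `^ q in
  (E%:E <= energy p q v)%E /\ ((energy p q v <= E%:E)%E -> v = scaled_profile p t (v 0)).
  move=> vm; set A := v 0 => A0.
  have w0 : 0 <= t * A `^ (p - 2) by rewrite mulr_ge0// powR_ge0.
  have HW := scaled_profileP p2 t0 A0.
  have HU := std_profileP p2 t0.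
  have [iZ EZ] := profile_slope_mass p2 t0 HU.
  have cZ := dprofile_continuous p2 t0 HU.
  have l0 : 0 < A `^ (p / 2 - 1) by rewrite powR_gt0.
  have c2 : continuous (fun x => dprofile p t (std_profile p t) x ^+ 2).
    move=> x; apply: (@continuous_comp _ _ _ (dprofile p t (std_profile p t)) (fun y => y ^+ 2)); first exact: cZ.
    exact: exprn_continuous.
  have [iZl EZl] := scale_half_line l0 c2 (fun x => sqr_ge0 _) iZ EZ.
  have zE : (fun x => dprofile p (t * A `^ (p - 2)) (scaled_profile p t A) x ^+ 2) =
     (fun x => (A * A `^ (p / 2 - 1)) ^+ 2 * dprofile p t (std_profile p t) (A `^ (p / 2 - 1) * x) ^+ 2).
    by apply/funext => x; rewrite dprofile_scale// exprMn.
  have mI := measurable_itv `[(0 : R), +oo[.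
  have iW : mu.-integrable I0 (EFin \o (fun x => dprofile p (t * A `^ (p - 2)) (scaled_profile p t A) x ^+ 2)).
    by rewrite zE; exact: itgZ.
  have := energy_lower_bound q p2 w0 HW iW vm (erefl A).
  rewrite zE RintegralZl// EZl.
  have -> : 2 * ((A * A `^ (p / 2 - 1)) ^+ 2 * (slope_int p t / 2 / A `^ (p / 2 - 1))) =
     A `^ (p / 2 + 1) * slope_int p t.
    have -> : A `^ (p / 2 + 1) = A * (A * A `^ (p / 2 - 1)).
      rewrite [A * A `^ _]mulr_powRB1 ?(ltW A0)//; last by lra.
      by rewrite powRD ?(gt_eqF A0) ?implybT// powRr1 ?ltW// mulrC.
    by field; rewrite gt_eqF.
  exact.
move=> um; rewrite neq_lt => /orP[h|h] A E; last first.
  have [B1 B2] := H u um h; rewrite /E /A gtr0_norm//; split => // le.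
  by left; exact: B2.
have hN : 0 < (\- u) 0 by rewrite /= oppr_gt0.
have [B1 B2] := H _ (H1mass_opp um) hN.
move: B1 B2; rewrite energy_opp; last by case: um.
rewrite /E /A ltr0_norm// => B1 B2; split => // le; right.
rewrite -[X in \- scaled_profile p t X]/((\- u) 0) -B2//.
by apply/funext => x /=; rewrite opprK.
Qed.


(** This settles the functions that have no height to normalise by: only nonnegative terms remain,
    and the L^p term vanishes only if [u] is 0 almost everywhere. *)
Lemma energy_gt0 p q m u : 0 < p -> q != 0 -> H1mass m u -> 0 < m -> u 0 = 0 ->
  (0 < energy p q u)%E.
Proof.
move=> p0 q0 [hu um] m0 u0.
have [g2 _] := weak_derivativeP hu; have [_ u2 _] := hu.
have mu_ := L2_measurable u2.
rewrite /energy (L2_Lpnorm g2) Lpnorm_powR// u0 normr0 powR0// mulr0 sube0.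
have N0 : (0 <= (2^-1)%:E * (\int[mu]_x (weak_derivative u x ^+ 2))%:E)%E.
  by rewrite -EFinM lee_fin mulr_ge0// Rintegral_ge0// => x _; exact: sqr_ge0.
have P0 : (0 <= \int[mu]_x (`|u x| `^ p)%:E)%E.
  by apply: integral_ge0 => x _; rewrite lee_fin powR_ge0.
apply: (@lt_le_trans _ _ ((p^-1)%:E * \int[mu]_x (`|u x| `^ p)%:E)%E); last by rewrite leeDr.
apply: mule_gt0; first by rewrite lte_fin invr_gt0.
rewrite lt0e P0 andbT; apply/eqP => E.
have mup := measurable_norm_powR p mu_.
have : (\int[mu]_x `|(EFin \o (fun x => (`|u x| `^ p)%R)) x| = 0)%E.
  by rewrite -E; apply: eq_integral => x _; rewrite /= ger0_norm ?powR_ge0.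
move=> /ae_eq_integral_abs => H; have {}H := H measurableT _.
have := L2_Lpnorm u2; rewrite um => -[] Em.
have : \int[mu]_x (u x ^+ 2) = 0.
  rewrite /Rintegral (@ae_eq_integral _ _ _ mu setT (cst 0%E))//.
  - by rewrite integral0.
  - by have /integrableP[] := L2_sqr_integrable u2.
  - have {}H := H _; apply: filterS (H _).
      move=> x /(_ I) /= [] /powR_eq0_eq0/eqP; rewrite normr_eq0 => /eqP -> _.
      by rewrite expr0n.
    exact/measurable_EFinP.
by rewrite -Em => m00; move: m0; rewrite m00 ltxx.
Qed.

Lemma zero_function p q : 0 < p -> q != 0 ->
  H1mass 0 (cst 0 : R -> R) /\ energy p q (cst 0 : R -> R) = 0%E.
Proof.
move=> p0 q0.
have mI := measurable_itv `[(0 : R), +oo[.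
have E0 : (fun x : R => cst 0 x ^+ 2) = cst 0 :> (R -> R).
  by apply/funext => x /=; rewrite expr0n.
have i0 : mu.-integrable I0 (EFin \o (fun x : R => cst (0 : R) x ^+ 2)).
  by rewrite E0; exact: integrable0.
have I00 : \int[mu]_(x in I0) (cst (0 : R) x ^+ 2) = 0.
  by rewrite E0 /Rintegral; under eq_integral do rewrite /=; rewrite integral0.
have [h1 h2 h3] := @even_H1 R (cst 0) (cst 0) (fun x => cvg_cst _) (fun x => cvg_cst _)
  (fun=> erefl) (fun x _ => is_derive_cst 0 x 1) i0 i0.
split; first by split => //; rewrite h2 I00 mulr0.
rewrite /energy h3 I00 mulr0 mule0 add0e Lpnorm_powR//= normr0 powR0 ?gt_eqF//.
by rewrite integral0 mule0 powR0// mulr0 sube0.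
Qed.

End EnergyBounds.

(** * The integrals over [0, 1] *)

Section MassFacts.
Context {R : realType}.
Notation mu := (@lebesgue_measure R).
Implicit Types (x y t s e r : R) (p q w A k l m : R) (f g : R -> R).

(** Equal integrals would force [f = g] almost everywhere on ]0, 1[, an interval of measure 1 where
    the inequality is strict. *)
Lemma lt_Rintegral01 f g : mu.-integrable `[0, 1] (EFin \o f) -> mu.-integrable `[0, 1] (EFin \o g) ->
  (forall r, 0 < r < 1 -> f r < g r) ->
  \int[mu]_(r in `[0, 1]) f r < \int[mu]_(r in `[0, 1]) g r.
Proof.
move=> fi gi fg.
have sub : `]0, 1[%classic `<=` `[0%R : R, 1].
  by move=> x /=; rewrite !in_itv/= => /andP[/ltW -> /ltW ->].
have E h : mu.-integrable `[0, 1] (EFin \o h) ->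
    \int[mu]_(r in `[0, 1]) h r = \int[mu]_(r in `]0, 1[) h r.
  move=> hi; rewrite /Rintegral (@integral_itv_bndoo R 0 1 (EFin \o h) true false)//.
  have /integrableP[mh _] := hi; exact: measurable_funS mh.
rewrite !E// -subr_gt0 -RintegralB//; [|exact: integrableS gi|exact: integrableS fi].
have di : mu.-integrable `]0, 1[ (EFin \o (fun r => g r - f r)).
  by apply: itgB => //; [exact: integrableS gi|exact: integrableS fi].
rewrite lt_neqAle eq_sym Rintegral_ge0 ?andbT; last first.
  by move=> x /=; rewrite in_itv/= subr_ge0 => /fg/ltW.
apply/eqP => I0.
have J : (\int[mu]_(r in `]0%R, 1%R[) `|(EFin \o (fun r => (g r - f r)%R)) r| = 0)%E.
  transitivity (\int[mu]_(r in `]0%R, 1%R[) (g r - f r)%:E)%E.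
    apply: eq_integral => x; rewrite inE/= in_itv/= => /fg h.
    by rewrite ger0_norm// subr_ge0 ltW.
  by rewrite -[LHS]fineK ?(integrable_fin_num _ di)//; congr EFin.
have /integrableP[md _] := di.
have /ae_eq_integral_abs H := J.
have := H (measurable_itv _) md.
move=> [B [mB B0 sB]].
have : (mu `]0%R, 1%R[%classic <= mu B)%E.
  apply: le_measure; rewrite ?inE//.
  move=> x x01; apply: sB => /= h.
  have := h x01 => -[] /eqP; rewrite subr_eq0 => /eqP e.
  by move: x01; rewrite /= in_itv/= => /fg; rewrite e ltxx.
by rewrite B0 lebesgue_measure_itv/= lte_fin ltr01 sube0 lee_fin ler10.
Qed.

Lemma Rintegral01_cst e : \int[mu]_(r in `[0, 1]) e = e.
Proof.
have muE : mu `[0%R, 1%R]%classic = 1%:E.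
  by rewrite lebesgue_measure_itv/= lte_fin ltr01 sube0.
apply: (etrans (congr1 fine (integral_cst mu (measurable_itv `[(0:R), 1]) e%:E))).
by rewrite [X in (_ * X)%E](_ : _ = 1%:E); [rewrite mule1|exact: muE].
Qed.

Lemma integrable01_cst e : mu.-integrable `[0, 1] (EFin \o (fun=> e)).
Proof. by apply: cont_itv_integrable; exact: cst_continuous. Qed.

Lemma le_Rintegral01 f g : mu.-integrable `[0, 1] (EFin \o f) -> mu.-integrable `[0, 1] (EFin \o g) ->
  (forall r, 0 < r < 1 -> f r <= g r) ->
  \int[mu]_(r in `[0, 1]) f r <= \int[mu]_(r in `[0, 1]) g r.
Proof.
move=> fi gi fg; apply/ler_addgt0Pl => e e0.
rewrite -[X in _ <= X + _]Rintegral01_cst -RintegralD//; last exact: integrable01_cst.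
apply: ltW; apply: lt_Rintegral01 => //.
  by apply: itgD => //; exact: integrable01_cst.
by move=> r /fg h; apply: (le_lt_trans h); rewrite ltrDr.
Qed.

Section fixp.
Variables (p : R) (p2 : 2 < p).
Notation m := (mass_int p).
Notation G := (slope_int p).
Notation c := (2 / p).
Notation k := (p / 2 - 1).

Let p0 : 0 < p. Proof. exact: lt_trans p2. Qed.

Let c0 : 0 < c. Proof. exact: divr_gt0. Qed.

Let k0 : 0 < k. Proof. by have := p2; lra. Qed.

Lemma lt_weight_neg t1 t2 r : 0 <= t1 -> t1 < t2 -> 0 < r ->
  weight p t2 (- 2^-1) r < weight p t1 (- 2^-1) r.
Proof.
move=> t10 t12 r0; have X1 := weight_arg_gt0 p2 t10 r0.
have X2 := weight_arg_gt0 p2 (ltW (le_lt_trans t10 t12)) r0.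
rewrite /weight !powRN ltf_pV2 ?posrE ?powR_gt0//.
by rewrite gt0_ltr_powR ?invr_gt0// ?nnegrE ?ltrD2l// ltW.
Qed.

Lemma lt_mass_int t1 t2 : admissible p t1 -> t1 < t2 -> m t2 < m t1.
Proof.
move=> a1 t12; have t10 := admissible_ge0 a1.
apply: lt_Rintegral01; [|exact: integrable_weight_neg|].
  by apply: integrable_weight_neg => //; left; exact: le_lt_trans t12.
by move=> r /andP[r0 _]; exact: lt_weight_neg.
Qed.

Lemma mass_int_lt t : 0 < t -> m t < t `^ (- 2^-1).
Proof.
move=> t0; rewrite -[X in _ < X]Rintegral01_cst.
apply: lt_Rintegral01; [|exact: integrable01_cst|].
  by apply: integrable_weight_neg => //; left.
move=> r /andP[r0 _]; rewrite /weight !powRN.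
have X1 := weight_arg_gt0 p2 (ltW t0) r0.
rewrite ltf_pV2 ?posrE ?powR_gt0//.
rewrite gt0_ltr_powR ?invr_gt0// ?nnegrE ?(ltW t0) ?(ltW X1)//.
by rewrite ltrDr mulr_gt0// powR_gt0.
Qed.

Lemma mass_int_gt0 t : admissible p t -> 0 < m t.
Proof.
move=> a; have t0 := admissible_ge0 a.
rewrite -[X in X < _](Rintegral01_cst 0).
apply: lt_Rintegral01; [exact: integrable01_cst|exact: integrable_weight_neg|].
by move=> r /andP[r0 _]; rewrite powR_gt0//; exact: weight_arg_gt0.
Qed.

Lemma slope_int_ge_sqrt t : 0 <= t -> t `^ 2^-1 <= G t.
Proof.
move=> t0; rewrite -[X in X <= _]Rintegral01_cst.
apply: le_Rintegral01; [exact: integrable01_cst|exact: integrable_weight_half|].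
move=> r /andP[r0 _]; have X := weight_arg_gt0 p2 t0 r0.
rewrite /weight; apply: ge0_ler_powR; rewrite ?nnegrE ?invr_ge0 ?(ltW X)//.
by rewrite lerDr mulr_ge0 ?powR_ge0// ltW.
Qed.

Lemma slope_int_le t : 0 <= t -> G t <= (c + t) `^ 2^-1.
Proof.
move=> t0; rewrite -[X in _ <= X]Rintegral01_cst.
apply: le_Rintegral01; [exact: integrable_weight_half|exact: integrable01_cst|].
move=> r /andP[r0 r1]; have X := weight_arg_gt0 p2 t0 r0.
rewrite /weight; apply: ge0_ler_powR; rewrite ?nnegrE ?invr_ge0 ?(ltW X) ?addr_ge0 ?(ltW c0)//.
rewrite lerD2r -[leRHS]mulr1 ler_pM2l//.
have := @ge0_ler_powR R k (ltW k0) r 1; rewrite powR1; apply; rewrite ?nnegrE ?ltW//.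
Qed.

Lemma slope_int_nondec t : 0 <= t -> G 0 <= G t.
Proof.
move=> t0; apply: le_Rintegral01; [exact: integrable_weight_half..|].
move=> r /andP[r0 r1]; have X := weight_arg_gt0 p2 t0 r0.
have X0 := weight_arg_gt0 p2 (lexx 0) r0.
rewrite /weight; apply: ge0_ler_powR; rewrite ?nnegrE ?invr_ge0 ?(ltW X) ?(ltW X0)//.
by rewrite lerD2l.
Qed.

Lemma slope_int_gt0 t : 0 <= t -> 0 < G t.
Proof.
move=> t0; rewrite -[X in X < _](Rintegral01_cst 0).
apply: lt_Rintegral01; [exact: integrable01_cst|exact: integrable_weight_half|].
by move=> r /andP[r0 _]; rewrite powR_gt0//; exact: weight_arg_gt0.
Qed.

Lemma weight_sqr t r : 0 <= t -> 0 < r ->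
  weight p t 2^-1 r ^+ 2 = c * r `^ k + t.
Proof.
move=> t0 r0; have X := weight_arg_gt0 p2 t0 r0.
by rewrite /weight -powR_mulrn ?powR_ge0// -powRrM mulVf// powRr1// ltW.
Qed.

(** The Cauchy-Schwarz inequality for a function and its inverse, obtained by integrating the
    pointwise bound v >= 2 G - G^2 / v, where [v] is the weight of exponent 1/2 and [G] its
    integral. *)
Lemma mul_mass_slope_ge1 t : admissible p t -> 1 <= m t * G t.
Proof.
move=> a; have t0 := admissible_ge0 a.
have G0 := slope_int_gt0 t0.
have im := integrable_weight_neg 1 p2 a; have iG := integrable_weight_half 1 p2 t0.
have : 2 * G t - G t ^+ 2 * m t <= G t.
  have -> : 2 * G t - G t ^+ 2 * m t =
      \int[mu]_(r in `[0, 1]) (2 * G t - G t ^+ 2 * weight p t (- 2^-1) r).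
    rewrite RintegralB//; [|exact: integrable01_cst|exact: itgZ].
    by rewrite Rintegral01_cst RintegralZl.
  apply: le_Rintegral01 => //; first by apply: itgB => //; [exact: integrable01_cst|exact: itgZ].
  move=> r /andP[r0 _].
  have h := weight_inv p2 t0 r0.
  have a0 : 0 < weight p t (- 2^-1) r by rewrite powR_gt0//; exact: weight_arg_gt0.
  move: h a0; move: (weight p t (- 2^-1) r) (weight p t 2^-1 r) => u v uv u0.
  have -> : v = u^-1 by apply: (mulfI (lt0r_neq0 u0)); rewrite uv divff ?lt0r_neq0.
  rewrite -subr_ge0.
  have -> : u^-1 - (2 * G t - G t ^+ 2 * u) = u^-1 * (1 - G t * u) ^+ 2.
    by field; rewrite gt_eqF.
  by rewrite mulr_ge0 ?sqr_ge0// invr_ge0 ltW.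
rewrite expr2; move: (m t) (G t) G0 => M g g0; nra.
Qed.

Lemma mul_mass_le_slope t : admissible p t -> t * m t <= G t.
Proof.
move=> a; have t0 := admissible_ge0 a.
rewrite -RintegralZl//; last exact: integrable_weight_neg.
apply: le_Rintegral01; [by apply: itgZ => //; exact: integrable_weight_neg|exact: integrable_weight_half|].
move=> r /andP[r0 _]; have h := weight_inv p2 t0 r0.
have hs := weight_sqr t0 r0.
have a0 : 0 < weight p t (- 2^-1) r by rewrite powR_gt0//; exact: weight_arg_gt0.
have : t <= weight p t 2^-1 r ^+ 2 by rewrite hs lerDr mulr_ge0 ?powR_ge0// ltW.
move: h a0; move: (weight p t (- 2^-1) r) (weight p t 2^-1 r) => u v uv u0 tv.
rewrite (@le_trans _ _ (v ^+ 2 * u))//; first by rewrite ler_wpM2r// ltW.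
by rewrite expr2 -mulrA [v * u]mulrC uv mulr1.
Qed.

(** The left side is the integral of the derivative of [r * weight p t 2^-1 r], the right side its
    value at 1. In the stationarity argument it eliminates [slope_int]. *)
Lemma mass_slope_by_parts t : 0 < t ->
  (1 + k / 2) * G t - k / 2 * t * m t = (c + t) `^ 2^-1.
Proof.
move=> t0.
have iG := integrable_weight_half 1 p2 (ltW t0).
have im : mu.-integrable `[0, 1] (EFin \o weight p t (- 2^-1)).
  by apply: integrable_weight_neg => //; left.
rewrite -!RintegralZl// -RintegralB//; [|exact: itgZ|exact: itgZ].
pose F r := r * weight p t 2^-1 r.
have X0 r : 0 <= r -> 0 < c * r `^ k + t.
  by move=> r0; rewrite ltr_wpDl// mulr_ge0 ?powR_ge0// ltW.
have cw e : {within `[0, 1], continuous (weight p t e)}.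
  apply/continuous_within_itvP => //.
  have c1 r : 0 < r -> {for r, continuous (weight p t e)}.
    by move=> r0; apply: continuous_weight => //; exact: ltW.
  split.
  - by move=> r; rewrite in_itv/= => /andP[r0 _]; exact: c1.
  - have : (c * r `^ k + t) @[r --> 0^'+] --> c * 0 `^ k + t.
      apply: cvgD; last exact: cvg_cst.
      apply: cvgM; first exact: cvg_cst.
      by rewrite powR0 ?gt_eqF//; exact: powR_cvg0.
    move=> h; apply: (@cvg_comp _ _ _ _ (fun y => y `^ e) _ _ _ h).
    by apply: continuous_powR_gt0; exact: X0.
  - by apply: cvg_at_left_filter; exact: c1.
have [_ cw0 cw1] := (continuous_within_itvP _ ltr01).1 (cw 2^-1).
have dF r : 0 < r -> is_derive r 1 F
    ((1 + k / 2) * weight p t 2^-1 r - k / 2 * t * weight p t (- 2^-1) r).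
  move=> r0; have X := X0 r (ltW r0).
  have dX : is_derive r 1 (fun r => c * r `^ k + t) (c * (k * r `^ (k - 1))).
    have d := is_derive1_powR k r0.
    by apply: is_derive_eq; rewrite /GRing.scale/=; ring.
  have dW := @is_derive1_comp _ (fun y => y `^ 2^-1) (fun r => c * r `^ k + t) r _ _ (is_derive1_powR 2^-1 X) dX.
  rewrite /F; apply: is_derive_eq; rewrite /GRing.scale/= mulr1 /weight.
  have -> : 2^-1 - 1 = - 2^-1 :> R by field.
  have e1 : (c * r `^ k + t) `^ 2^-1 = (c * r `^ k + t) * (c * r `^ k + t) `^ (- 2^-1).
    rewrite -[X in _ = X * _]powRr1 ?(ltW X)// -powRD ?(gt_eqF X) ?implybT//.
    by congr (_ `^ _); field.
  have e2 : r `^ k = r * r `^ (k - 1) by rewrite mulr_powRB1// ltW.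
  rewrite e1; move: ((c * r `^ k + t) `^ (- 2^-1)) => a.
  rewrite e2; move: (r `^ (k - 1)) => b.
  by field; rewrite gt_eqF.
rewrite /Rintegral (@continuous_FTC2 _ _ F 0 1)//.
- by rewrite /F mul0r mul1r sube0/= /weight powR1 mulr1.
- move=> r; apply: cvgB; apply: cvgM; [exact: cvg_cst|exact: cw|exact: cvg_cst|exact: cw].
- split.
  + by move=> r; rewrite in_itv/= => /andP[r0 _]; have [] := dF r r0.
  + apply: cvgM; last exact: cw0.
    by apply: cvg_at_right_filter; exact: cvg_id.
  + apply: cvgM; last exact: cw1.
    by apply: cvg_at_left_filter; exact: cvg_id.
- move=> r; rewrite in_itv/= => /andP[r0 _]; rewrite derive1E.
  by have h := dF r r0; exact: derive_val.
Qed.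


(** The inequality is pointwise: as r^k < 1 on ]0, 1[, the quotient (c + t) / (c r^k + t) is
    strictly decreasing in [t]. *)
Lemma lt_sqrt_mul_mass_int t1 t2 : admissible p t1 -> t1 < t2 ->
  (c + t2) `^ 2^-1 * m t2 < (c + t1) `^ 2^-1 * m t1.
Proof.
move=> a1 t12; have t10 := admissible_ge0 a1.
have t20 := le_lt_trans t10 t12.
have a2 : admissible p t2 by left.
rewrite -!RintegralZl//; [|exact: integrable_weight_neg..].
apply: lt_Rintegral01; [by apply: itgZ => //; exact: integrable_weight_neg..|].
move=> r /andP[r0 r1].
have X1 := weight_arg_gt0 p2 t10 r0; have X2 := weight_arg_gt0 p2 (ltW t20) r0.
have c1 : 0 < c + t1 by rewrite ltr_wpDr.
have c2 : 0 < c + t2 by rewrite ltr_wpDr// ltW.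
rewrite /weight !powRN ltr_pdivrMr ?powR_gt0// mulrAC ltr_pdivlMr ?powR_gt0//.
rewrite -!powRM ?ltW// gt0_ltr_powR ?invr_gt0// ?nnegrE ?ltW ?mulr_gt0//.
have rk : r `^ k < 1.
  have := @gt0_ltr_powR R k k0 r 1; rewrite powR1; apply; rewrite ?nnegrE ?ltW//.
move: (r `^ k) rk => y y1.
rewrite -subr_gt0.
have -> : (c + t1) * (c * y + t2) - (c + t2) * (c * y + t1) = c * ((1 - y) * (t2 - t1)) by ring.
by rewrite mulr_gt0// mulr_gt0 ?subr_gt0.
Qed.

Let continuous_weight_param a e r : 0 < r -> 0 <= a ->
  continuous (fun t => weight p (Num.max a t) e r).
Proof.
move=> r0 a0 t.
have X : 0 < c * r `^ k + Num.max a t.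
  by apply: weight_arg_gt0 => //; rewrite le_max a0.
apply: (@continuous_comp _ _ _ (fun t => c * r `^ k + Num.max a t) (fun y => y `^ e)).
  apply: cvgD; first exact: cvg_cst.
  by apply: (@continuous_max _ _ (cst a) id); [exact: cvg_cst|exact: cvg_id].
exact: continuous_powR_gt0.
Qed.

Let ae_positive01 (P : R -> Prop) : (forall r, 0 < r -> P r) ->
  \forall r \ae mu, `[0, 1]%classic r -> P r.
Proof.
move=> H; exists [set 0]; split; [exact: measurable_set1|exact: lebesgue_measure_set1|].
move=> r /= /not_implyP[]; rewrite in_itv/= => /andP[r0 _] nP.
by apply: contrapT => /eqP r1; apply: nP; apply: H; rewrite lt_neqAle eq_sym r1.
Qed.

(** Composing with [Num.max a] expresses continuity on [a, +oo[ by a function on the whole line. The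
    weight at [a] dominates all the others, since they decrease in [t]. *)
Lemma continuous_mass_int a : admissible p a -> continuous (fun t => m (Num.max a t)).
Proof.
move=> adm t; have a0 := admissible_ge0 adm.
have admx x : admissible p (Num.max a x).
  have [_|h] := leP x a; first exact: adm.
  by left; exact: le_lt_trans h.
have := @continuity_under_integral R _ _ mu (fun t r => weight p (Num.max a t) (- 2^-1) r)
  `[0, 1]%classic (measurable_itv _) (t - 1) (t + 1) _ _ (weight p a (- 2^-1)) _ _ t.
apply.
- by move=> x _; exact: integrable_weight_neg.
- by apply: ae_positive01 => r r0 x _; exact: continuous_weight_param.
- exact: integrable_weight_neg.
- move=> x _; apply: ae_positive01 => r r0.
  rewrite ger0_norm ?weight_ge0//; have [//|h] := leP x a.
  by apply: ltW; exact: lt_weight_neg.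
- by rewrite inE/= in_itv/=; lra.
Qed.

Lemma continuous_slope_int a : 0 <= a -> continuous (fun t => G (Num.max a t)).
Proof.
move=> a0 t.
have mx0 x : 0 <= Num.max a x by rewrite le_max a0.
have := @continuity_under_integral R _ _ mu (fun t r => weight p (Num.max a t) 2^-1 r)
  `[0, 1]%classic (measurable_itv _) (t - 1) (t + 1) _ _ (weight p (Num.max a (t + 1)) 2^-1) _ _ t.
apply.
- by move=> x _; exact: integrable_weight_half.
- by apply: ae_positive01 => r r0 x _; exact: continuous_weight_param.
- exact: integrable_weight_half.
- move=> x; rewrite /= in_itv/= => /andP[_ xt]; apply: ae_positive01 => r r0.
  rewrite ger0_norm ?weight_ge0// /weight ge0_ler_powR ?invr_ge0// ?nnegrE.
  + by apply: ltW; exact: weight_arg_gt0.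
  + by apply: ltW; exact: weight_arg_gt0.
  + by rewrite lerD2l ge_max !le_max lexx (ltW xt) orbT.
- by rewrite inE/= in_itv/=; lra.
Qed.

(** For [p > 6] the exponent p/2 - 1 exceeds 2, so with [t = b^2] the weight is at least 1 / (a r +
    b), whose integral is logarithmic in 1/b. *)
Lemma mass_int_unbounded M : 6 < p -> exists2 t, 0 < t & M < m t.
Proof.
move=> p6.
pose a := Num.sqrt c; have a0 : 0 < a by rewrite sqrtr_gt0.
(* Solves ln((a + b) / b) / a = |M| + 1. *)
pose b := a / (expR (a * (`|M| + 1)) - 1).
have e1 : 1 < expR (a * (`|M| + 1)) by rewrite expR_gt1 mulr_gt0// ltr_wpDl.
have b0 : 0 < b by rewrite divr_gt0// subr_gt0.
exists (b ^+ 2); first by rewrite exprn_gt0.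
have adm : admissible p (b ^+ 2) by left; rewrite exprn_gt0.
pose F r := a^-1 * ln (a * r + b).
have dF r : 0 <= r -> is_derive r 1 F ((a * r + b)^-1).
  move=> r0; have X : 0 < a * r + b by rewrite ltr_wpDl// mulr_ge0// ltW.
  have dX : is_derive r 1 (fun r => a * r + b) a.
    by apply: is_derive_eq; rewrite /GRing.scale/=; ring.
  have dL := @is_derive1_comp _ (@ln R) (fun r => a * r + b) r _ _ (is_derive1_ln X) dX.
  have := is_deriveZ a^-1 dL; congr is_derive; rewrite /GRing.scale/=.
  by field; rewrite !gt_eqF.
have cF r : 0 <= r -> {for r, continuous F}.
  move=> r0; apply/differentiable_continuous/derivable1_diffP.
  by have [] := dF r r0.
have cg : {within `[0, 1], continuous (fun r => (a * r + b)^-1)}.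
  apply: continuous_in_subspaceT => r; rewrite inE/= in_itv/= => /andP[r0 _].
  have X : 0 < a * r + b by rewrite ltr_wpDl// mulr_ge0// ltW.
  apply: cvgV; first by rewrite gt_eqF.
  apply: cvgD; last exact: cvg_cst.
  by apply: cvgM; [exact: cvg_cst|exact: cvg_id].
have ig : mu.-integrable `[0, 1] (EFin \o (fun r => (a * r + b)^-1)).
  by apply: continuous_compact_integrable => //; exact: segment_compact.
have I : \int[mu]_(r in `[0, 1]) (a * r + b)^-1 = `|M| + 1.
  rewrite /Rintegral (@continuous_FTC2 _ _ F 0 1)//.
  - rewrite -EFinB /= /F mulr0 add0r mulr1 -mulrBr -ln_div ?posrE ?addr_gt0//.
    have -> : (a + b) / b = expR (a * (`|M| + 1)).
      rewrite /b; field; rewrite !gt_eqF ?subr_gt0//.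
    by rewrite expRK mulrA mulVf ?gt_eqF// mul1r.
  - split.
    + by move=> r; rewrite in_itv/= => /andP[/ltW r0 _]; have [] := dF r r0.
    + by apply: cvg_at_right_filter; exact: cF.
    + by apply: cvg_at_left_filter; exact: cF.
  - move=> r; rewrite in_itv/= => /andP[/ltW r0 _]; rewrite derive1E.
    by have h := dF r r0; exact: derive_val.
apply: (@lt_le_trans _ _ (`|M| + 1)).
  by rewrite (le_lt_trans (ler_norm M))// ltrDl.
rewrite -I; apply: le_Rintegral01 => //; first exact: integrable_weight_neg.
move=> r /andP[r0 r1].
have X := weight_arg_gt0 p2 (sqr_ge0 b) r0.
have Y : 0 < a * r + b by rewrite ltr_wpDl// mulr_ge0// ltW.
rewrite /weight powRN lef_pV2 ?posrE ?powR_gt0//.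
rewrite powR12_sqrt ?(ltW X)//.
rewrite -[X in _ <= X](ger0_norm (ltW Y)) -sqrtr_sqr; apply: ler_wsqrtr.
have rk : r `^ k <= r ^+ 2.
  rewrite -(powR_mulrn 2 (ltW r0)); apply: ger_powR; first by rewrite r0 ltW.
  lra.
have a2 : a ^+ 2 = c by rewrite sqr_sqrtr// ltW.
have cr : c * r `^ k <= c * r ^+ 2 by rewrite ler_pM2l.
have -> : (a * r + b) ^+ 2 = c * r ^+ 2 + (a * r * b *+ 2 + b ^+ 2).
  by clear -a2; clearbody b; clearbody a; rewrite -a2; ring.
apply: lerD => //.
by rewrite lerDr; apply/mulrn_wge0/ltW/mulr_gt0 => //; exact: mulr_gt0.
Qed.

End fixp.
End MassFacts.

(** * The reduced energy *)

Section Powers.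
Context {R : realType}.
Implicit Types (x y e : R).

Lemma lt_powR_neg x y e : e < 0 -> 0 < x -> x < y -> y `^ e < x `^ e.
Proof.
move=> e0 x0 xy; have y0 := lt_trans x0 xy.
rewrite -(opprK e) 2!(powRN _ (- e)) ltf_pV2 ?posrE ?powR_gt0//.
by rewrite gt0_ltr_powR ?oppr_gt0// nnegrE ltW.
Qed.

Lemma powR_lt1 x e : 0 < e -> 0 <= x -> (x `^ e < 1) = (x < 1).
Proof.
move=> e0 x0; rewrite -[X in _ < X](congr1 (@^~ e) (@powR1 R)).
case: (ltP x 1) => h; first by rewrite gt0_ltr_powR ?nnegrE.
by apply/negbTE; rewrite -leNgt ge0_ler_powR ?nnegrE// ltW.
Qed.

Lemma powR_le1 x e : 0 < e -> 0 <= x -> (x `^ e <= 1) = (x <= 1).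
Proof.
move=> e0 x0; have E := congr1 (@^~ e) (@powR1 R); rewrite /= in E.
rewrite -[X in _ <= X]E.
case: (leP x 1) => h; first by rewrite ge0_ler_powR ?nnegrE// ltW.
by apply/negbTE; rewrite -ltNge gt0_ltr_powR ?nnegrE.
Qed.

Lemma powRK x e : e != 0 -> 0 <= x -> (x `^ e) `^ e^-1 = x.
Proof. by move=> e0 x0; rewrite -powRrM mulfV// powRr1. Qed.

Lemma powRVK x e : e != 0 -> 0 <= x -> (x `^ e^-1) `^ e = x.
Proof. by move=> e0 x0; rewrite -powRrM mulVf// powRr1. Qed.

Lemma continuous_powR (f : R -> R) e x : 0 < f x -> {for x, continuous f} ->
  {for x, continuous (fun y => f y `^ e)}.
Proof.
move=> fx cf; apply: (@continuous_comp _ _ _ f (fun y => y `^ e)) => //.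
exact: continuous_powR_gt0.
Qed.

Lemma lt_mulr_sub1 (c x y u v : R) : 0 < c -> 0 < x -> x < y -> v < u -> u <= 1 ->
  c * y * (v - 1) < c * x * (u - 1).
Proof.
move=> c0 x0 xy vu u1; rewrite -!mulrA ltr_pM2l//.
have y0 := lt_trans x0 xy.
apply: (@lt_le_trans _ _ (y * (u - 1))); first by rewrite ltr_pM2l// ltrD2r.
by rewrite ler_wnM2r ?subr_le0// ltW.
Qed.

(** With x = M (c + t)^(1/2), the left side is at most 4 x - 2 x^2 + 2 c M^2 = 2 - 2 (x - 1)^2 + 2 c
    M^2, which is less than 2 + 2 c / t because M^2 t < 1. *)
Lemma mass_energy_arith (M G t c m x : R) : 0 < t -> 0 < c -> 4 * c < t * (m - 2) ->
  M * M * t < 1 -> M * G <= x -> 1 <= x -> x * x = M * M * (c + t) ->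
  M * (4 * (G - t * M / 2)) < m.
Proof.
move=> t0 c0 tm My MG x1 xE; rewrite -(ltr_pM2l t0).
have x2 : 1 <= x * x by rewrite -[leLHS]mulr1 ler_pM// ler01.
have h1 : t * (x * x) < t + c.
  by rewrite xE mulrCA mulrA (addrC t) -[X in _ < X]mul1r ltr_pM2r ?addr_gt0.
have h2 : 0 <= t * (x - 1) ^+ 2 by rewrite mulr_ge0 ?sqr_ge0 ?(ltW t0).
have h3 : t <= t * (x * x) by rewrite -[leLHS]mulr1 ler_pM2l.
have h4 : c * (M * M * t) < c by rewrite -[X in _ < X]mulr1 ltr_pM2l.
have h5 : t * (M * G) <= t * x by rewrite ler_pM2l.
rewrite xE in h3; nra.
Qed.

End Powers.

Section Reduced.
Context {R : realType}.
Implicit Types (p q t m A b d v : R).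

Definition energy_int p t := slope_int p t - t * mass_int p t / 2.
Definition mass_exponent p q := (q - (p / 2 + 1)) / (3 - p / 2).
(* The height at which the rescaled profile [scaled_profile p t] has mass [m]; its
   energy is then [reduced_energy p q t m], negative iff [threshold p q t < m]. *)
Definition amplitude p t m := (m / mass_int p t) `^ (3 - p / 2)^-1.
Definition reduced_energy p q t m :=
  amplitude p t m `^ (p / 2 + 1) * energy_int p t - q^-1 * amplitude p t m `^ q.
Definition threshold p q t :=
  mass_int p t * (q * energy_int p t) `^ (mass_exponent p q)^-1.

Definition exponents p q :=
  (2 < p < 6 /\ p / 2 + 1 < q < 4) \/ (6 < p /\ 4 <= q < p / 2 + 1).

Variables (p q : R) (hpq : exponents p q).
Notation M := (mass_int p).
Notation G := (slope_int p).
Notation K := (energy_int p).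
Notation a := (amplitude p).
Notation sg := (mass_exponent p q).
Notation F := (reduced_energy p q).
Notation N := (threshold p q).
Notation adm := (admissible p).

Let p2 : 2 < p.
Proof. by case: hpq => [[/andP[]]|[p6 _]]; lra. Qed.

Let q2 : 2 < q.
Proof. by case: hpq => -[p6 /andP[q1 q3]]; move: p2 => ?; lra. Qed.

Let q0 : 0 < q. Proof. by apply: lt_trans q2. Qed.
Let p0 : 0 < p. Proof. by apply: lt_trans p2. Qed.

Let dn0 : 3 - p / 2 != 0.
Proof.
by case: hpq => [[/andP[_ p6] _]|[p6 _]]; [apply: lt0r_neq0|apply: ltr0_neq0]; lra.
Qed.

Lemma mass_exponent_gt0 : 0 < sg.
Proof.
case: hpq => [[/andP[_ p6] /andP[qp _]]|[p6 /andP[_ qp]]].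
  by apply: divr_gt0; lra.
by rewrite -[sg]mulrNN -invrN; apply: divr_gt0; lra.
Qed.

Let sg0 := mass_exponent_gt0.

Lemma mass_exponent_lt1 : q != 4 -> sg < 1.
Proof.
move=> /eqP q4; case: hpq => [[/andP[_ p6] /andP[_ q4']]|[p6 /andP[q4' _]]].
  by rewrite ltr_pdivrMr; lra.
have : 4 < q by rewrite lt_neqAle q4' andbT eq_sym; apply/eqP.
by move=> ?; rewrite ltr_ndivrMr; lra.
Qed.

Lemma mass_exponent_eq1 : q = 4 -> sg = 1.
Proof.
by move=> q4; rewrite /mass_exponent q4 (_ : 4 - _ = 3 - p / 2) ?divff//; lra.
Qed.

Lemma slope_int0_gt0 : 0 < G 0.
Proof. exact: slope_int_gt0. Qed.

(** A bound away from 0 that is uniform in [t]: [t * M t <= G t] costs at most half of [G t], and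
    [G] is smallest at 0. *)
Lemma energy_int_ge t : adm t -> G 0 / 2 <= K t.
Proof.
move=> at_; have t0 := admissible_ge0 at_.
have := mul_mass_le_slope p2 at_; have := slope_int_nondec p2 t0.
rewrite /energy_int; move: (M t) (G t) (G 0) => x y z; lra.
Qed.

Lemma energy_int_gt0 t : adm t -> 0 < K t.
Proof.
by move=> /energy_int_ge; apply: lt_le_trans; rewrite divr_gt0// slope_int0_gt0.
Qed.

Lemma mul_mass_energy_ge t : adm t -> 2^-1 <= M t * K t.
Proof.
move=> at_; have := mul_mass_slope_ge1 p2 at_; have M0 := mass_int_gt0 p2 at_.
have : t * M t * M t <= G t * M t by rewrite ler_pM2r// mul_mass_le_slope.
rewrite /energy_int; move: (M t) (G t) => x y; lra.
Qed.

Lemma threshold_gt0 t : adm t -> 0 < N t.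
Proof.
move=> at_; rewrite mulr_gt0 ?powR_gt0 ?mulr_gt0//.
  exact: mass_int_gt0.
exact: energy_int_gt0.
Qed.

Lemma amplitude_gt0 t m : adm t -> 0 < m -> 0 < a t m.
Proof. by move=> at_ m0; rewrite powR_gt0 ?divr_gt0 ?mass_int_gt0. Qed.

Lemma amplitude_mass t m : adm t -> 0 < m -> a t m `^ (3 - p / 2) * M t = m.
Proof.
move=> at_ m0; have M0 := mass_int_gt0 p2 at_.
by rewrite /amplitude powRVK ?divr_ge0 ?ltW// divfK// gt_eqF.
Qed.

Lemma amplitude_unique t A : adm t -> 0 < A -> a t (A `^ (3 - p / 2) * M t) = A.
Proof.
move=> at_ A0; have M0 := mass_int_gt0 p2 at_.
by rewrite /amplitude mulfK ?gt_eqF// powRK ?ltW.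
Qed.

Let reduced_coef_gt0 t m : adm t -> 0 < m -> 0 < q^-1 * a t m `^ q.
Proof.
move=> at_ m0; apply: mulr_gt0; first by rewrite invr_gt0.
by apply/powR_gt0/amplitude_gt0.
Qed.

(** After [A^q / q] is factored out, [A^(p/2+1-q) q K] remains. Its first factor is (M/m)^s because
    [A^(3-p/2) = m/M]. *)
Lemma reduced_energyE t m : adm t -> 0 < m ->
  F t m = q^-1 * a t m `^ q * ((N t / m) `^ sg - 1).
Proof.
move=> at_ m0; have M0 := mass_int_gt0 p2 at_; have K0 := energy_int_gt0 at_.
have A0 := amplitude_gt0 at_ m0.
have -> : (N t / m) `^ sg = a t m `^ (p / 2 + 1 - q) * (q * K t).
  rewrite /threshold mulrAC (powRM _ (ltW (divr_gt0 M0 m0)) (powR_ge0 _ _)).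
  rewrite powRVK ?gt_eqF//; last by apply/ltW/mulr_gt0.
  congr (_ * _).
  have -> : M t / m = (m / M t) `^ (-1).
    by rewrite (powR_inv1 (ltW (divr_gt0 m0 M0))) invf_div.
  rewrite /amplitude -2!powRrM.
  congr (_ `^ _).
  by rewrite /mass_exponent mulN1r -mulNr opprB mulrC.
have -> : a t m `^ (p / 2 + 1 - q) = a t m `^ (p / 2 + 1) / a t m `^ q.
  by rewrite powRB// (gt_eqF A0) implybT.
rewrite /reduced_energy; field.
by rewrite (gt_eqF (powR_gt0 q A0)) (gt_eqF q0).
Qed.

Lemma reduced_energy_lt0 t m : adm t -> 0 < m -> (F t m < 0) = (N t < m).
Proof.
move=> at_ m0; have N0 := threshold_gt0 at_.
rewrite reduced_energyE// pmulr_rlt0; last first.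
  exact: reduced_coef_gt0.
by rewrite subr_lt0 powR_lt1 ?divr_ge0 ?ltW// ltr_pdivrMr// mul1r.
Qed.

Lemma reduced_energy_le0 t m : adm t -> 0 < m -> (F t m <= 0) = (N t <= m).
Proof.
move=> at_ m0; have N0 := threshold_gt0 at_.
rewrite reduced_energyE// pmulr_rle0; last first.
  exact: reduced_coef_gt0.
by rewrite subr_le0 powR_le1 ?ler_pdivrMr ?mul1r//; exact/ltW/divr_gt0.
Qed.

(** In the factorised form both factors help: for [p < 6] the amplitude grows with the mass, and it
    multiplies a nonpositive quantity that decreases. *)
Lemma lt_reduced_energy t m1 m2 : p < 6 -> adm t -> 0 < m1 -> N t <= m1 -> m1 < m2 ->
  F t m2 < F t m1.
Proof.
move=> p6 at_ m10 Nm m12; have m20 := lt_trans m10 m12.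
have N0 := threshold_gt0 at_; have M0 := mass_int_gt0 p2 at_.
have e0 : 0 < (3 - p / 2)^-1 by rewrite invr_gt0; lra.
have a12 : a t m1 `^ q < a t m2 `^ q.
  rewrite gt0_ltr_powR ?nnegrE ?powR_ge0// gt0_ltr_powR ?nnegrE ?divr_ge0 ?ltW//.
  by rewrite ltr_pM2r// invr_gt0.
have n12 : (N t / m2) `^ sg < (N t / m1) `^ sg.
  rewrite gt0_ltr_powR ?nnegrE ?divr_ge0 ?ltW//.
  by rewrite ltr_pM2l// ltf_pV2.
have n1 : (N t / m1) `^ sg <= 1.
  by rewrite powR_le1 ?ler_pdivrMr ?mul1r//; exact/ltW/divr_gt0.
have a1 : 0 < a t m1 `^ q by rewrite powR_gt0 ?amplitude_gt0.
rewrite (reduced_energyE at_ m20) (reduced_energyE at_ m10).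
have qV : 0 < q^-1 by rewrite invr_gt0.
exact: (lt_mulr_sub1 qV a1 a12 n12 n1).
Qed.

Lemma admissible_le b t : adm b -> b <= t -> adm t.
Proof.
case=> [b0 bt|[-> p6]]; first by left; exact: lt_le_trans bt.
by rewrite le_eqVlt => /predU1P[<-|]; [right|left].
Qed.

Lemma admissible_max b t : adm b -> adm (Num.max b t).
Proof. by move=> /admissible_le; apply; rewrite le_max lexx. Qed.

Lemma continuous_energy_int b : adm b -> continuous (fun t => K (Num.max b t)).
Proof.
move=> ab t; apply: cvgB; first exact/continuous_slope_int/(admissible_ge0 ab).
apply: cvgM; last exact: cvg_cst.
apply: cvgM; last exact: continuous_mass_int.
by apply: continuous_max; [exact: cvg_cst|exact: cvg_id].
Qed.

Lemma continuous_threshold b : adm b -> continuous (fun t => N (Num.max b t)).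
Proof.
move=> ab t; apply: cvgM; first exact: continuous_mass_int.
apply: (@continuous_powR _ (fun t => q * K (Num.max b t))).
  by apply: mulr_gt0 => //; exact/energy_int_gt0/admissible_max.
by apply: cvgM; [exact: cvg_cst|exact: continuous_energy_int].
Qed.

Lemma continuous_amplitude m b : 0 < m -> adm b ->
  continuous (fun t => a (Num.max b t) m).
Proof.
move=> m0 ab t; have M0 := mass_int_gt0 p2 (admissible_max t ab).
apply: (@continuous_powR _ (fun t => m / M (Num.max b t))); first exact: divr_gt0.
apply: cvgM; first exact: cvg_cst.
by apply: cvgV; [exact: lt0r_neq0|exact: continuous_mass_int].
Qed.

Lemma continuous_reduced_energy m b : 0 < m -> adm b ->
  continuous (fun t => F (Num.max b t) m).
Proof.
move=> m0 ab t; have A0 := amplitude_gt0 (admissible_max t ab) m0.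
have cP e : {for t, continuous (fun t => a (Num.max b t) m `^ e)}.
  by apply: (@continuous_powR _ (fun t => a (Num.max b t) m)) => //; exact: continuous_amplitude.
apply: cvgB; first by apply: cvgM; [exact: cP|exact: continuous_energy_int].
by apply: cvgM; [exact: cvg_cst|exact: cP].
Qed.

Lemma mass_int_lt_of_sqr d t : 0 < d -> d ^- 2 <= t -> M t < d.
Proof.
move=> d0 dt; have d2 : 0 < d ^- 2 by rewrite invr_gt0 exprn_gt0.
have t0 := lt_le_trans d2 dt.
apply: (lt_le_trans (mass_int_lt p2 t0)).
have -> : d = (d ^- 2) `^ (- 2^-1).
  rewrite -powR_invn ?(ltW d0)// -powRrM.
  by rewrite (_ : - 2%:R * - 2^-1 = 1) ?powRr1 ?(ltW d0)//; field.
move: dt; rewrite le_eqVlt => /predU1P[<-//|dt].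
by apply/ltW/lt_powR_neg => //; rewrite oppr_lt0.
Qed.

Lemma exists_mass_int b v : adm b -> 0 < v -> v <= M b -> exists2 t, adm t & M t = v.
Proof.
move=> ab v0 vb; have b0 := admissible_ge0 ab.
have v2 : 0 < v ^- 2 by rewrite invr_gt0 exprn_gt0.
(* Since [M t] lies below t^(-1/2), it is smaller than [v] at [T]. *)
set T := b + v ^- 2.
have bT : b <= T by rewrite lerDl ltW.
have MT : M T < v by apply: mass_int_lt_of_sqr => //; rewrite lerDr.
have [|||c] := @IVT _ (fun t => M (Num.max b t)) b T v.
- exact: bT.
- exact/continuous_subspaceT/continuous_mass_int.
- rewrite (max_l (lexx b)) (max_r bT).
  have TB : M T <= M b by exact: ltW (lt_le_trans MT vb).
  by rewrite (min_r TB) (max_l TB) vb (ltW MT).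
by move=> _ <-; exists (Num.max b c) => //; exact: admissible_max.
Qed.

(** Bounds on [M] confine a sublevel set of [f] to a compact interval of [t]. As [M t] is below
    t^(-1/2), the lower bound [d] bounds [t] from above; the upper bound [D] keeps [t] away from 0
    if [p > 6], where [M] is unbounded, whereas for [p < 6] the value 0 is itself admissible. *)
Lemma exists_min (f : R -> R) t1 d D :
  (forall b, adm b -> continuous (fun t => f (Num.max b t))) ->
  adm t1 -> 0 < d -> (forall t, adm t -> f t <= f t1 -> d <= M t <= D) ->
  exists2 t0, adm t0 & forall t, adm t -> f t0 <= f t.
Proof.
move=> cf at1 d0 H.
have [b ab bP] : exists2 b, adm b & forall t, adm t -> M t <= D -> b <= t.
  have [p6|p6] : p < 6 \/ 6 < p.
    by case: hpq => [[/andP[_ ?] _]|[? _]]; [left|right].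
    by exists 0; [right|move=> t /admissible_ge0].
  have [b b0 bD] := mass_int_unbounded p2 D p6.
  exists b; first by left.
  move=> t at_ MD; rewrite leNgt; apply/negP => tb.
  by have := lt_trans bD (lt_mass_int p2 at_ tb); rewrite ltNge MD.
set T := d ^- 2.
have tT t : adm t -> f t <= f t1 -> b <= t <= T.
  move=> at_ /(H _ at_)/andP[dM MD]; rewrite bP//=.
  by rewrite leNgt; apply/negP => /ltW/(mass_int_lt_of_sqr d0); rewrite ltNge dM.
have /andP[bt1 t1T] := tT _ at1 (lexx _).
have [||c] := @EVT_min _ (fun t => f (Num.max b t)) b T.
- exact: le_trans t1T.
- exact/continuous_subspaceT/cf.
rewrite in_itv/= => /andP[bc _]; rewrite (max_r bc) => cmin.
exists c; first exact: admissible_le bc.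
move=> t at_; have [ft|/ltW ft] := leP (f t) (f t1).
  have /andP[bt tT'] := tT _ at_ ft.
  by have := cmin t; rewrite in_itv/= bt tT' (max_r bt); exact.
apply: le_trans ft; have := cmin t1.
by rewrite in_itv/= bt1 t1T (max_r bt1); exact.
Qed.

Lemma mass_int_le_threshold t m : adm t -> N t <= m ->
  M t <= m / (q * (G 0 / 2)) `^ sg^-1.
Proof.
move=> at_ Nm.
have G0 : 0 < q * (G 0 / 2) by rewrite mulr_gt0// divr_gt0// slope_int0_gt0.
rewrite ler_pdivlMr ?powR_gt0//; apply: le_trans Nm.
rewrite /threshold ler_pM2l ?mass_int_gt0//.
apply: ge0_ler_powR; rewrite ?nnegrE ?invr_ge0.
- exact: ltW.
- exact: ltW.
- exact/ltW/mulr_gt0/energy_int_gt0.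
- by rewrite ler_pM2l// energy_int_ge.
Qed.

(** From [M K >= 1/2] one gets N^s = M^(s-1) q M K >= M^(s-1) q/2. As s < 1, a bounded threshold
    keeps [M] away from 0. *)
Lemma mass_int_ge_threshold t m : q != 4 -> adm t -> 0 < m -> N t <= m ->
  (q / 2 / m `^ sg) `^ (1 - sg)^-1 <= M t.
Proof.
move=> q4 at_ m0 Nm; have s1 : 0 < 1 - sg by rewrite subr_gt0 mass_exponent_lt1.
have M0 := mass_int_gt0 p2 at_; have K0 := energy_int_gt0 at_.
have X0 : 0 < q / 2 / m `^ sg by rewrite !divr_gt0 ?powR_gt0.
rewrite -[leRHS](powRK (lt0r_neq0 s1) (ltW M0)).
apply: ge0_ler_powR; rewrite ?nnegrE ?invr_ge0 ?powR_ge0//; [exact: ltW|exact: ltW|].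
rewrite ler_pdivrMr ?powR_gt0//.
have NE : N t `^ sg = M t `^ sg * (q * K t).
  rewrite /threshold (powRM _ (ltW M0) (powR_ge0 _ _)) powRVK ?gt_eqF//.
  exact/ltW/mulr_gt0.
have h : N t `^ sg <= m `^ sg.
  by rewrite ge0_ler_powR ?nnegrE// ltW// threshold_gt0.
have -> : M t `^ (1 - sg) * m `^ sg = M t * (m `^ sg / M t `^ sg).
  by rewrite powRB ?powRr1 ?(ltW M0) ?(gt_eqF M0) ?implybT// -mulrA (mulrC _^-1).
apply: (@le_trans _ _ (M t * (q * K t))).
  by rewrite mulrCA ler_pM2l// mul_mass_energy_ge.
by rewrite ler_pM2l// ler_pdivlMr ?powR_gt0// mulrC -NE.
Qed.

Lemma threshold_min : q != 4 -> exists2 t0, adm t0 & forall t, adm t -> N t0 <= N t.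
Proof.
move=> q4; have a1 : adm 1 by left.
have N0 := threshold_gt0 a1.
apply: (@exists_min N 1 ((q / 2 / N 1 `^ sg) `^ (1 - sg)^-1)
          (N 1 / (q * (G 0 / 2)) `^ sg^-1)) => //.
- exact: continuous_threshold.
- by rewrite powR_gt0 ?divr_gt0 ?powR_gt0.
- by move=> t at_ Nt; rewrite mass_int_ge_threshold//= mass_int_le_threshold.
Qed.

(** This serves [q = 4], where the exponent [1 - sg] is 0 and the bound through the threshold
    degenerates. An energy at most [- e] bounds the amplitude [A] from below, and
    [M t = m A^(p/2-3)] has a positive exponent for [p > 6]. *)
Lemma mass_int_ge_reduced_energy t m e : 6 < p -> adm t -> 0 < m -> 0 < e ->
  F t m <= - e -> m * (q * e) `^ (q^-1 * (p / 2 - 3)) <= M t.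
Proof.
move=> p6 at_ m0 e0 Fe; have A0 := amplitude_gt0 at_ m0.
have M0 := mass_int_gt0 p2 at_.
have qe : q * e <= a t m `^ q.
  rewrite -ler_pdivlMl// mulrC -[leLHS]opprK lerNl; apply: le_trans Fe.
  rewrite mulrC lerDr; apply: mulr_ge0; first exact: powR_ge0.
  exact/ltW/energy_int_gt0.
have -> : M t = m * a t m `^ (p / 2 - 3).
  rewrite -{1}(amplitude_mass at_ m0) mulrAC -powRD; last by rewrite (gt_eqF A0) implybT.
  by rewrite (_ : 3 - p / 2 + (p / 2 - 3) = 0) ?powRr0 ?mul1r//; ring.
rewrite ler_pM2l// powRrM; apply: ge0_ler_powR; rewrite ?nnegrE ?powR_ge0//; first lra.
rewrite -[leRHS](powRK (lt0r_neq0 q0) (ltW A0)).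
apply: ge0_ler_powR; rewrite ?nnegrE ?powR_ge0 ?invr_ge0//; first exact: ltW.
by apply/ltW/mulr_gt0.
Qed.

Lemma reduced_energy_min t1 m : adm t1 -> 0 < m -> F t1 m < 0 ->
  exists2 t0, adm t0 & forall t, adm t -> F t0 m <= F t m.
Proof.
move=> at1 m0 F1.
have [d d0 dP] : exists2 d, 0 < d & forall t, adm t -> F t m <= F t1 m -> d <= M t.
  have [q4|q4] := eqVneq q 4; last first.
    exists ((q / 2 / m `^ sg) `^ (1 - sg)^-1).
      by rewrite powR_gt0 ?divr_gt0 ?powR_gt0.
    move=> t at_ Ft; apply: mass_int_ge_threshold => //.
    by rewrite -(reduced_energy_le0 at_ m0) (le_trans Ft) ?ltW.
  have p6 : 6 < p by case: hpq => [[_]|[]//]; rewrite q4 ltxx andbF.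
  have e0 : 0 < - F t1 m by rewrite oppr_gt0.
  exists (m * (q * - F t1 m) `^ (q^-1 * (p / 2 - 3))).
    by rewrite mulr_gt0 ?powR_gt0 ?mulr_gt0.
  by move=> t at_ Ft; apply: mass_int_ge_reduced_energy => //; rewrite opprK.
apply: (@exists_min (F^~ m) t1 d (m / (q * (G 0 / 2)) `^ sg^-1)) => //.
  by move=> b; exact: continuous_reduced_energy.
move=> t at_ Ft; rewrite dP//=; apply: mass_int_le_threshold => //.
by rewrite -(reduced_energy_le0 at_ m0) (le_trans Ft) ?ltW.
Qed.

Lemma sqr_mass_int_lt1 t : 0 < t -> M t * M t * t < 1.
Proof.
move=> t0; have M0 : 0 < M t by apply: mass_int_gt0 => //; left.
have tE : t = t `^ (2^-1) * t `^ (2^-1).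
  by rewrite powR12_sqrt ?(ltW t0)// -expr2 sqr_sqrtr// ltW.
have h : M t * t `^ 2^-1 < 1.
  by have := mass_int_lt p2 t0; rewrite powRN -[X in _ < X]div1r ltr_pdivlMr ?powR_gt0.
have h0 : 0 <= M t * t `^ 2^-1 by rewrite mulr_ge0 ?powR_ge0 ?(ltW M0).
by rewrite [X in _ * X]tE mulrACA; exact: mulr_ilt1.
Qed.

(** Here N = 4 M G - 2 t M^2, with M G >= 1 and t M^2 < 1. *)
Lemma threshold_gt2 t : q = 4 -> 0 < t -> 2 < N t.
Proof.
move=> q4 t0; have at_ : adm t by left.
have M0 := mass_int_gt0 p2 at_.
have MG := mul_mass_slope_ge1 p2 at_.
have Mt := sqr_mass_int_lt1 t0.
rewrite /threshold mass_exponent_eq1// invr1 powRr1; last first.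
  exact/ltW/mulr_gt0/energy_int_gt0.
rewrite q4 /energy_int; move: (M t) (G t) M0 MG Mt => x y; lra.
Qed.

Lemma threshold_lt m : q = 4 -> 2 < m -> exists2 t, 0 < t & N t < m.
Proof.
move=> q4 m2; have c0 : 0 < 2 / p by rewrite divr_gt0.
(* The quotient makes the error of order 1/t in [mass_energy_arith] smaller than [m - 2]; the added
   1 makes the inequality strict. *)
pose t := 4 * (2 / p) / (m - 2) + 1.
have m2' : 0 < m - 2 by rewrite subr_gt0.
have t0 : 0 < t by rewrite addr_gt0// divr_gt0// mulr_gt0.
have tm : 4 * (2 / p) < t * (m - 2) by rewrite /t [X in _ < X]mulrDl divfK ?(gt_eqF m2')// ltrDl mul1r.
exists t => //; have at_ : adm t by left.
have M0 := mass_int_gt0 p2 at_.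
have ct : 0 < 2 / p + t by rewrite addr_gt0.
have GE := slope_int_le p2 (ltW t0).
rewrite powR12_sqrt ?(ltW ct)// in GE.
set S := Num.sqrt (2 / p + t) in GE.
have S0 : 0 < S by rewrite sqrtr_gt0.
have SE : S * S = 2 / p + t by rewrite -expr2 sqr_sqrtr// ltW.
have MG := mul_mass_slope_ge1 p2 at_.
have MS : 1 <= M t * S by apply: (le_trans MG); rewrite ler_pM2l.
have Mt := sqr_mass_int_lt1 t0.
rewrite /threshold mass_exponent_eq1// invr1 powRr1; last first.
  exact/ltW/mulr_gt0/energy_int_gt0.
have MGS : M t * G t <= M t * S by rewrite ler_pM2l.
have xE : (M t * S) * (M t * S) = M t * M t * (2 / p + t) by rewrite mulrACA SE.
rewrite q4 /energy_int; exact: (mass_energy_arith t0 c0 tm Mt MGS MS xE).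
Qed.

End Reduced.

(** * The ground state energy *)

Section GroundEnergy.
Context {R : realType}.
Variables (p q : R) (hpq : exponents p q).
Implicit Types (t m A : R) (u : R -> R).
Notation M := (mass_int p).
Notation G := (slope_int p).
Notation K := (energy_int p).
Notation a := (amplitude p).
Notation sg := (mass_exponent p q).
Notation F := (reduced_energy p q).
Notation N := (threshold p q).
Notation adm := (admissible p).
Notation E := (energy p q).
Notation GE := (ground_energy p q).

Let p2 : 2 < p.
Proof. by case: hpq => [[/andP[]]|[p6 _]]; lra. Qed.

Let q2 : 2 < q.
Proof. by case: hpq => -[p6 /andP[q1 q3]]; move: p2 => ?; lra. Qed.

Let p0 : 0 < p. Proof. by apply: lt_trans p2. Qed.
Let q0 : 0 < q. Proof. by apply: lt_trans q2. Qed.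
Let qn0 : q != 0. Proof. exact: lt0r_neq0. Qed.

Let a1 : adm 1. Proof. by left. Qed.

Lemma ground_energy_le m u : H1mass m u -> (GE m <= E u)%E.
Proof. by move=> um; apply: ereal_inf_lbound; exists u. Qed.

Lemma le_ground_energy m (y : \bar R) : (forall u, H1mass m u -> y <= E u)%E -> (y <= GE m)%E.
Proof. by move=> h; apply: le_ereal_inf_tmp => _ [u um <-]; exact: h. Qed.

Lemma powR_mul_pred A : 0 < A -> A ^+ 2 * A `^ (p / 2 - 1) = A `^ (p / 2 + 1).
Proof.
move=> A0; rewrite -powR_mulrn ?(ltW A0)// -powRD ?(gt_eqF A0) ?implybT//.
by congr (_ `^ _); ring.
Qed.

Lemma powR_div_pred A : 0 < A -> A `^ p / A `^ (p / 2 - 1) = A `^ (p / 2 + 1).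
Proof.
move=> A0; rewrite -powRB ?(gt_eqF A0) ?implybT//.
by congr (_ `^ _); field.
Qed.

Lemma powR_mass A : 0 < A -> A ^+ 2 / A `^ (p / 2 - 1) = A `^ (3 - p / 2).
Proof.
move=> A0; rewrite -powR_mulrn ?(ltW A0)// -powRB ?(gt_eqF A0) ?implybT//.
by congr (_ `^ _); ring.
Qed.

Lemma reduced_energy_attained t m : adm t -> 0 < m ->
  exists2 u, H1mass m u & E u = (F t m)%:E.
Proof.
move=> at_ m0; have A0 := amplitude_gt0 hpq at_ m0.
have [u um uE] := test_function q p2 at_ A0 (powR_gt0 (p / 2 - 1) A0).
exists u; first by rewrite -{1}(amplitude_mass hpq at_ m0) -powR_mass.
rewrite uE; congr EFin; rewrite powR_mul_pred// powR_div_pred//.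
by rewrite /reduced_energy /energy_int; field.
Qed.

Lemma reduced_energy_amplitude t A (m := A `^ (3 - p / 2) * M t) : adm t -> 0 < A ->
  F t m = A `^ (p / 2 + 1) * G t - t * A `^ (p - 2) / 2 * m - q^-1 * A `^ q.
Proof.
move=> at_ A0; rewrite /reduced_energy (amplitude_unique hpq at_ A0) /m /energy_int.
have -> : A `^ (p / 2 + 1) = A `^ (p - 2) * A `^ (3 - p / 2).
  by rewrite -powRD ?(gt_eqF A0) ?implybT//; congr (_ `^ _); field.
by ring.
Qed.

(** The parameter [t] is chosen so that the scaled profile of height |u 0| has mass [m], which turns
    [energy_ge] into a comparison with the reduced energy. Positive energy is kept as an
    alternative; it is harmless since the infimum is at most 0. *)
Lemma energy_ge_reduced m u : 0 < m -> H1mass m u ->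
  (0 < E u)%E \/
  exists2 t, adm t & ((F t m)%:E <= E u)%E /\
    ((E u <= (F t m)%:E)%E ->
       u = scaled_profile p t (a t m) \/ u = \- scaled_profile p t (a t m)).
Proof.
move=> m0 um; have [u0|un0] := eqVneq (u 0) 0; first by left; exact: (energy_gt0 p0 _ um).
set A := `|u 0|; have A0 : 0 < A by rewrite normr_gt0.
have Vm t : A `^ (3 - p / 2) * (m * A `^ (p / 2 - 3)) = m.
  rewrite mulrCA -powRD ?(gt_eqF A0) ?implybT//.
  by rewrite (_ : 3 - p / 2 + (p / 2 - 3) = 0) ?powRr0 ?mulr1//; ring.
have v0 : 0 < m * A `^ (p / 2 - 3) by rewrite mulr_gt0 ?powR_gt0.
have H b : adm b -> m * A `^ (p / 2 - 3) <= M b ->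
    exists2 t, adm t & ((F t m)%:E <= E u)%E /\
    ((E u <= (F t m)%:E)%E ->
       u = scaled_profile p t (a t m) \/ u = \- scaled_profile p t (a t m)).
  move=> ab vb; have [t at_ tv] := exists_mass_int hpq ab v0 vb.
  have mE : m = A `^ (3 - p / 2) * M t by rewrite tv Vm.
  have [h1 h2] := energy_ge q p2 at_ um un0.
  have FE : F t m = A `^ (p / 2 + 1) * G t - t * A `^ (p - 2) / 2 * m - q^-1 * A `^ q.
    by rewrite {1}mE (reduced_energy_amplitude at_ A0) -mE.
  have aE : a t m = A by rewrite mE (amplitude_unique hpq at_ A0).
  by exists t => //; rewrite FE aE; split.
have [p6|p6] : p < 6 \/ 6 < p.
  by case: hpq => [[/andP[_ ?] _]|[? _]]; [left|right].
  have adm0 : adm 0 by right.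
  have [vM|Mv] := leP (m * A `^ (p / 2 - 3)) (M 0); first by right; exact: H vM.
  (* At this height even the profile with [t = 0] has mass [m' < m]. The bound at [t = 0] is
     independent of the mass and equals [F 0 m']; this is positive if [m' < N 0], and otherwise
     raising the mass to [m] strictly lowers [F 0]. *)
  pose m' := A `^ (3 - p / 2) * M 0.
  have m'0 : 0 < m' by rewrite mulr_gt0 ?powR_gt0 ?(mass_int_gt0 p2 adm0).
  have m'm : m' < m by rewrite -[ltRHS](Vm 0) ltr_pM2l ?powR_gt0.
  have [h1 _] := energy_ge q p2 adm0 um un0.
  have FE : ((F 0 m')%:E <= E u)%E.
    by apply: le_trans h1; rewrite lee_fin reduced_energy_amplitude// !mul0r.
  have [Nm|Nm] := leP (N 0) m'; last first.
    left; apply: lt_le_trans FE; rewrite lte_fin ltNge.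
    by rewrite (reduced_energy_le0 hpq adm0 m'0) -ltNge.
  have lt : ((F 0 m)%:E < E u)%E.
    by apply: lt_le_trans FE; rewrite lte_fin lt_reduced_energy.
  right; exists 0; first exact: adm0.
  split; first exact: ltW lt.
  by rewrite leNgt lt.
have [b b0 /ltW bv] := mass_int_unbounded p2 (m * A `^ (p / 2 - 3)) p6.
by right; apply: (H b) => //; left.
Qed.

Lemma ground_energy_le_reduced t m : adm t -> 0 < m -> (GE m <= (F t m)%:E)%E.
Proof.
by move=> at_ m0; have [u um <-] := reduced_energy_attained at_ m0; exact: ground_energy_le.
Qed.

(** Spreading a fixed profile out at constant mass, with dilation [l] tending to 0 and squared
    height proportional to [l], makes the gradient and L^p terms vanish; the point term has the
    favourable sign. *)
Lemma ground_energy_le0 m : 0 < m -> (GE m <= 0)%E.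
Proof.
move=> m0; apply/lee_addgt0Pr => e e0; rewrite add0e.
have M0 := mass_int_gt0 p2 a1.
pose A l := Num.sqrt (l * m / M 1).
pose C := `|m / M 1 / 2 * G 1| + `|(m / M 1) `^ (p / 2) * ((G 1 - 1 * M 1) / 2)| + 1.
have C0 : 0 < C by rewrite ltr_wpDl// addr_ge0.
pose k := p / 2 - 1; have k0 : 0 < k by rewrite subr_gt0 ltr_pdivlMr// mul1r.
(* The two positive terms are of orders [l^2] and [l^k]. With [l = d^(1/r)] and [d <= 1] both powers
   are at most [d], and [d * C <= e] finishes the estimate. *)
pose r := Num.min 2 k; have r0 : 0 < r by rewrite lt_min k0 ltr0n.
pose d := Num.min 1 (e / C); have d0 : 0 < d by rewrite lt_min ltr01 divr_gt0.
pose l := d `^ r^-1; have l0 : 0 < l by exact: powR_gt0.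
have l1 : l <= 1 by rewrite powR_le1 ?invr_gt0 ?(ltW d0)// ge_min lexx.
have lr : l `^ r = d by rewrite powRVK ?(gt_eqF r0) ?(ltW d0).
have l2 : l ^+ 2 <= d.
  rewrite -lr -powR_mulrn ?(ltW l0)//; apply: ger_powR; first by rewrite l0.
  by rewrite ge_min lexx.
have lk : l `^ k <= d.
  by rewrite -lr; apply: ger_powR; [rewrite l0|rewrite ge_min lexx orbT].
have lm0 : 0 < l * m / M 1 by rewrite divr_gt0// mulr_gt0.
have A0 : 0 < A l by rewrite sqrtr_gt0.
have A2 : A l ^+ 2 = l * m / M 1 by rewrite sqr_sqrtr// ltW.
have [u um uE] := test_function q p2 a1 A0 l0.
have mE : A l ^+ 2 / l * M 1 = m.
  by rewrite A2; field; rewrite (gt_eqF M0) (gt_eqF l0).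
rewrite mE in um; apply: (le_trans (ground_energy_le um)); rewrite uE lee_fin.
have Ap : A l `^ p / l = l `^ k * (m / M 1) `^ (p / 2).
  have -> : A l `^ p = (l * (m / M 1)) `^ (p / 2).
    rewrite mulrA -A2 -powR_mulrn ?(ltW A0)// -powRrM; by congr (_ `^ _); field.
  rewrite powRM ?(ltW l0) ?(ltW (divr_gt0 m0 M0))// mulrAC; congr (_ * _).
  rewrite -[X in _ / X](powRr1 (ltW l0)) -powRB// (gt_eqF l0) implybT//.
rewrite Ap A2.
have T1 : l * m / M 1 * l / 2 * G 1 <= d * `|m / M 1 / 2 * G 1|.
  have -> : l * m / M 1 * l / 2 * G 1 = l ^+ 2 * (m / M 1 / 2 * G 1).
    by rewrite expr2; field; rewrite gt_eqF.
  apply: (@le_trans _ _ (l ^+ 2 * `|m / M 1 / 2 * G 1|)).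
    by rewrite ler_pM2l ?exprn_gt0// ler_norm.
  by rewrite ler_wpM2r.
have T2 : l `^ k * (m / M 1) `^ (p / 2) * ((G 1 - 1 * M 1) / 2) <=
    d * `|(m / M 1) `^ (p / 2) * ((G 1 - 1 * M 1) / 2)|.
  rewrite -mulrA; apply: (le_trans (ler_norm _)); rewrite normrM.
  by rewrite ler_wpM2r// ger0_norm// powR_ge0.
have T3 : 0 <= q^-1 * A l `^ q by rewrite mulr_ge0 ?powR_ge0// invr_ge0 ltW.
have T4 : d * C <= e by rewrite -ler_pdivlMr// ge_min lexx orbT.
move: T4; rewrite /C 2!mulrDr mulr1 => T4.
move: (l * m / M 1 * l / 2 * G 1) (l `^ k * _ * _) (q^-1 * _) (d * `|_|) (d * `|_|) T1 T2 T3 T4.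
move=> x y z w v; lra.
Qed.

Lemma ground_energy_ge0 m : 0 < m -> (forall t, adm t -> m <= N t) -> (0 <= GE m)%E.
Proof.
move=> m0 H; apply: le_ground_energy => u um.
have [/ltW//|[t at_ [FE _]]] := energy_ge_reduced m0 um.
apply: le_trans FE; rewrite lee_fin leNgt (reduced_energy_lt0 hpq at_ m0).
by rewrite -leNgt H.
Qed.

Lemma ground_energy_lt0 t m : adm t -> 0 < m -> N t < m -> (GE m < 0)%E.
Proof.
move=> at_ m0 Nm; apply: (le_lt_trans (ground_energy_le_reduced at_ m0)).
by rewrite lte_fin (reduced_energy_lt0 hpq at_ m0).
Qed.

Lemma reduced_min_ground_state t m : adm t -> 0 < m -> F t m <= 0 ->
  (forall s, adm s -> F t m <= F s m) ->
  exists2 u, ground_state p q m u & GE m = (F t m)%:E.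
Proof.
move=> at_ m0 F0 Fmin; have [u um uE] := reduced_energy_attained at_ m0.
have GEE : GE m = (F t m)%:E.
  apply/eqP; rewrite eq_le ground_energy_le_reduced//=.
  apply: le_ground_energy => v vm.
  have [/ltW|[s as_ [FE _]]] := energy_ge_reduced m0 vm.
    by apply: le_trans; rewrite lee_fin.
  by apply: le_trans FE; rewrite lee_fin Fmin.
by exists u => //; split=> //; rewrite uE GEE.
Qed.

Lemma ground_state_reduced m u : 0 < m -> ground_state p q m u ->
  exists2 t, adm t & GE m = (F t m)%:E /\
    [/\ F t m <= 0, N t <= m &
       u = scaled_profile p t (a t m) \/ u = \- scaled_profile p t (a t m)].
Proof.
move=> m0 [um uE]; have E0 := ground_energy_le0 m0.
have [|[t at_ [FE H]]] := energy_ge_reduced m0 um; first by rewrite uE ltNge E0.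
have GF := ground_energy_le_reduced at_ m0.
have F0 : F t m <= 0 by rewrite -lee_fin; apply: le_trans E0; rewrite -uE.
exists t => //; split; first by apply/eqP; rewrite eq_le GF -uE FE.
by split=> //; [rewrite -reduced_energy_le0|apply: H; rewrite uE].
Qed.

Lemma ground_state_exists t m : adm t -> 0 < m -> N t < m ->
  exists u t0, [/\ adm t0, ground_state p q m u & GE m = (F t0 m)%:E].
Proof.
move=> at_ m0 Nm; have F0 : F t m < 0 by rewrite reduced_energy_lt0.
have [t0 at0 Fmin] := reduced_energy_min hpq at_ m0 F0.
have [|u gu GEE] := reduced_min_ground_state at0 m0 _ Fmin.
  exact: le_trans (Fmin _ at_) (ltW F0).
by exists u, t0.
Qed.

Lemma lt_ground_energy t m1 m2 : adm t -> 0 < m1 -> N t < m1 -> m1 < m2 ->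
  (GE m2 < GE m1)%E.
Proof.
move=> at_ m10 Nm m12; have m20 := lt_trans m10 m12.
have [u [t0 [at0 [um uE] GEE]]] := ground_state_exists at_ m10 Nm.
have G0 := ground_energy_lt0 at_ m10 Nm.
have [p6|p6] : p < 6 \/ 6 < p.
  by case: hpq => [[/andP[_ ?] _]|[? _]]; [left|right].
  (* For [p < 6] the optimal [t0] at mass [m1] is kept: [N t0 <= m1], and along this branch the
     energy decreases with the mass. *)
  apply: (le_lt_trans (ground_energy_le_reduced at0 m20)).
  have N0 : N t0 <= m1.
    by rewrite -(reduced_energy_le0 hpq at0 m10) -lee_fin -GEE; exact: ltW.
  by rewrite GEE lte_fin; exact: (lt_reduced_energy hpq p6 at0 m10 N0 m12).
(* For [p > 6] the height is kept and [t] is lowered: the lower bound [energy_ge]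
   decreases with the mass. *)
have un0 : u 0 != 0.
  apply/eqP => u0; have := energy_gt0 p0 qn0 um m10 u0.
  by rewrite uE ltNge (ltW G0).
pose A := `|u 0|; have A0 : 0 < A by rewrite normr_gt0.
have v0 : 0 < m2 * A `^ (p / 2 - 3) by rewrite mulr_gt0 ?powR_gt0.
have [b b0 /ltW bv] := mass_int_unbounded p2 (m2 * A `^ (p / 2 - 3)) p6.
have ab : adm b by left.
have [t2 at2 tv] := exists_mass_int hpq ab v0 bv.
have t20 : 0 < t2 by case: at2 => // -[_]; rewrite ltNge (ltW p6).
have mE : m2 = A `^ (3 - p / 2) * M t2.
  rewrite tv mulrCA -powRD ?(gt_eqF A0) ?implybT//.
  by rewrite (_ : 3 - p / 2 + (p / 2 - 3) = 0) ?powRr0 ?mulr1//; ring.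
apply: (le_lt_trans (ground_energy_le_reduced at2 m20)).
rewrite -uE; have [h _] := energy_ge q p2 at2 um un0.
apply: lt_le_trans h; rewrite lte_fin mE reduced_energy_amplitude// -mE -/A.
have h : t2 * A `^ (p - 2) / 2 * m1 < t2 * A `^ (p - 2) / 2 * m2.
  by rewrite ltr_pM2l// divr_gt0// mulr_gt0// powR_gt0.
by rewrite ltrD2r ltrD2l ltrN2.
Qed.

(** At mass 0 the compensating term of [energy_ge] disappears, so a large [t] makes the bound
    nonnegative: [t = b^2] is such that [A^(p/2+1) b] equals [A^q / q]. *)
Lemma ground_energy_mass0 : GE 0 = 0%E.
Proof.
have [z0 zE] := @zero_function R p q p0 qn0.
apply/eqP; rewrite eq_le -{1}zE ground_energy_le//=.
apply: le_ground_energy => u um; have [u0|un0] := eqVneq (u 0) 0.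
  rewrite /energy u0 normr0 powR0// mulr0 sube0.
  by rewrite adde_ge0// mule_ge0 ?poweR_ge0// lee_fin invr_ge0// ltW.
pose A := `|u 0|; have A0 : 0 < A by rewrite normr_gt0.
pose b := (A `^ (p / 2 + 1))^-1 * (q^-1 * A `^ q).
have b0 : 0 < b by rewrite !mulr_gt0 ?invr_gt0 ?powR_gt0.
have b2 : 0 < b ^+ 2 by rewrite exprn_gt0.
have ab : adm (b ^+ 2) by left.
have [h _] := energy_ge q p2 ab um un0; apply: le_trans h.
rewrite -/A mulr0 subr0 lee_fin subr_ge0 -ler_pdivrMl ?powR_gt0//.
have := slope_int_ge_sqrt p2 (ltW b2).
by rewrite powR12_sqrt ?(ltW b2)// sqrtr_sqr gtr0_norm.
Qed.

(** The infimum over the empty set; it makes the energy nonincreasing on the whole real line. *)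
Lemma ground_energy_lt0_mass m : m < 0 -> GE m = +oo%E.
Proof.
move=> m0; apply/eqP; rewrite eq_le leey/=; apply: le_ground_energy => u [_ um].
have := poweR_ge0 (Lpnorm 2 u) 2; rewrite um lee_fin leNgt m0//.
Qed.

End GroundEnergy.

(** * Behaviour for large mass *)

Section Asymptotics.
Context {R : realType}.
Variables (p q : R) (hpq : exponents p q).
Implicit Types (t m A : R) (u : R -> R).
Notation M := (mass_int p).
Notation G := (slope_int p).
Notation K := (energy_int p).
Notation a := (amplitude p).
Notation sg := (mass_exponent p q).
Notation F := (reduced_energy p q).
Notation N := (threshold p q).
Notation adm := (admissible p).
Notation E := (energy p q).
Notation GE := (ground_energy p q).

Let p2 : 2 < p.
Proof. by case: hpq => [[/andP[]]|[p6 _]]; lra. Qed.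

Let q2 : 2 < q.
Proof. by case: hpq => -[p6 /andP[q1 q3]]; move: p2 => ?; lra. Qed.

Let p0 : 0 < p. Proof. by apply: lt_trans p2. Qed.
Let q0 : 0 < q. Proof. by apply: lt_trans q2. Qed.
Let sg0 : 0 < sg. Proof. exact: mass_exponent_gt0. Qed.

(** The profile with [t = 0] suffices: as the mass grows, (N 0 / m)^s falls below 1/2 while the
    amplitude tends to infinity. *)
Lemma ground_energy_cvgNy : p < 6 -> GE m @[m --> +oo] --> -oo%E.
Proof.
move=> p6; have d0 : 0 < 3 - p / 2 by lra.
have half (x : R) : x <= 2^-1 -> x - 1 <= - 2^-1 by move=> ?; lra.
have lin (x y z : R) : 2 * z <= x -> - z <= y -> x * - 2^-1 <= y by move=> ? ?; lra.
have a0 : adm 0 by right.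
have M0 := mass_int_gt0 p2 a0; have N0 := threshold_gt0 hpq a0.
apply/cvgeNyPle => B.
pose X := 2 * q * `|B|; have X0 : 0 <= X by rewrite !mulr_ge0// ltW.
near=> m.
have m0 : 0 < m by near: m; exact: nbhs_pinfty_gt.
have Nm : N 0 / 2^-1 `^ sg^-1 <= m by near: m; apply: nbhs_pinfty_ge; exact: num_real.
have Am : X `^ q^-1 `^ (3 - p / 2) * M 0 <= m by near: m; apply: nbhs_pinfty_ge; exact: num_real.
apply: (le_trans (ground_energy_le_reduced hpq a0 m0)); rewrite lee_fin.
have h1 : (N 0 / m) `^ sg <= 2^-1.
  rewrite -[leRHS](powRVK (lt0r_neq0 sg0)) ?invr_ge0//.
  rewrite ge0_ler_powR ?nnegrE ?powR_ge0 ?(ltW sg0) ?(ltW (divr_gt0 N0 m0))//.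
  by rewrite ler_pdivrMr// mulrC -ler_pdivrMr// powR_gt0// invr_gt0.
have h2 : X <= a 0 m `^ q.
  rewrite -[leLHS](powRVK (lt0r_neq0 q0) X0).
  rewrite ge0_ler_powR ?nnegrE ?powR_ge0 ?(ltW q0)//.
  rewrite /amplitude -[leLHS](powRK (lt0r_neq0 d0) (powR_ge0 _ _)).
  rewrite ge0_ler_powR ?nnegrE ?powR_ge0 ?invr_ge0 ?(ltW d0) ?(ltW (divr_gt0 m0 M0))//.
  by rewrite ler_pdivlMr.
rewrite (reduced_energyE hpq a0 m0) -mulrA ler_pdivrMl//.
apply: (@le_trans _ _ (a 0 m `^ q * - 2^-1)).
  apply: ler_wpM2l; first exact: powR_ge0.
  exact: half.
have BB : - `|B| <= B by rewrite lerNl -normrN ler_norm.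
apply: (lin _ _ (q * `|B|)); first by rewrite mulrA.
by rewrite -mulrN ler_pM2l.
Unshelve. all: by end_near.
Qed.

(** Now p/2 + 1 > q and [K >= G 0 / 2], so the positive term of the reduced energy dominates once
    the amplitude reaches [B]; below [B] the negative term is at most [q^-1 B^q]. *)
Lemma ground_energy_bounded : 6 < p -> exists C, forall m, 0 < m -> ((- C)%:E <= GE m)%E.
Proof.
move=> p6; have qp : 0 < p / 2 + 1 - q.
  by case: hpq => [[]|[_]] /andP[]; lra.
have lin (x y z : R) : 0 <= x -> y <= z -> - z <= x - y by move=> ? ?; lra.
have G0 : 0 < G 0 := slope_int_gt0 p2 (lexx 0).
pose B := (2 / (q * G 0)) `^ (p / 2 + 1 - q)^-1.
have B0 : 0 <= B by exact: powR_ge0.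
have C0 : 0 <= q^-1 * B `^ q by rewrite mulr_ge0 ?powR_ge0// invr_ge0 ltW.
exists (q^-1 * B `^ q) => m m0; apply: le_ground_energy => u um.
have [/ltW|[t at_ [FE _]]] := energy_ge_reduced hpq m0 um.
  by apply: le_trans; rewrite lee_fin oppr_le0.
apply: le_trans FE; rewrite lee_fin.
have A0 := amplitude_gt0 hpq at_ m0; have KG := energy_int_ge hpq at_.
have K0 := energy_int_gt0 hpq at_.
rewrite /reduced_energy; set A := a t m in A0 *.
have [AB|BA] := leP A B.
  have : A `^ q <= B `^ q by rewrite ge0_ler_powR ?nnegrE ?(ltW q0) ?(ltW A0).
  move=> AqBq; have h : q^-1 * A `^ q <= q^-1 * B `^ q by rewrite ler_pM2l ?invr_gt0.
  exact: (lin _ _ _ (mulr_ge0 (powR_ge0 _ _) (ltW K0)) h).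
apply: (@le_trans _ _ 0); first by rewrite oppr_le0.
rewrite subr_ge0 (_ : p / 2 + 1 = q + (p / 2 + 1 - q)); last by ring.
rewrite powRD ?(gt_eqF A0) ?implybT// mulrC -mulrA ler_pM2l; last exact: powR_gt0.
have h : 2 / (q * G 0) <= A `^ (p / 2 + 1 - q).
  have X0 : 0 <= 2 / (q * G 0) by rewrite divr_ge0// ltW// mulr_gt0.
  rewrite -[leLHS](powRVK (lt0r_neq0 qp) X0).
  by rewrite ge0_ler_powR ?nnegrE ?(ltW qp) ?(ltW A0) ?(ltW BA).
apply: (@le_trans _ _ (2 / (q * G 0) * (G 0 / 2))).
  by rewrite le_eqVlt; apply/orP; left; apply/eqP; field; rewrite (gt_eqF q0) (gt_eqF G0).
by rewrite ler_pM// ?divr_ge0 ?mulr_ge0 ?(ltW q0) ?(ltW G0).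
Qed.

End Asymptotics.

(** * Stationarity under dilations for the exponent 4 *)

Section Stationarity.
Context {R : realType}.
Implicit Types (p t m r : R).

(** For [q = 4] the gradient term and the point term scale alike under mass-preserving dilations.
    The vanishing derivative then involves [slope_int] and [mass_int] only in the combination that
    [mass_slope_by_parts] evaluates. *)
Lemma stationary_mass p t m : 6 < p -> 0 < t -> 0 < m ->
  (forall u, H1mass m u -> ((reduced_energy p 4 t m)%:E <= energy p 4 u)%E) ->
  2 * ((2 / p + t) `^ 2^-1 * mass_int p t) = m.
Proof.
move=> p6 t0 m0 umin; have p2 : 2 < p by lra.
have at_ : admissible p t by left.
have M0 := mass_int_gt0 p2 at_.
pose A := amplitude p t m; have A0 : 0 < A by rewrite powR_gt0// divr_gt0.
pose P := A `^ (p / 2 + 1); have P0 : 0 < P by exact: powR_gt0.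
pose J := slope_int p t - t * mass_int p t.
pose phi r := P * (slope_int p t / 2 * r ^+ 4 + J / 2 * r `^ (p - 2)) - 4^-1 * A `^ 4 * r ^+ 4.
have mE : A `^ (3 - p / 2) * mass_int p t = m.
  have d0 : 3 - p / 2 != 0 by apply: ltr0_neq0; lra.
  by rewrite /A /amplitude (powRVK d0 (ltW (divr_gt0 m0 M0))) divfK// gt_eqF.
(* [phi r] is the energy of the profile with height [A * r], dilated so as to
   keep the mass [m]. *)
have phiE r : 0 < r -> exists2 u, H1mass m u & energy p 4 u = (phi r)%:E.
  move=> r0; have Ar0 : 0 < A * r by rewrite mulr_gt0.
  have l0 : 0 < A `^ (p / 2 - 1) * r ^+ 2 by apply: mulr_gt0; [exact: powR_gt0|exact: exprn_gt0].
  have [u um uE] := test_function 4 p2 at_ Ar0 l0.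
  exists u.
    rewrite -mE -(powR_mass p A0); congr (H1mass (_ * _) u) : um.
    by field; rewrite (gt_eqF r0) (gt_eqF (powR_gt0 _ A0)).
  rewrite uE /phi /P; congr EFin; rewrite !powRM ?(ltW A0) ?(ltW r0)//.
  rewrite (powR_mulrn 4 (ltW r0)).
  have -> : A `^ p = P * A `^ (p / 2 - 1).
    by rewrite /P -(powR_div_pred p A0) divfK// gt_eqF// powR_gt0.
  have -> : r `^ p = r `^ (p - 2) * r ^+ 2.
    by rewrite -(powR_mulrn 2 (ltW r0)) -powRD ?(gt_eqF r0) ?implybT//; congr (_ `^ _); ring.
  have -> : (A * r) ^+ 2 * (A `^ (p / 2 - 1) * r ^+ 2) = P * r ^+ 4.
    by rewrite /P -(powR_mul_pred p A0); ring.
  by rewrite -/P /J; field; rewrite (gt_eqF r0) (gt_eqF (powR_gt0 _ A0)).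
have phi1 : phi 1 = reduced_energy p 4 t m.
  by rewrite /phi /reduced_energy /energy_int /J -/A -/P powR1 !expr1n; field.
have dphi r : 0 < r -> is_derive r 1 phi
    (P * (slope_int p t / 2 * (4 * r ^+ 3) + J / 2 * ((p - 2) * r `^ (p - 2 - 1)))
      - 4^-1 * A `^ 4 * (4 * r ^+ 3)).
  move=> r0; have := is_derive1_powR (p - 2) r0 => h.
  rewrite /phi; apply: is_derive_eq; rewrite /GRing.scale/=; ring.
have d0 : is_derive (1 : R) 1 phi 0.
  apply: (@derive1_at_min _ phi 0 2 1); first exact: ler0n.
  - by move=> r; rewrite in_itv/= => /andP[r0 _]; have [] := dphi _ r0.
  - by rewrite in_itv/= ltr01 ltr1n.
  - move=> r; rewrite in_itv/= => /andP[r0 _].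
    by have [u um uE] := phiE _ r0; rewrite phi1 -lee_fin -uE umin.
have := @derive_val _ _ _ _ _ _ _ d0.
rewrite (@derive_val _ _ _ _ _ _ _ (dphi _ ltr01)) powR1 expr1n.
have -> : A `^ 4 = P * A `^ (3 - p / 2).
  by rewrite /P -powRD ?(gt_eqF A0) ?implybT//; congr (_ `^ _); field.
rewrite -(mass_slope_by_parts p2 t0) -mE /J.
move: (A `^ (3 - p / 2)) (slope_int p t) (mass_int p t) => x g n /eqP.
have -> : P * (g / 2 * (4 * 1) + (g - t * n) / 2 * ((p - 2) * 1)) - 4^-1 * (P * x) * (4 * 1) =
    P * (2 * ((1 + (p / 2 - 1) / 2) * g - (p / 2 - 1) / 2 * t * n) - x) by field.
by rewrite mulf_eq0 (gt_eqF P0)/= subr_eq0 mulrA => /eqP ->.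
Qed.

End Stationarity.

(** * The critical mass *)

Section Threshold.
Context {R : realType}.
Variables (p q : R) (hpq : exponents p q).
Notation adm := (admissible p).
Notation GE := (ground_energy p q).

Let p2 : 2 < p.
Proof. by case: hpq => [[/andP[]]|[p6 _]]; lra. Qed.

Let admissible_gt0 t : q = 4 -> adm t -> 0 < t.
Proof.
move=> q4 [//|[_ p6]]; case: hpq => [[_]|[p6']]; first by rewrite q4 ltxx andbF.
by have := lt_trans p6 p6'; rewrite ltxx.
Qed.

Lemma ground_state_unique m u w : q = 4 -> 0 < m ->
  ground_state p q m u -> ground_state p q m w -> w = u \/ w = \- u.
Proof.
move=> q4 m0 gu gw.
have p6 : 6 < p by case: hpq => [[_]|[]//]; rewrite q4 ltxx andbF.
have H v : ground_state p q m v -> exists2 t, 0 < t /\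
    2 * ((2 / p + t) `^ 2^-1 * mass_int p t) = m &
    v = scaled_profile p t (amplitude p t m) \/ v = \- scaled_profile p t (amplitude p t m).
  move=> gv; have [t at_ [GEE [_ _ vE]]] := ground_state_reduced hpq m0 gv.
  have t0 := admissible_gt0 q4 at_.
  exists t => //; split=> //; apply: stationary_mass => // y ym.
  by move: GEE; rewrite -q4 => <-; exact: ground_energy_le.
have [t [t0 tm] uE] := H u gu; have [s [s0 sm] wE] := H w gw.
have st : s = t.
  have at_ : adm t by left.
  have as_ : adm s by left.
  have E : (2 / p + s) `^ 2^-1 * mass_int p s = (2 / p + t) `^ 2^-1 * mass_int p t.
    have n2 : (2 : R) != 0 by rewrite pnatr_eq0.
    by apply: (mulfI n2); exact: etrans sm (esym tm).
  case: (ltgtP s t) => // st.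
    by have := lt_sqrt_mul_mass_int p2 as_ st; rewrite E ltxx.
  by have := lt_sqrt_mul_mass_int p2 at_ st; rewrite E ltxx.
rewrite {}st {s s0 sm} in wE.
have oppK (f : R -> R) : \- (\- f) = f by apply/funext => x /=; rewrite opprK.
by case: uE wE => -> [] ->; rewrite ?oppK; [left|right|right|left].
Qed.

(** The second and third clauses characterise [mut] as the infimum of [threshold]. The last two
    separate the cases: a minimum for [q != 4], and for [q = 4] the value 2, which every threshold
    exceeds. *)
Lemma critical_mass_exists : exists mut,
  [/\ 0 < mut, forall m, mut < m -> exists2 t, adm t & threshold p q t < m,
      forall t, adm t -> mut <= threshold p q t,
      q != 4 -> exists2 t, adm t & threshold p q t = mut & q = 4 -> mut = 2].
Proof.
have [q4|q4] := eqVneq q 4.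
  exists 2; split=> //.
  - by move=> m m2; have [t t0 tm] := threshold_lt hpq q4 m2; exists t => //; left.
  - by move=> t at_; apply/ltW/threshold_gt2 => //; exact: admissible_gt0.
have [t0 at0 tmin] := threshold_min hpq q4.
exists (threshold p q t0); split=> //.
- exact: threshold_gt0.
- by move=> m tm; exists t0.
- by move=> _; exists t0.
- by move=> q4'; rewrite q4' eqxx in q4.
Qed.

Variable mut : R.
Hypotheses (mut0 : 0 < mut)
  (mut_lt : forall m, mut < m -> exists2 t, adm t & threshold p q t < m)
  (mut_le : forall t, adm t -> mut <= threshold p q t).

Lemma ground_energy_eq0 m : 0 <= m <= mut -> GE m = 0%E.
Proof.
rewrite le_eqVlt => /andP[/predU1P[<- _|m0 mm]]; first exact: ground_energy_mass0.
apply/eqP; rewrite eq_le ground_energy_le0//= ground_energy_ge0// => t at_.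
exact: le_trans (mut_le at_).
Qed.

Lemma ground_energy_neg m : mut < m -> (GE m < 0)%E.
Proof.
by move=> mm; have [t at_ tm] := mut_lt mm; exact: ground_energy_lt0 (lt_trans mut0 mm) tm.
Qed.

Lemma ground_energy_decreasing m1 m2 : mut <= m1 -> m1 < m2 -> (GE m2 < GE m1)%E.
Proof.
rewrite le_eqVlt => /predU1P[<- mm|mm1 m12].
  by rewrite (@ground_energy_eq0 mut) ?lexx ?ltW// ground_energy_neg.
have [t at_ tm] := mut_lt mm1.
exact: (lt_ground_energy hpq at_ (lt_trans mut0 mm1) tm m12).
Qed.

(** Monotonicity on all of the line, negative masses included, is the form from which the limit at
    infinity is identified with the infimum. *)
Lemma ground_energy_nonincreasing : nonincreasing_fun GE.
Proof.
move=> x y; rewrite le_eqVlt => /predU1P[->//|xy].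
have [x0|x0] := ltP x 0; first by rewrite (ground_energy_lt0_mass p q x0) leey.
have [mx|xm] := leP mut x; first exact/ltW/ground_energy_decreasing.
rewrite (@ground_energy_eq0 x); last by rewrite x0 ltW.
exact: ground_energy_le0 (le_lt_trans x0 xy).
Qed.

Lemma ground_energy_cvg : 6 < p ->
  exists2 l : \bar R, GE m @[m --> +oo] --> l & (-oo < l)%E.
Proof.
move=> p6; have [C HC] := ground_energy_bounded hpq p6.
exists (ereal_inf (range GE)).
  exact: nonincreasing_cvge ground_energy_nonincreasing.
apply: (@lt_le_trans _ _ (- C)%:E); first exact: ltNyr.
apply: le_ereal_inf_tmp => _ [x _ <-].
apply: (@le_trans _ _ (GE (Num.max x 1))).
  by apply: HC; rewrite lt_max ltr01 orbT.
by apply: ground_energy_nonincreasing; rewrite le_max lexx.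
Qed.

Lemma ground_state_iff m : q != 4 -> (exists2 t, adm t & threshold p q t = mut) ->
  0 < m -> (exists u, ground_state p q m u) <-> mut <= m.
Proof.
move=> q4 [t0 at0 t0E] m0; split=> [[u gu]|].
  have [t at_ [_ [_ tm _]]] := ground_state_reduced hpq m0 gu.
  exact: le_trans (mut_le at_) tm.
rewrite le_eqVlt => /predU1P[mE|mm]; last first.
  have [t at_ tm] := mut_lt mm.
  by have [u [s [_ gu _]]] := ground_state_exists hpq at_ m0 tm; exists u.
have F0 : reduced_energy p q t0 m <= 0 by rewrite reduced_energy_le0// t0E mE.
have [|u gu _] := reduced_min_ground_state hpq at0 m0 F0; last by exists u.
(* At the critical mass no reduced energy is negative, so a parameter [t0] attaining the infimum of
   [threshold] is a minimiser. *)
move=> s as_; apply: (le_trans F0).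
by rewrite leNgt reduced_energy_lt0// -leNgt -mE mut_le.
Qed.

Lemma ground_state_iff4 m : q = 4 -> mut = 2 -> 0 < m ->
  (exists u, ground_state p q m u) <-> 2 < m.
Proof.
move=> q4 mE m0; split=> [[u gu]|]; last first.
  rewrite -mE => /mut_lt[t at_ tm].
  by have [u [s [_ gu _]]] := ground_state_exists hpq at_ m0 tm; exists u.
have [t at_ [_ [_ tm _]]] := ground_state_reduced hpq m0 gu.
by apply: lt_le_trans tm; apply: threshold_gt2 => //; exact: admissible_gt0.
Qed.

End Threshold.

Theorem theorem1p6 (R : realType) (p q : R)
  (hpq : (2 < p < 6 /\ p / 2 + 1 < q < 4) \/ (6 < p /\ 4 <= q < p / 2 + 1)) :
  exists mut : R,
    0 < mut /\
    (forall m : R, 0 <= m <= mut -> ground_energy p q m = 0%E) /\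
    (forall m : R, mut < m -> (ground_energy p q m < 0)%E) /\
    (forall m1 m2 : R, mut <= m1 -> m1 < m2 ->
       (ground_energy p q m2 < ground_energy p q m1)%E) /\
    (2 < p < 6 /\ p / 2 + 1 < q < 4 ->
       ground_energy p q m @[m --> +oo] --> (-oo)%E) /\
    (6 < p /\ 4 <= q < p / 2 + 1 ->
       exists2 l : \bar R, ground_energy p q m @[m --> +oo] --> l & (-oo < l)%E) /\
    (q != 4 -> forall m : R, 0 < m ->
       ((exists u : R -> R, ground_state p q m u) <-> mut <= m)) /\
    (q = 4 ->
       mut = 2 /\
       (forall m : R, 0 < m ->
          ((exists u : R -> R, ground_state p q m u) <-> 2 < m)) /\
       (forall m : R, 2 < m -> forall u w : R -> R,
          ground_state p q m u -> ground_state p q m w -> w = u \/ w = \- u)).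
Proof.
have hpq' : exponents p q := hpq.
have [mut [mut0 mut_lt mut_le mut_min mut2]] := critical_mass_exists hpq'.
exists mut; split=> //; split; first exact: ground_energy_eq0.
split; first exact: ground_energy_neg.
split; first exact: ground_energy_decreasing.
split; first by move=> [/andP[_ p6] _]; exact: ground_energy_cvgNy.
split; first by move=> [p6 _]; exact: (ground_energy_cvg hpq' mut0).
split; first by move=> q4 m m0; apply: ground_state_iff => //; exact: mut_min.
move=> q4; have mE := mut2 q4; split=> //; split.
  by move=> m m0; apply: (ground_state_iff4 hpq' mut_lt).
by move=> m m2 u w; apply: (ground_state_unique hpq' q4); exact: lt_trans m2.
Qed.
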